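(* Let $n\ge 1$ and let $f,g,u,v\in\mathrm{Sym}(\mathbb{C}^n)\cap H(\mathbb{C}^n)$. Then the following statements are equivalent: (a) $[T_{f+\overline{g}},T_{u+\overline{v}}]=0$, where $[A,B]=AB-BA$. (b) $\mathcal{B}[u\overline{g}-f\overline{v}]=u\overline{g}-f\overline{v}$. (c) For all $z\in\mathbb{C}^n$, $$u(z)\overline{g(z)}-f(z)\overline{v(z)}=g^*(\overline{z}-\partial_z)u(z)-v^*(\overline{z}-\partial_z)f(z).$$
   Context: $dV$ is Lebesgue measure on $\mathbb{C}^n$ and $d\mu(z)=\pi^{-n}e^{-|z|^2}dV(z)$. For $z,w\in\mathbb{C}^n$, $z\cdot w=\sum_k z_kw_k$ (bilinear) and $|z|^2=z\cdot\overline{z}$. $H(\mathbb{C}^n)$ is the space of entire functions and $F^2=L^2(\mathbb{C}^n,d\mu)\cap H(\mathbb{C}^n)$ is the Fock space, with reproducing kernel $K_z(w)=K(w,z)=e^{w\cdot\overline{z}}$. $\mathrm{Sym}(\mathbb{C}^n)$ is the set of complex measurable functions $u$ such that for every $c>0$ the function $u(z)e^{-c|z|^2}$ is essentially bounded. Berezin transform: $k(w,z)=K(w,z)/\sqrt{K(z,z)}$ and $\mathcal{B}[u](z)=\int_{\mathbb{C}^n}u(w)|k(w,z)|^2\,d\mu(w)$. Toeplitz operators: $T_\varphi=PM_\varphi$, where $M_\varphi$ is multiplication by $\varphi$ and $P$ is the orthogonal projection of $L^2(\mathbb{C}^n,d\mu)$ onto $F^2$; explicitly $T_\varphi F(z)=\int_{\mathbb{C}^n}\varphi(w)F(w)e^{z\cdot\overline{w}}\,d\mu(w)$.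 Such operators may be unbounded; identities between Toeplitz operators and their products are understood as identities on the (dense) linear span of the kernels $K_z$, $z\in\mathbb{C}^n$, where all the integrals involved converge. Notation $g^*(\overline{z}-\partial_z)f(z)$: for entire $g(z)=\sum_i a_iz^i$ (multi-indices $i$), $g^*(z)=\overline{g(\overline{z})}=\sum_i\overline{a_i}z^i$, and $$g^*(\overline{z}-\partial_z)f(z)=\sum_i\overline{a_i}\,(\overline{z}-\partial_z)^if(z),\qquad (\overline{z}-\partial_z)^if(z)=\sum_{l\le i}\binom{i}{l}(-1)^{|i-l|}\,\overline{z}^{\,l}\,\partial^{i-l}f(z),$$ where $\binom{i}{l}=\prod_k\binom{i_k}{l_k}$, $l\le i$ componentwise, $|i-l|=\sum_k(i_k-l_k)$, $\partial^j=\partial_1^{j_1}\cdots\partial_n^{j_n}$, $\partial_k=\partial/\partial z_k$. *)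

(* Defs.v *)
From HB Require Import structures.
From mathcomp Require Import all_boot all_order all_algebra.
From mathcomp Require Import complex.
From mathcomp Require Import all_classical all_reals all_analysis.
From mathcomp.analysis.showcase Require summability.

Set Implicit Arguments.
Unset Strict Implicit.
Unset Printing Implicit Defensive.

Import Order.TTheory GRing.Theory Num.Theory.
Import numFieldNormedType.Exports.

Local Open Scope classical_set_scope.
Local Open Scope ring_scope.
Local Open Scope complex_scope.

(* R[i] gets its modulus topology and its complex normed space structure, so   *)
(* that 'D_v and differentiable over R[i] are complex (not real) notions.      *)
HB.instance Definition _ (R : realType) := NormedModule.copy R[i] (R[i]^o).

Section complex_measurable.
Variable R : realType.

Definition to_reals (z : R[i]) : measurableTypeR R * measurableTypeR R :=
  (complex.Re z, complex.Im z).

Definition of_reals (p : measurableTypeR R * measurableTypeR R) : R[i] :=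
  p.1 +i* p.2.

Definition complex_display : measure_display.
Proof. exact: default_measure_display. Qed.

Definition complex_measurable : set_system R[i] :=
  preimage_set_system setT to_reals measurable.

Let complex_measurable_sigma : sigma_algebra setT complex_measurable.
Proof. exact/sigma_algebra_preimage/sigma_algebra_measurable. Qed.

Let complex_measurable0 : complex_measurable set0.
Proof. by case: complex_measurable_sigma. Qed.

Let complex_measurableC A : complex_measurable A -> complex_measurable (~` A).
Proof. by case: complex_measurable_sigma => _ mC _ mA; rewrite -setTD; exact: mC. Qed.

Let complex_measurable_bigcup (F : (set R[i])^nat) :
  (forall i, complex_measurable (F i)) -> complex_measurable (\bigcup_i F i).
Proof. by case: complex_measurable_sigma => _ _; exact. Qed.

HB.instance Definition _ := @isMeasurable.Build complex_display R[i]
  complex_measurable complex_measurable0 complex_measurableC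
  complex_measurable_bigcup.

Lemma measurable_of_reals : measurable_fun setT of_reals.
Proof.
move=> _ _ [A mA <-]; rewrite !setTI.
suff -> : of_reals @^-1` (to_reals @^-1` A) = A by [].
by apply/seteqP; split => -[x y].
Qed.

End complex_measurable.

Section row_measurable.
Context d (T : measurableType d) (n : nat).

Let coord (i : 'I_n) (x : 'rV[T]_n) : T := x ord0 i.

Let row0 : g_sigma_preimage coord set0.
Proof. exact: sigma_algebra0. Qed.

Let rowC A : g_sigma_preimage coord A -> g_sigma_preimage coord (~` A).
Proof. exact: sigma_algebraC. Qed.

Let row_bigcup (F : _^nat) : (forall i, g_sigma_preimage coord (F i)) ->
  g_sigma_preimage coord (\bigcup_i (F i)).
Proof. exact: sigma_algebra_bigcup. Qed.

HB.instance Definition _ := @isMeasurable.Build (measure_tuple_display d)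
  'rV[T]_n (g_sigma_preimage coord) row0 rowC row_bigcup.

End row_measurable.

Section sigma_finite.
Context d1 d2 (T1 : measurableType d1) (T2 : measurableType d2) (R : realType).
Local Open Scope ereal_scope.

Lemma sigma_finite_product (m1 : {sigma_finite_measure set T1 -> \bar R})
    (m2 : {sigma_finite_measure set T2 -> \bar R}) :
  sigma_finite setT (m1 \x m2).
Proof.
have /sigma_finiteP[F [TF ndF Foo]] := sigma_finiteT m1.
have /sigma_finiteP[G [TG ndG Goo]] := sigma_finiteT m2.
exists (fun n => F n `*` G n).
  rewrite -setXTT TF TG predeqE => -[x y]; split.
    move=> [/= [n _ Fnx] [k _ Gky]]; exists (maxn n k) => //; split.
    - by move: x Fnx; exact/subsetPset/ndF/leq_maxl.
    - by move: y Gky; exact/subsetPset/ndG/leq_maxr.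
  by move=> [n _ []/= ? ?]; split; exists n.
move=> k; have [? ?] := Foo k; have [? ?] := Goo k.
split; first exact: measurableX.
by rewrite product_measure1E// lte_mul_pinfty// ge0_fin_numE.
Qed.

Lemma sigma_finite_pushforward (mu : set T1 -> \bar R) (f : T1 -> T2)
    (g : T2 -> T1) :
  sigma_finite setT mu -> cancel f g -> measurable_fun setT g ->
  sigma_finite setT (pushforward mu f).
Proof.
move=> [F UF mF] fK mg.
exists (fun i => g @^-1` F i); first by rewrite -preimage_bigcup -UF preimage_setT.
move=> i; have [mFi Foo] := mF i; split.
  by rewrite -[X in measurable X]setTI; exact: mg.
rewrite /pushforward (_ : f @^-1` _ = F i)//.
by apply/seteqP; split=> x /=; rewrite fK.
Qed.

End sigma_finite.

Section lebesgue_complex.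
Variable R : realType.
Local Open Scope ereal_scope.

Lemma measurable_to_reals : measurable_fun setT (@to_reals R).
Proof. by move=> _ A mA; rewrite setTI; exists A => //; rewrite setTI. Qed.

Definition lebesgueC : set R[i] -> \bar R :=
  pushforward (@lebesgue_measure R \x @lebesgue_measure R) (@of_reals R).

Let lebesgueC0 : lebesgueC set0 = 0.
Proof. by rewrite /lebesgueC /pushforward preimage_set0 measure0. Qed.

Let lebesgueC_ge0 A : 0 <= lebesgueC A.
Proof. by rewrite /lebesgueC /pushforward measure_ge0. Qed.

Let lebesgueC_sigma_additive : semi_sigma_additive lebesgueC.
Proof.
apply: measure_semi_sigma_additive; exact: measurable_of_reals.
Qed.

HB.instance Definition _ := isMeasure.Build _ _ _ lebesgueC
  lebesgueC0 lebesgueC_ge0 lebesgueC_sigma_additive.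

Let lebesgueC_sigma_finite : sigma_finite setT lebesgueC.
Proof.
apply: (@sigma_finite_pushforward _ _ _ _ _ _ _ (@to_reals R)).
- exact: sigma_finite_product.
- by case.
- exact: measurable_to_reals.
Qed.

HB.instance Definition _ := Measure_isSigmaFinite.Build _ _ _ lebesgueC
  lebesgueC_sigma_finite.

End lebesgue_complex.

Section row_power.
Context d (T : measurableType d) (R : realType).
Variable mu : {sigma_finite_measure set T -> \bar R}.
Local Open Scope ereal_scope.

Definition row_cons n (p : T * 'rV[T]_n) : 'rV[T]_n.+1 :=
  row_mx (\row_(_ < 1) p.1) p.2.

Definition row_uncons n (x : 'rV[T]_n.+1) : T * 'rV[T]_n :=
  (x ord0 ord0, \row_(j < n) x ord0 (lift ord0 j)).

Lemma row_consK n : cancel (@row_cons n) (@row_uncons n).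
Proof.
move=> [a x]; rewrite /row_uncons /row_cons /=; congr pair.
  rewrite mxE; case: splitP => [j _|//]; by rewrite mxE.
apply/rowP => j; rewrite !mxE.
by case: splitP => k /=; [case: k => -[] |move=> /= []/ord_inj ->].
Qed.

Lemma measurable_row_coord n (i : 'I_n) :
  measurable_fun setT (fun x : 'rV[T]_n => x ord0 i).
Proof.
move=> _ Y mY; rewrite setTI; apply: sub_sigma_algebra => /=.
rewrite -bigcup_seq/=; exists i => /=; first by rewrite mem_index_enum.
by exists Y => //; rewrite setTI.
Qed.

Lemma measurable_fun_row d' (U : measurableType d') n (f : U -> 'rV[T]_n) :
  (forall i, measurable_fun setT (fun u => f u ord0 i)) -> measurable_fun setT f.
Proof.
move=> mf _ Y; rewrite setTI.
suff : g_sigma_preimage (fun i => (fun x : 'rV[T]_n => x ord0 i) \o f)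
    `<=` measurable.
  by rewrite g_sigma_preimage_comp => + mY; apply; exists Y => //; rewrite setTI.
apply: smallest_sub; first exact: sigma_algebra_measurable.
rewrite -bigcup_seq; apply: bigcup_sub => i _ A [B mB <-].
exact: mf.
Qed.

Lemma measurable_row_cons n : measurable_fun setT (@row_cons n).
Proof.
apply: measurable_fun_row => i.
rewrite (_ : (fun p : T * 'rV[T]_n => _) = fun p => match fintype.split
    (i : 'I_(1 + n)) with inl _ => p.1 | inr j => p.2 ord0 j end); last first.
  apply/funext => p; rewrite /row_cons mxE.
  by case: fintype.split => // j; rewrite mxE.
case: fintype.split => j; first exact: measurable_fst.
apply: (measurableT_comp (measurable_row_coord j)).
exact: measurable_snd.
Qed.

Lemma measurable_row_uncons n : measurable_fun setT (@row_uncons n).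
Proof.
apply: measurable_fun_pair; first exact: measurable_row_coord.
apply: measurable_fun_row => i; under eq_fun do rewrite mxE.
exact: measurable_row_coord.
Qed.

Section succ.
Variables (n : nat) (m : {sigma_finite_measure set 'rV[T]_n -> \bar R}).

Definition row_succ : set 'rV[T]_n.+1 -> \bar R :=
  pushforward (mu \x m) (@row_cons n).

Let row_succ0 : row_succ set0 = 0.
Proof. by rewrite /row_succ /pushforward preimage_set0 measure0. Qed.

Let row_succ_ge0 A : 0 <= row_succ A.
Proof. by rewrite /row_succ /pushforward measure_ge0. Qed.

Let row_succ_sigma_additive : semi_sigma_additive row_succ.
Proof.
apply: measure_semi_sigma_additive; exact: measurable_row_cons.
Qed.

HB.instance Definition _ := isMeasure.Build _ _ _ row_succ
  row_succ0 row_succ_ge0 row_succ_sigma_additive.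

Let row_succ_sigma_finite : sigma_finite setT row_succ.
Proof.
exact: (sigma_finite_pushforward (sigma_finite_product mu m)
  (@row_consK n) (@measurable_row_uncons n)).
Qed.

HB.instance Definition _ := Measure_isSigmaFinite.Build _ _ _ row_succ
  row_succ_sigma_finite.

End succ.

(* The n-fold product measure, coordinate by coordinate.                        *)
Fixpoint row_power n : {sigma_finite_measure set 'rV[T]_n -> \bar R} :=
  if n is n'.+1 then row_succ (row_power n') else \d_point.

End row_power.

Section fock.
Variables (R : realType) (n : nat).
Local Notation C := R[i].
Local Notation Cn := 'rV[R[i]]_n.

Definition dV : {sigma_finite_measure set Cn -> \bar R} :=
  row_power (@lebesgueC R) n.

(* Each component is a Lebesgue integral, with junk value 0 when not finite.   *)
Definition cintegral d (T : measurableType d) (m : {measure set T -> \bar R})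
    (F : T -> C) : C :=
  (\int[m]_x complex.Re (F x)) +i* (\int[m]_x complex.Im (F x)).

Definition cexp (z : C) : C :=
  (expR (complex.Re z))%:C * (cos (complex.Im z) +i* sin (complex.Im z)).

Definition dot (z w : Cn) : C := \sum_k z 0 k * w 0 k.

Definition conjv (z : Cn) : Cn := map_mx Num.conj z.

Definition sqnorm (z : Cn) : C := dot z (conjv z).

(* Integration against d\mu = pi^-n e^(-|w|^2) dV.                             *)
Definition mu_integral (F : Cn -> C) : C :=
  cintegral dV (fun w => F w * (((pi : R)%:C ^+ n)^-1 * cexp (- sqnorm w))).

Definition entire (f : Cn -> C) : Prop := forall z, differentiable f z.

Definition in_Sym (u : Cn -> C) : Prop :=
  measurable_fun setT u /\
  forall c : R, 0 < c -> exists M : R,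
    {ae dV, forall z, `|u z * cexp (- (c%:C * sqnorm z))| <= M%:C}.

Definition rkernel (w z : Cn) : C := cexp (dot w (conjv z)).

Definition nkernel (w z : Cn) : C := rkernel w z / sqrtC (rkernel z z).

Definition berezin (u : Cn -> C) (z : Cn) : C :=
  mu_integral (fun w => u w * `|nkernel w z| ^+ 2).

(* P (phi F) (z), with the projection P written through its kernel.             *)
Definition toeplitz (phi F : Cn -> C) (z : Cn) : C :=
  mu_integral (fun w => phi w * F w * cexp (dot z (conjv w))).

Definition kernel_span : set (Cn -> C) :=
  [set F | exists (m : nat) (c : 'I_m -> C) (p : 'I_m -> Cn),
    F = fun w => \sum_j c j * rkernel w (p j)].

Definition commutator (A B : (Cn -> C) -> Cn -> C) (F : Cn -> C) : Cn -> C :=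
  fun z => A (B F) z - B (A F) z.

(* Operators are possibly unbounded on the Fock space; an identity between     *)
(* them is an identity on the dense span of the reproducing kernels.           *)
Definition zero_on_kernels (A : (Cn -> C) -> Cn -> C) : Prop :=
  forall F, kernel_span F -> A F = fun=> 0.

Definition mindex : choiceType := {ffun 'I_n -> nat}.

Definition monom (z : Cn) (i : 'I_n -> nat) : C := \prod_k z 0 k ^+ i k.

(* coefs g is the family a with g(z) = \sum_i a_i z^i for all z, the sum being *)
(* the limit of the finite partial sums along the inclusion of index sets.     *)
Definition coefs (g : Cn -> C) : mindex -> C :=
  get [set a : mindex -> C | forall z : Cn,
    summability.partial_sum (fun i : mindex => a i * monom z i) @
      summability.totally --> g z].

Definition partial (k : 'I_n) (f : Cn -> C) : Cn -> C :=
  fun z => 'D_(delta_mx 0 k) f z.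

(* \partial_0^{j_0} ... \partial_{n-1}^{j_{n-1}} f                             *)
Definition mpartial (j : 'I_n -> nat) (f : Cn -> C) : Cn -> C :=
  foldr (fun k => iter (j k) (partial k)) f (enum 'I_n).

(* (\bar z - \partial_z)^i f (z); the bound on l k only makes the index type    *)
(* finite, it is implied by l <= i.                                            *)
Definition shift_partial (i : mindex) (f : Cn -> C) (z : Cn) : C :=
  \sum_(l : {ffun 'I_n -> 'I_(\sum_k i k).+1} | [forall k, (l k <= i k)%N])
    (\prod_k 'C(i k, l k))%:R * (-1) ^+ (\sum_k (i k - l k))%N *
    monom (conjv z) (fun k => l k) * mpartial (fun k => (i k - l k)%N) f z.

(* g^*(\bar z - \partial_z) f (z)                                              *)
Definition star_shift (g f : Cn -> C) (z : Cn) : C :=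
  summability.sum (fun i : mindex => (coefs g i)^* * shift_partial i f z).

End fock.

(* Main.v *)
(* Write [phi z w] for [u z * conj (g w) - f z * conj (v w)] and [Psi_s z w] for the
   integral of [phi (z + y) (w + s y)] against d mu(y).  Expanding the kernels, the
   commutator in (a) vanishes iff [Psi_1 = phi] everywhere, while (b) says that
   [Psi_1 = phi] on the diagonal.  The reproducing property rewrites
   [(conj z - d)^i u (z)] as the integral of [u y * conj (z - y)^i * e^(z . conj y)];
   summing the power series of [g] under the integral and shifting the Gaussian
   turns [g^*(conj z - d) u (z)] into the integral of
   [u (z + y) * conj (g (z - y))], so (c) says that [Psi_(-1) = phi] on the
   diagonal.  Functions holomorphic in [z] and antiholomorphic in [w] are determined
   by their values on the diagonal, and integrating the identity [Psi_s = phi] over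
   [(z + y, z - s y)] gives [Psi_(-s) = phi] on the diagonal, because two
   independent Gaussian shifts [x + y] and [s (x - y)] are uncorrelated. *)

(* Two obstacles shape the proof. Membership in [in_Sym] bounds a function only almost everywhere;
   the reproducing formula, valid for a Gaussian of any rate, turns this into a pointwise bound with
   an arbitrarily small exponent ([tame]). That freedom is essential: the kernel exp(z . conj w)
   already consumes half of the Gaussian in each variable, and everything else must fit into the
   rest for the integrals to be exchanged. The reproducing formula itself rests on circular means,
   which come from Goursat's theorem and so need no regularity of the derivative. Polarization works
   on one pair of lines p + x q, p + conj x q at a time: the restricted function reproduces itself
   against the one-variable kernel, and the Taylor expansion of that kernel gives an identity
   theorem from a real segment. For independent x, y the mean of (x + y) conj (s (x - y)) is conj s
   (E|x|^2 - E|y|^2) = 0, whatever s is. As [coefs] is a choice among unconditionally convergent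
   expansions, uniqueness of coefficients is needed. Explicit error bounds, linear in the increment
   for derivatives and geometric for series, serve instead of limit theorems under the integral. *)
From HB Require Import structures.
Require Import Defs.
From mathcomp Require Import all_boot all_order all_algebra.
From mathcomp Require Import complex ring lra finmap.
From mathcomp Require separable cyclic cyclotomic.
From mathcomp Require Import all_classical all_reals all_analysis.
From mathcomp Require Import measurable_realfun.
From mathcomp.analysis.showcase Require summability.
Set Implicit Arguments.
Unset Strict Implicit.
Unset Printing Implicit Defensive.
Import Order.TTheory GRing.Theory Num.Theory.
Import numFieldNormedType.Exports.
Import ComplexField.Normc.
Local Open Scope classical_set_scope.
Local Open Scope ring_scope.
Local Open Scope complex_scope.

(* [^*] stands for both [conjc] and [Num.conj], which are convertible. *)
Definition cj (R : realType) (z : R[i]) : R[i] := conjc z.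

(** * Real and imaginary parts, modulus and conjugation *)

Section complex_facts.
Variable R : realType.
Implicit Types z w : R[i].

Lemma normcC z : `|z| = (normc z)%:C.
Proof. by []. Qed.

Lemma normc_ge0 z : 0 <= normc z.
Proof. by case: z => a b; exact: sqrtr_ge0. Qed.

Lemma complexReIm z : (complex.Re z) +i* (complex.Im z) = z.
Proof. by case: z. Qed.

Lemma normcD z w : normc (z + w) <= normc z + normc w.
Proof. exact: le_normcD. Qed.

Lemma cReD z w : complex.Re (z + w) = complex.Re z + complex.Re w.
Proof. by case: z w => [? ?] [? ?]. Qed.

Lemma cImD z w : complex.Im (z + w) = complex.Im z + complex.Im w.
Proof. by case: z w => [? ?] [? ?]. Qed.

Lemma cReM z w : complex.Re (z * w) =
  complex.Re z * complex.Re w - complex.Im z * complex.Im w.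
Proof. by case: z w => [? ?] [? ?]. Qed.

Lemma cImM z w : complex.Im (z * w) =
  complex.Re z * complex.Im w + complex.Im z * complex.Re w.
Proof. by case: z w => [? ?] [? ?]. Qed.

Lemma Reconjc z : complex.Re (cj z) = complex.Re z. Proof. by case: z. Qed.
Lemma Imconjc z : complex.Im (cj z) = - complex.Im z. Proof. by case: z. Qed.

Lemma NumconjE z : Num.conj z = cj z.
Proof. by []. Qed.

Lemma cjK : involutive (@cj R).
Proof. exact: conjcK. Qed.

Lemma cj_real (x : R) : cj x%:C = x%:C.
Proof. exact: conjc_real. Qed.

Lemma normc_Re z : `|complex.Re z| <= normc z.
Proof.
by case: z => a b; rewrite -sqrtr_sqr ler_wsqrtr// lerDl sqr_ge0.
Qed.

Lemma normc_Im z : `|complex.Im z| <= normc z.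
Proof.
by case: z => a b; rewrite -sqrtr_sqr ler_wsqrtr// lerDr sqr_ge0.
Qed.

Lemma normc_le z : normc z <= `|complex.Re z| + `|complex.Im z|.
Proof.
case: z => a b /=; rewrite -(@ler_pXn2r _ 2)// ?nnegrE ?sqrtr_ge0 ?addr_ge0//.
rewrite sqr_sqrtr ?addr_ge0 ?sqr_ge0// sqrrD !real_normK ?num_real//.
by rewrite -addrA lerD2l lerDr mulrn_wge0// mulr_ge0.
Qed.

Lemma normcRe (x : R) : normc x%:C = `|x|.
Proof. by rewrite /= expr0n addr0 sqrtr_sqr. Qed.

Lemma normc_conj z : normc (cj z) = normc z.
Proof. by case: z => a b /=; rewrite sqrrN. Qed.

Lemma normc_sq z : normc z ^+ 2 = complex.Re z ^+ 2 + complex.Im z ^+ 2.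
Proof. by case: z => a b /=; rewrite sqr_sqrtr ?addr_ge0 ?sqr_ge0. Qed.

Lemma mulc_conj z : z * (cj z) = (normc z ^+ 2)%:C.
Proof. by rewrite normc_sq; case: z => a b; simpc; congr (_ +i* _); rewrite /=; ring. Qed.

Lemma normcX z k : normc (z ^+ k) = normc z ^+ k.
Proof. by elim: k => [|k ih]; rewrite ?normc1// !exprS normcM ih. Qed.

Lemma normc_sum (I : Type) (s : seq I) (P : pred I) (F : I -> R[i]) :
  normc (\sum_(i <- s | P i) F i) <= \sum_(i <- s | P i) normc (F i).
Proof.
elim/big_rec2: _ => [|i y x _ h]; first by rewrite normc0.
by rewrite (le_trans (normcD _ _))// lerD2l.
Qed.

Lemma normc_prod (I : Type) (s : seq I) (P : pred I) (F : I -> R[i]) :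
  normc (\prod_(i <- s | P i) F i) = \prod_(i <- s | P i) normc (F i).
Proof.
by elim/big_rec2: _ => [|i y x _ h]; rewrite ?normc1// normcM h.
Qed.

Lemma realcD (x y : R) : (x + y)%:C = x%:C + y%:C.
Proof. exact: rmorphD. Qed.

Lemma realcN (x : R) : (- x)%:C = - x%:C.
Proof. exact: rmorphN. Qed.

Lemma realcM (x y : R) : (x * y)%:C = x%:C * y%:C.
Proof. exact: rmorphM. Qed.

Lemma realcX (x : R) k : (x ^+ k)%:C = x%:C ^+ k.
Proof. exact: rmorphXn. Qed.

Lemma realcV (x : R) : (x^-1)%:C = x%:C^-1.
Proof. exact: fmorphV. Qed.

Lemma realc_nat k : (k%:R : R)%:C = k%:R.
Proof. exact: rmorph_nat. Qed.

Lemma realc_sum (I : Type) (s : seq I) (P : pred I) (F : I -> R) :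
  (\sum_(i <- s | P i) F i)%:C = \sum_(i <- s | P i) (F i)%:C.
Proof. exact: rmorph_sum. Qed.

Lemma conjcD z w : (cj (z + w)) = (cj z) + (cj w).
Proof. exact: rmorphD. Qed.

Lemma conjcM z w : (cj (z * w)) = (cj z) * (cj w).
Proof. exact: rmorphM. Qed.

Lemma conjcN z : (cj (- z)) = - (cj z).
Proof. exact: rmorphN. Qed.

Lemma conjcX z k : (cj (z ^+ k)) = (cj z) ^+ k.
Proof. exact: rmorphXn. Qed.

Lemma conjc_sum (I : Type) (s : seq I) (P : pred I) (F : I -> R[i]) :
  (cj (\sum_(i <- s | P i) F i)) = \sum_(i <- s | P i) (cj (F i)).
Proof. exact: rmorph_sum. Qed.

Lemma conjc_prod (I : Type) (s : seq I) (P : pred I) (F : I -> R[i]) :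
  (cj (\prod_(i <- s | P i) F i)) = \prod_(i <- s | P i) (cj (F i)).
Proof. exact: rmorph_prod. Qed.

End complex_facts.

(** * Measurability of complex-valued functions *)

Section cmeasurable.
Context d (T : measurableType d) (R : realType).
Implicit Types F G : T -> R[i].

Lemma cmeasurableP F : measurable_fun setT F <->
  measurable_fun setT (fun x => complex.Re (F x) : measurableTypeR R) /\
  measurable_fun setT (fun x => complex.Im (F x) : measurableTypeR R).
Proof.
split=> [mF|[mr mi]].
  have m2 := measurableT_comp (@measurable_to_reals R) mF.
  by split; [exact: measurableT_comp measurable_fst m2|
             exact: measurableT_comp measurable_snd m2].
have := measurableT_comp (@measurable_of_reals R) (measurable_fun_pair mr mi).
by apply: eq_measurable_fun => x _ /=; rewrite /of_reals/= complexReIm.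
Qed.

Lemma cmeas_re F : measurable_fun setT F ->
  measurable_fun setT (fun x => complex.Re (F x)).
Proof. by case/cmeasurableP. Qed.

Lemma cmeas_im F : measurable_fun setT F ->
  measurable_fun setT (fun x => complex.Im (F x)).
Proof. by case/cmeasurableP. Qed.

Lemma cmeasD F G : measurable_fun setT F -> measurable_fun setT G ->
  measurable_fun setT (fun x => F x + G x).
Proof.
move=> /cmeasurableP[? ?] /cmeasurableP[? ?]; apply/cmeasurableP; split.
  by under eq_fun do rewrite cReD; exact: measurable_funD.
by under eq_fun do rewrite cImD; exact: measurable_funD.
Qed.

Lemma cmeasM F G : measurable_fun setT F -> measurable_fun setT G ->
  measurable_fun setT (fun x => F x * G x).
Proof.
move=> /cmeasurableP[? ?] /cmeasurableP[? ?]; apply/cmeasurableP; split.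
  by under eq_fun do rewrite cReM; apply: measurable_funB; exact: measurable_funM.
by under eq_fun do rewrite cImM; apply: measurable_funD; exact: measurable_funM.
Qed.

Lemma cmeas_conj F : measurable_fun setT F ->
  measurable_fun setT (fun x => (cj (F x))).
Proof.
move=> /cmeasurableP[? ?]; apply/cmeasurableP; split.
  by under eq_fun do rewrite Reconjc.
by under eq_fun do rewrite Imconjc; exact: measurable_funN.
Qed.

Lemma cmeas_cst (c : R[i]) : measurable_fun setT (fun _ : T => c).
Proof. exact: measurable_cst. Qed.

Lemma cmeasN F : measurable_fun setT F -> measurable_fun setT (fun x => - F x).
Proof.
move=> mF; have := cmeasM (cmeas_cst (-1)) mF.
by apply: eq_measurable_fun => x _; rewrite mulN1r.
Qed.

Lemma cmeasB F G : measurable_fun setT F -> measurable_fun setT G ->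
  measurable_fun setT (fun x => F x - G x).
Proof. by move=> mF mG; apply: cmeasD => //; exact: cmeasN. Qed.

Lemma cmeas_real (f : T -> R) : measurable_fun setT f ->
  measurable_fun setT (fun x => (f x)%:C).
Proof. by move=> mf; apply/cmeasurableP; split. Qed.

Lemma cmeas_sum (I : Type) (s : seq I) (P : pred I) (F : I -> T -> R[i]) :
  (forall i, P i -> measurable_fun setT (F i)) ->
  measurable_fun setT (fun x => \sum_(i <- s | P i) F i x).
Proof.
move=> mF; elim: s => [|i s ih].
  by under eq_fun do rewrite big_nil; exact: cmeas_cst.
under eq_fun do rewrite big_cons.
by case Pi: (P i) => //; apply: cmeasD; [exact: mF|exact: ih].
Qed.

Lemma cmeasX F k : measurable_fun setT F -> measurable_fun setT (fun x => F x ^+ k).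
Proof.
move=> mF; elim: k => [|k ih]; first exact: cmeas_cst.
by under eq_fun do rewrite exprS; exact: cmeasM.
Qed.

Lemma cmeas_normc F : measurable_fun setT F ->
  measurable_fun setT (fun x => normc (F x)).
Proof.
move=> /cmeasurableP[? ?].
have -> : (fun x => normc (F x)) =
    (fun x => Num.sqrt (complex.Re (F x) ^+ 2 + complex.Im (F x) ^+ 2)).
  by apply/funext => x; case: (F x).
apply: (measurableT_comp (continuous_measurable_fun (@sqrt_continuous R))).
by apply: measurable_funD; exact: measurable_funX.
Qed.

Lemma cmeas_exp F : measurable_fun setT F ->
  measurable_fun setT (fun x => cexp (F x)).
Proof.
move=> /cmeasurableP[? ?]; rewrite /cexp; apply: cmeasM.
  by apply: cmeas_real; exact: measurableT_comp.
apply/cmeasurableP; split=> /=.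
  by apply: measurableT_comp => //; apply: continuous_measurable_fun; exact: continuous_cos.
by apply: measurableT_comp => //; apply: continuous_measurable_fun; exact: continuous_sin.
Qed.

End cmeasurable.

(** * Complex-valued integrals *)

Section cintegral_theory.
Context d (T : measurableType d) (R : realType) (m : {measure set T -> \bar R}).
Implicit Types F G : T -> R[i].

Definition cintegrable F :=
  measurable_fun setT F /\ (\int[m]_x (normc (F x))%:E < +oo)%E.

Lemma cintegrableP F : cintegrable F <-> measurable_fun setT F /\
  m.-integrable setT (fun x => (normc (F x))%:E).
Proof.
split=> -[mF iF]; split=> //.
  apply/integrableP; split.
    by apply/measurable_EFinP; exact: cmeas_normc.
  by under eq_integral do rewrite gee0_abs ?lee_fin ?normc_ge0//.
have /integrableP[_] := iF.
by under eq_integral do rewrite gee0_abs ?lee_fin ?normc_ge0//.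
Qed.

Lemma cintegrable_meas F : cintegrable F -> measurable_fun setT F.
Proof. by case. Qed.

Lemma cintegrable_norm F : cintegrable F ->
  m.-integrable setT (fun x => (normc (F x))%:E).
Proof. by case/cintegrableP. Qed.

Lemma cintegrable_ler F (g : T -> R) : measurable_fun setT F ->
  m.-integrable setT (fun x => (g x)%:E) -> (forall x, normc (F x) <= g x) ->
  cintegrable F.
Proof.
move=> mF ig h; apply/cintegrableP; split=> //.
apply: le_integrable ig => //; first by apply/measurable_EFinP; exact: cmeas_normc.
move=> x _; rewrite /= lee_fin ger0_norm ?normc_ge0// (le_trans (h x))//.
by rewrite ler_norm.
Qed.

Lemma cintegrable_le F G : measurable_fun setT F -> cintegrable G ->
  (forall x, normc (F x) <= normc (G x)) -> cintegrable F.
Proof. by move=> mF /cintegrable_norm; exact: cintegrable_ler. Qed.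

Lemma cintegrable_re F : cintegrable F ->
  m.-integrable setT (fun x => (complex.Re (F x))%:E).
Proof.
move=> /cintegrableP[mF iF]; apply: le_integrable iF => //.
  by apply/measurable_EFinP; exact: cmeas_re.
by move=> x _; rewrite /= lee_fin (ger0_norm (normc_ge0 _)) normc_Re.
Qed.

Lemma cintegrable_im F : cintegrable F ->
  m.-integrable setT (fun x => (complex.Im (F x))%:E).
Proof.
move=> /cintegrableP[mF iF]; apply: le_integrable iF => //.
  by apply/measurable_EFinP; exact: cmeas_im.
by move=> x _; rewrite /= lee_fin (ger0_norm (normc_ge0 _)) normc_Im.
Qed.

Lemma cintegrableD F G : cintegrable F -> cintegrable G ->
  cintegrable (fun x => F x + G x).
Proof.
move=> iF iG; apply: (@cintegrable_ler _ (fun x => normc (F x) + normc (G x))).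
- by apply: cmeasD; exact: cintegrable_meas.
- have := integrableD measurableT (cintegrable_norm iF) (cintegrable_norm iG).
  by apply: eq_integrable.
- by move=> x; exact: normcD.
Qed.

Lemma cintegrableZ c F : cintegrable F -> cintegrable (fun x => c * F x).
Proof.
move=> iF; apply: (@cintegrable_ler _ (fun x => normc c * normc (F x))).
- by apply: cmeasM; [exact: cmeas_cst|exact: cintegrable_meas].
- have := integrableZl measurableT (normc c) (cintegrable_norm iF).
  by apply: eq_integrable.
- by move=> x; rewrite normcM.
Qed.

Lemma cintegrableB F G : cintegrable F -> cintegrable G ->
  cintegrable (fun x => F x - G x).
Proof.
move=> iF /(cintegrableZ (-1)) iG.
by under eq_fun do rewrite -mulN1r; exact: cintegrableD.
Qed.

Lemma cintegrable_conj F : cintegrable F -> cintegrable (fun x => (cj (F x))).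
Proof.
move=> iF; apply: (cintegrable_le _ iF); last by move=> x; rewrite normc_conj.
by apply: cmeas_conj; case: iF.
Qed.

Lemma cintegrable_real (g : T -> R) : m.-integrable setT (fun x => (g x)%:E) ->
  cintegrable (fun x => (g x)%:C).
Proof.
move=> ig; apply: (@cintegrable_ler _ (fun x => `|g x|)).
- by apply: cmeas_real; apply/measurable_EFinP; case/integrableP: ig.
- exact: (integrable_norm ig).
- by move=> x; rewrite normcRe.
Qed.

Lemma cintegrable0 : cintegrable (fun=> 0).
Proof.
split; first exact: cmeas_cst.
by under eq_integral do rewrite normc0; rewrite integral0.
Qed.

Lemma cintegrable_sum (I : Type) (s : seq I) (P : pred I) (F : I -> T -> R[i]) :
  (forall i, P i -> cintegrable (F i)) ->
  cintegrable (fun x => \sum_(i <- s | P i) F i x).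
Proof.
move=> iF; elim: s => [|i s ih].
  by under eq_fun do rewrite big_nil; exact: cintegrable0.
under eq_fun do rewrite big_cons.
by case Pi: (P i) => //; apply: cintegrableD; [exact: iF|exact: ih].
Qed.

Lemma eq_cintegral F G : F =1 G -> cintegral m F = cintegral m G.
Proof. by move=> /funext ->. Qed.

Lemma cintegral0 : cintegral m (fun=> 0) = 0.
Proof. by rewrite /cintegral/= /Rintegral !integral0. Qed.

Lemma cintegralD F G : cintegrable F -> cintegrable G ->
  cintegral m (fun x => F x + G x) = cintegral m F + cintegral m G.
Proof.
move=> iF iG; rewrite /cintegral.
under eq_Rintegral do rewrite cReD.
under [X in _ +i* X]eq_Rintegral do rewrite cImD.
rewrite RintegralD ?RintegralD//; first [exact: cintegrable_re|exact: cintegrable_im].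
Qed.

Lemma cintegralZ c F : cintegrable F ->
  cintegral m (fun x => c * F x) = c * cintegral m F.
Proof.
move=> iF; rewrite /cintegral.
have ir := cintegrable_re iF; have ii := cintegrable_im iF.
under eq_Rintegral do rewrite cReM.
under [X in _ +i* X]eq_Rintegral do rewrite cImM.
rewrite RintegralB ?RintegralD//; last 4 first.
- exact: (integrableZl measurableT (complex.Re c) ii).
- exact: (integrableZl measurableT (complex.Im c) ir).
- exact: (integrableZl measurableT (complex.Re c) ir).
- exact: (integrableZl measurableT (complex.Im c) ii).
by rewrite !RintegralZl//; case: c => a b; simpc.
Qed.

Lemma cintegralZr c F : cintegrable F ->
  cintegral m (fun x => F x * c) = cintegral m F * c.
Proof. by move=> iF; under eq_fun do rewrite mulrC; rewrite cintegralZ// mulrC. Qed.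

Lemma cintegralN F : cintegrable F ->
  cintegral m (fun x => - F x) = - cintegral m F.
Proof. by move=> iF; under eq_fun do rewrite -mulN1r; rewrite cintegralZ// mulN1r. Qed.

Lemma cintegralB F G : cintegrable F -> cintegrable G ->
  cintegral m (fun x => F x - G x) = cintegral m F - cintegral m G.
Proof.
move=> iF iG; rewrite -cintegralN// -cintegralD//.
by under eq_fun do rewrite -mulN1r; exact: cintegrableZ.
Qed.

Lemma cintegral_sum (I : Type) (s : seq I) (P : pred I) (F : I -> T -> R[i]) :
  (forall i, P i -> cintegrable (F i)) ->
  cintegral m (fun x => \sum_(i <- s | P i) F i x) =
  \sum_(i <- s | P i) cintegral m (F i).
Proof.
move=> iF; elim: s => [|i s ih].
  by under eq_fun do rewrite big_nil; rewrite big_nil cintegral0.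
rewrite big_cons -ih; under eq_fun do rewrite big_cons.
case Pi: (P i) => //; rewrite cintegralD//; first exact: iF.
exact: cintegrable_sum.
Qed.

Lemma cintegral_real (g : T -> R) : cintegral m (fun x => (g x)%:C) =
  (\int[m]_x g x)%:C.
Proof. by rewrite /cintegral/= /Rintegral integral0. Qed.

Lemma cintegral_conj F : cintegrable F ->
  cintegral m (fun x => (cj (F x))) = (cj (cintegral m F)).
Proof.
move=> iF; rewrite /cintegral.
under eq_Rintegral do rewrite Reconjc.
under [X in _ +i* X]eq_Rintegral do rewrite Imconjc -mulN1r.
by rewrite RintegralZl ?mulN1r//; exact: cintegrable_im.
Qed.

Lemma normc_cintegral_le F (g : T -> R) : cintegrable F ->
  m.-integrable setT (fun x => (g x)%:E) -> (forall x, normc (F x) <= g x) ->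
  normc (cintegral m F) <= \int[m]_x g x.
Proof.
move=> iF ig h; set I := cintegral m F.
have [I0|I0] := eqVneq I 0.
  by rewrite I0 normc0 Rintegral_ge0// => x _; rewrite (le_trans _ (h x)) ?normc_ge0.
have n0 : 0 < normc I.
  rewrite lt_neqAle normc_ge0 andbT eq_sym; apply: contra I0 => /eqP/eq0_normc ->//.
(* [c] rotates the integral onto the positive real axis. *)
pose c := (cj I) * ((normc I)^-1)%:C.
have cI : c * I = (normc I)%:C.
  rewrite /c mulrAC (mulrC (cj I)) mulc_conj -rmorphM/=; congr (_%:C).
  by rewrite expr2 -mulrA divff ?mulr1// gt_eqF.
have c1 : normc c = 1.
  rewrite normcM normc_conj normcRe ger0_norm ?invr_ge0 ?normc_ge0//.
  by rewrite divff// gt_eqF.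
have -> : normc I = complex.Re (c * I) by rewrite cI.
rewrite -cintegralZ//; apply: le_Rintegral => //.
- exact/cintegrable_re/cintegrableZ.
- move=> x _; rewrite (le_trans _ (h x))//.
  by rewrite (le_trans (ler_norm _))// (le_trans (normc_Re _))// normcM c1 mul1r.
Qed.

Lemma normc_cintegral F : cintegrable F ->
  normc (cintegral m F) <= \int[m]_x normc (F x).
Proof. by move=> iF; apply: normc_cintegral_le => //; exact: cintegrable_norm. Qed.

End cintegral_theory.

(** * Fubini's theorem for complex-valued functions *)

Section cfubini.
Context d1 d2 (T1 : measurableType d1) (T2 : measurableType d2) (R : realType).
Variables (m1 : {sigma_finite_measure set T1 -> \bar R})
          (m2 : {sigma_finite_measure set T2 -> \bar R}).
Variable F : T1 * T2 -> R[i].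
Hypothesis iF : cintegrable (m1 \x m2)%E F.

Let fineE1 (f : T1 * T2 -> R) : (m1 \x m2)%E.-integrable setT (fun x => (f x)%:E) ->
  m1.-integrable setT (fun x => (\int[m2]_y f (x, y))%:E) /\
  \int[m1]_x \int[m2]_y f (x, y) = \int[(m1 \x m2)%E]_z f z.
Proof.
move=> i_f; have iF1 := integrable_fubini_F i_f.
have mF : measurable_fun setT (fun x => (\int[m2]_y f (x, y))%:E).
  apply/measurable_EFinP.
  have mfi := @fine_measurable R setT measurableT.
  exact: (measurableT_comp mfi (measurable_fubini_F i_f)).
(* The extended integral of a slice may be infinite, where [fine] returns 0, so the two inner
   integrals agree only almost everywhere. *)
have aeE : ae_eq m1 setT (fubini_F m2 (fun x => (f x)%:E))
    (fun x => (\int[m2]_y f (x, y))%:E).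
  have := ae_integrable1 i_f; apply: filterS => x ix _.
  by rewrite /fubini_F /Rintegral fineK//; exact: integrable_fin_num.
split.
  apply/integrableP; split=> //.
  have /integrableP[mi] := iF1.
  suff -> : (\int[m1]_x `|fubini_F m2 (fun x => (f x)%:E) x| =
    \int[m1]_x `|(\int[m2]_y f (x, y))%:E|)%E by [].
  apply: ae_eq_integral => //.
  - exact: measurableT_comp.
  - exact: measurableT_comp.
  - by apply: filterS aeE => x h _ /=; rewrite h.
rewrite /Rintegral; congr fine.
rewrite -integral12_prod_meas1//; apply: ae_eq_integral => //.
- exact: (measurable_fubini_F i_f).
- by apply: filterS aeE => x h _; rewrite -h.
Qed.

Lemma cfubini1 : cintegral m1 (fun x => cintegral m2 (fun y => F (x, y))) =
  cintegral (m1 \x m2)%E F.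
Proof.
have [_ e1] := fineE1 (cintegrable_re iF); have [_ e2] := fineE1 (cintegrable_im iF).
by rewrite /cintegral -e1 -e2.
Qed.

Lemma cintegrable_fubini1 : cintegrable m1 (fun x => cintegral m2 (fun y => F (x, y))).
Proof.
have [i1 _] := fineE1 (cintegrable_re iF); have [i2 _] := fineE1 (cintegrable_im iF).
apply: (@cintegrable_ler _ _ _ _ _ (fun x =>
   `|\int[m2]_y complex.Re (F (x, y))| + `|\int[m2]_y complex.Im (F (x, y))|)).
- apply/cmeasurableP; split=> /=.
  + by apply/measurable_EFinP; case/integrableP: i1.
  + by apply/measurable_EFinP; case/integrableP: i2.
- have := integrableD measurableT (integrable_norm i1) (integrable_norm i2).
  exact: eq_integrable.
- by move=> x; exact: normc_le.
Qed.

End cfubini.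

Section cfubini_swap.
Context d1 d2 (T1 : measurableType d1) (T2 : measurableType d2) (R : realType).
Variables (m1 : {sigma_finite_measure set T1 -> \bar R})
          (m2 : {sigma_finite_measure set T2 -> \bar R}).
Variable F : T1 * T2 -> R[i].

Lemma cintegrable_prod : measurable_fun setT F ->
  (\int[m1]_x \int[m2]_y (normc (F (x, y)))%:E < +oo)%E ->
  cintegrable (m1 \x m2)%E F.
Proof.
move=> mF h; split=> //.
rewrite (fubini_tonelli1 (fun z => (normc (F z))%:E)) //.
  by apply/measurable_EFinP; exact: cmeas_normc.
by move=> z; rewrite lee_fin normc_ge0.
Qed.

Lemma cintegrable_prod_ler (g1 : T1 -> R) (g2 : T2 -> R) : measurable_fun setT F ->
  m1.-integrable setT (fun x => (g1 x)%:E) ->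
  m2.-integrable setT (fun x => (g2 x)%:E) ->
  (forall x y, normc (F (x, y)) <= g1 x * g2 y) ->
  cintegrable (m1 \x m2)%E F.
Proof.
move=> mF i1 i2 h; apply: cintegrable_prod => //.
pose I2 := (\int[m2]_y `|g2 y|%:E)%E.
have I2oo : (I2 < +oo)%E by case/integrableP: i2.
have I20 : (0 <= I2)%E by apply: integral_ge0 => ? _; rewrite lee_fin.
have mN x : measurable_fun setT (fun y => (normc (F (x, y)))%:E).
  apply/measurable_EFinP/cmeas_normc.
  exact: (measurableT_comp mF (measurable_pair1 x)).
have m2g : measurable_fun setT (fun x => `|g2 x|%:E).
  have /integrableP[m _] := integrable_norm i2; exact: m.
have m1g : measurable_fun setT (fun x => `|g1 x|%:E).
  have /integrableP[m _] := integrable_norm i1; exact: m.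
apply: (@le_lt_trans _ _ (\int[m1]_x (`|g1 x|%:E * I2))%E).
  apply: ge0_le_integral => //.
  - by move=> x _; apply: integral_ge0 => y _; rewrite lee_fin normc_ge0.
  - apply: (measurable_fun_fubini_tonelli_F (fun z => (normc (F z))%:E)) => //.
    + by apply/measurable_EFinP; exact: cmeas_normc.
    + by move=> z; rewrite lee_fin normc_ge0.
  - by apply: emeasurable_funM => //; exact: measurable_cst.
  move=> x _; rewrite /I2 -ge0_integralZl//.
  apply: ge0_le_integral => //.
  - by move=> y _; rewrite lee_fin normc_ge0.
  - by apply: emeasurable_funM => //; exact: measurable_cst.
  - move=> y _; rewrite -EFinM lee_fin -normrM.
    by rewrite (le_trans (h x y)) ?ler_norm.
rewrite ge0_integralZr// lte_mul_pinfty//; first by apply: integral_ge0 => ? _; rewrite lee_fin.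
have /integrableP[_] := i1; rewrite ge0_fin_numE//.
by apply: integral_ge0 => ? _; rewrite lee_fin.
Qed.

End cfubini_swap.

Section cfubini_thm.
Context d1 d2 (T1 : measurableType d1) (T2 : measurableType d2) (R : realType).
Variables (m1 : {sigma_finite_measure set T1 -> \bar R})
          (m2 : {sigma_finite_measure set T2 -> \bar R}).
Variable F : T1 * T2 -> R[i].
Hypothesis iF : cintegrable (m1 \x m2)%E F.

Let swap (z : T2 * T1) := (z.2, z.1).

Let mswap : measurable_fun setT swap.
Proof. exact: measurable_fun_pair. Qed.

Lemma cintegrable_swap : cintegrable (m2 \x m1)%E (F \o swap).
Proof.
have [mF] := iF; rewrite (fubini_tonelli1 (fun z => (normc (F z))%:E)); last 2 first.
- by apply/measurable_EFinP; exact: cmeas_normc.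
- by move=> z; rewrite lee_fin normc_ge0.
rewrite (fubini_tonelli (fun z => (normc (F z))%:E)); last 2 first.
- by apply/measurable_EFinP; exact: cmeas_normc.
- by move=> z; rewrite lee_fin normc_ge0.
by move=> h; apply: cintegrable_prod => //; exact: (measurableT_comp mF).
Qed.

Lemma cfubini : cintegral m1 (fun x => cintegral m2 (fun y => F (x, y))) =
  cintegral m2 (fun y => cintegral m1 (fun x => F (x, y))).
Proof.
rewrite (cfubini1 iF) (cfubini1 cintegrable_swap) /cintegral /Rintegral.
by congr (fine _ +i* fine _);
  [have i1 := cintegrable_re iF; have i2 := cintegrable_re cintegrable_swap|
   have i1 := cintegrable_im iF; have i2 := cintegrable_im cintegrable_swap];
  rewrite -(integral12_prod_meas1 i1) -(integral12_prod_meas1 i2); apply: Fubini.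
Qed.

End cfubini_thm.

(** * Measure-preserving maps *)

Section preserving.
Variable R : realType.

Definition preserving d1 d2 (T1 : measurableType d1) (T2 : measurableType d2)
    (m1 : {measure set T1 -> \bar R}) (m2 : {measure set T2 -> \bar R})
    (f : T1 -> T2) :=
  measurable_fun setT f /\ forall A, measurable A -> m1 (f @^-1` A) = m2 A.

Section basics.
Context d1 d2 d3 (T1 : measurableType d1) (T2 : measurableType d2)
  (T3 : measurableType d3).
Variables (m1 : {measure set T1 -> \bar R}) (m2 : {measure set T2 -> \bar R})
  (m3 : {measure set T3 -> \bar R}).

Lemma preserving_comp f g : preserving m1 m2 f -> preserving m2 m3 g ->
  preserving m1 m3 (g \o f).
Proof.
move=> [mf hf] [mg hg]; split; first exact: measurableT_comp.
by move=> A mA; rewrite comp_preimage hf ?hg// -[X in measurable X]setTI; exact: mg.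
Qed.

Lemma preserving_id : preserving m1 m1 id.
Proof. by split. Qed.

Lemma preserving_ge0_integral f (h : T2 -> \bar R) : preserving m1 m2 f ->
  measurable_fun setT h -> (forall x, 0 <= h x)%E ->
  (\int[m1]_x h (f x) = \int[m2]_y h y)%E.
Proof.
move=> [mf hf] mh h0.
pose F : {mfun T1 >-> T2} := HB.pack f (isMeasurableFun.Build _ _ _ _ _ mf).
rewrite -(@ge0_integral_pushforward _ _ _ _ R f mf m1 setT h)//.
rewrite -[in LHS]/(pushforward m1 F).
by apply: eq_measure_integral => A mA _; exact: hf.
Qed.

Lemma preserving_cintegrable f (F : T2 -> R[i]) : preserving m1 m2 f ->
  cintegrable m2 F -> cintegrable m1 (fun x => F (f x)).
Proof.
move=> pf [mF iF]; split; first by case: pf => mf _; exact: measurableT_comp mF mf.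
rewrite (preserving_ge0_integral (h := fun x => (normc (F x))%:E) pf)//.
- by apply/measurable_EFinP; exact: cmeas_normc.
- by move=> x; rewrite lee_fin normc_ge0.
Qed.

Lemma preserving_integral f (h : T2 -> R) : preserving m1 m2 f ->
  measurable_fun setT h -> \int[m1]_x h (f x) = \int[m2]_y h y.
Proof.
move=> pf mh; rewrite /Rintegral; congr fine.
rewrite integralE [RHS]integralE.
have mE : measurable_fun setT (fun x => (h x)%:E) by exact/measurable_EFinP.
rewrite -(preserving_ge0_integral (h := (fun x => (h x)%:E)^\+%E) pf)//; last first.
  exact: measurable_funepos.
rewrite -(preserving_ge0_integral (h := (fun x => (h x)%:E)^\-%E) pf)//; last first.
  exact: measurable_funeneg.
by congr (_ - _)%E; apply: eq_integral => x _; rewrite ?funeposE ?funenegE.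
Qed.

Lemma preserving_cintegral f (F : T2 -> R[i]) : preserving m1 m2 f ->
  measurable_fun setT F ->
  cintegral m1 (fun x => F (f x)) = cintegral m2 F.
Proof.
move=> pf mF; rewrite /cintegral.
by congr (_ +i* _); [apply: (preserving_integral (h := fun x => complex.Re (F x)))|
  apply: (preserving_integral (h := fun x => complex.Im (F x)))] => //;
  [exact: cmeas_re|exact: cmeas_im].
Qed.

End basics.

Section product.
Context d1 d2 (T1 : measurableType d1) (T2 : measurableType d2).
Variables (m1 : {sigma_finite_measure set T1 -> \bar R})
  (m2 : {sigma_finite_measure set T2 -> \bar R}).

Lemma preserving_swap : preserving (m1 \x m2)%E (m2 \x m1)%E (fun z => (z.2, z.1)).
Proof.
have mf : measurable_fun setT (fun z : T1 * T2 => (z.2, z.1)).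
  exact: measurable_fun_pair.
split=> // A mA.
pose F : {mfun (T1 * T2)%type >-> (T2 * T1)%type} :=
  HB.pack (fun z : T1 * T2 => (z.2, z.1)) (isMeasurableFun.Build _ _ _ _ _ mf).
apply/esym; apply: (product_measure_unique (m' := pushforward (m1 \x m2)%E F)) => //.
move=> B C mB mC; rewrite /= /pushforward.
rewrite (_ : _ @^-1` (B `*` C) = C `*` B); first by rewrite product_measure1E// muleC.
by apply/seteqP; split=> -[x y] /= [].
Qed.

(** The product measure integrates the measures of the sections over [x], and a section of the
    preimage is the preimage of a section under [S x]. Shears of the plane are of this form. *)
Lemma preserving_skew (S : T1 -> T2 -> T2) :
  measurable_fun setT (fun z : T1 * T2 => S z.1 z.2) ->
  (forall x, preserving m2 m2 (S x)) ->
  preserving (m1 \x m2)%E (m1 \x m2)%E (fun z => (z.1, S z.1 z.2)).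
Proof.
move=> mS pS; split; first exact: measurable_fun_pair.
move=> A mA; rewrite /product_measure1; apply: eq_integral => x _ /=.
have [_ h] := pS x; rewrite -(h _ (measurable_xsection x mA)).
by congr (m2 _); apply/seteqP; split=> y; rewrite /xsection/= !inE.
Qed.

End product.

Section product_map.
Context d1 d2 (T1 : measurableType d1) (T2 : measurableType d2).
Variables (m1 : {sigma_finite_measure set T1 -> \bar R})
  (m2 : {sigma_finite_measure set T2 -> \bar R}).

Lemma preserving_prod (S : T1 -> T1) (T : T2 -> T2) :
  preserving m1 m1 S -> preserving m2 m2 T ->
  preserving (m1 \x m2)%E (m1 \x m2)%E (fun z => (S z.1, T z.2)).
Proof.
move=> pS pT.
have s1 : preserving (m1 \x m2)%E (m1 \x m2)%E (fun z => (z.1, T z.2)).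
  apply: (@preserving_skew _ _ _ _ _ _ (fun _ => T)) => //.
  by case: pT => mT _; exact: measurableT_comp.
have s2 : preserving (m2 \x m1)%E (m2 \x m1)%E (fun z => (z.1, S z.2)).
  apply: (@preserving_skew _ _ _ _ _ _ (fun _ => S)) => //.
  by case: pS => mS _; exact: measurableT_comp.
have := preserving_comp (preserving_comp (preserving_comp s1
  (preserving_swap m1 m2)) s2) (preserving_swap m2 m1).
exact.
Qed.

End product_map.

Lemma preserving_shift (a : R) :
  preserving (@lebesgue_measure R) (@lebesgue_measure R) (fun x => x + a).
Proof.
have mf : measurable_fun setT ((fun x => x + a) : measurableTypeR R -> measurableTypeR R).
  by apply: measurable_funD.
split=> // A mA.
pose F : {mfun measurableTypeR R >-> measurableTypeR R} :=
  HB.pack (fun x : measurableTypeR R => (x + a : measurableTypeR R))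
    (isMeasurableFun.Build _ _ _ _ _ mf).
apply/esym; apply: (lebesgue_measure_unique (mu := pushforward (@lebesgue_measure R) F)) => //.
move=> _ [[p q] _ <-] /=; rewrite /pushforward.
rewrite (_ : F @^-1` _ = `]p - a, q - a]%classic); last first.
  by apply/seteqP; split=> x /=; rewrite !in_itv/= ltrBlDr lerBrDr.
rewrite !lebesgue_measure_itv/= !lte_fin ltrD2r; case: ifP => // _.
by rewrite -!EFinD; congr EFin; ring.
Qed.

Lemma of_reals_preserving : preserving (@lebesgue_measure R \x @lebesgue_measure R)%E
  (@lebesgueC R) (@of_reals R).
Proof. by split; first exact: measurable_of_reals. Qed.

Lemma preserving_lebesgueC (S : R * R -> R * R) (T : R[i] -> R[i]) :
  preserving (@lebesgue_measure R \x @lebesgue_measure R)%E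
    (@lebesgue_measure R \x @lebesgue_measure R)%E S ->
  measurable_fun setT T ->
  (forall p, T (of_reals p) = of_reals (S p)) ->
  preserving (@lebesgueC R) (@lebesgueC R) T.
Proof.
move=> [mS pS] mT h; split=> // A mA.
rewrite /= /lebesgueC /pushforward.
have -> : @of_reals R @^-1` (T @^-1` A) = S @^-1` (@of_reals R @^-1` A).
  by apply/seteqP; split=> p /=; rewrite h.
rewrite pS//.
by rewrite -[X in measurable X]setTI; exact: measurable_of_reals.
Qed.

Lemma preserving_translateC (a : R[i]) :
  preserving (@lebesgueC R) (@lebesgueC R) (fun z => z + a).
Proof.
apply: (preserving_lebesgueC (preserving_prod (preserving_shift (complex.Re a))
  (preserving_shift (complex.Im a)))).
- by apply: cmeasD => //; exact: measurable_cst.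
- by move=> p; case: a.
Qed.

Let shear1 (t : R) : preserving (@lebesgue_measure R \x @lebesgue_measure R)%E
    (@lebesgue_measure R \x @lebesgue_measure R)%E (fun z => (z.1, z.2 + t * z.1)).
Proof.
apply: (@preserving_skew _ _ (measurableTypeR R) (measurableTypeR R)
  lebesgue_measure lebesgue_measure (fun x y : R => y + t * x)).
  apply: measurable_funD; first exact: measurable_snd.
  by apply: measurable_funM; [exact: measurable_cst|exact: measurable_fst].
by move=> x; exact: preserving_shift.
Qed.

Let shear2 (t : R) : preserving (@lebesgue_measure R \x @lebesgue_measure R)%E
    (@lebesgue_measure R \x @lebesgue_measure R)%E (fun z => (z.1 + t * z.2, z.2)).
Proof.
have := preserving_comp (preserving_comp (preserving_swap (@lebesgue_measure R)
  (@lebesgue_measure R)) (shear1 t)) (preserving_swap (@lebesgue_measure R)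
  (@lebesgue_measure R)).
exact.
Qed.

(* A rotation of angle different from pi is a product of three shears. *)
Lemma preserving_rotateC (c : R[i]) : normc c = 1 ->
  preserving (@lebesgueC R) (@lebesgueC R) (fun z => c * z).
Proof.
have mM e : measurable_fun setT (fun z : R[i] => e * z).
  by apply: cmeasM => //; exact: measurable_cst.
have rot (e : R[i]) : normc e = 1 -> complex.Re e != -1 ->
    preserving (@lebesgueC R) (@lebesgueC R) (fun z => e * z).
  move=> e1 eN1; have := normc_sq e; rewrite e1 expr1n.
  case: e e1 eN1 => a b _ /= aN1 ab.
  have a1 : 1 + a != 0 by rewrite addrC addr_eq0.
  (* Tangent of half the rotation angle; the three shears have coefficients [- t], [b], [- t]. *)
  pose t := b / (1 + a).
  apply: (preserving_lebesgueC (preserving_comp (preserving_comp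
    (shear2 (- t)) (shear1 b)) (shear2 (- t)))) => // -[x y].
  have tb : t * b = 1 - a.
    rewrite /t mulrAC -expr2 (_ : b ^+ 2 = (1 - a) * (1 + a)).
      by rewrite mulfK.
    by rewrite -[b ^+ 2](addKr (a ^+ 2)) -ab; ring.
  have ta : t * (1 + a) = b by rewrite /t divfK.
  apply/eqP; rewrite eq_complex /=; apply/andP; split; apply/eqP.
  - transitivity (x * (1 - t * b) - y * (t * (2 - t * b))); last by ring.
    by rewrite tb (_ : 2 - (1 - a) = 1 + a) ?ta; ring.
  - transitivity (b * x + y * (1 - t * b)); last by ring.
    by rewrite tb; ring.
move=> c1; have [cN1|] := eqVneq (complex.Re c) (-1); last exact: rot.
(* The excluded half turn is two quarter turns. *)
have -> : c = 'i * 'i.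
  have := normc_sq c; rewrite c1 cN1 expr1n sqrrN expr1n => /eqP.
  rewrite addrC -subr_eq subrr eq_sym sqrf_eq0 => /eqP c0.
  by rewrite -[c]complexReIm cN1 c0; simpc; congr (_ +i* _); ring.
have ri : preserving (@lebesgueC R) (@lebesgueC R) (fun z => 'i * z).
  apply: rot => /=; first by rewrite expr0n expr1n add0r sqrtr1.
  by rewrite eq_sym oppr_eq0 oner_eq0.
have := preserving_comp ri ri; congr preserving.
by apply/funext => z /=; rewrite mulrA.
Qed.

Section rows.
Context d (T : measurableType d).
Variable mu : {sigma_finite_measure set T -> \bar R}.

Definition rowmap n (S : 'I_n -> T -> T) (z : 'rV[T]_n) : 'rV[T]_n :=
  \row_k S k (z ord0 k).

Lemma measurable_rowmap n (S : 'I_n -> T -> T) :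
  (forall k, measurable_fun setT (S k)) -> measurable_fun setT (rowmap S).
Proof.
move=> mS; apply: measurable_fun_row => k; under eq_fun do rewrite mxE.
by apply: measurableT_comp; [exact: mS|exact: measurable_row_coord].
Qed.

Lemma preserving_rows n (S : 'I_n -> T -> T) :
  (forall k, preserving mu mu (S k)) ->
  preserving (row_power mu n) (row_power mu n) (rowmap S).
Proof.
elim: n S => [|n ih] S pS.
  have -> : rowmap S = id; last exact: preserving_id.
  by apply/funext => z; apply/rowP => -[].
split; first by apply: measurable_rowmap => k; case: (pS k).
move=> A mA; rewrite /= /row_succ /pushforward.
pose S' k := S (lift ord0 k).
have [_ h] := preserving_prod (pS ord0) (ih S' (fun k => pS (lift ord0 k))).
have E p : rowmap S (row_cons p) = row_cons (S ord0 p.1, rowmap S' p.2).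
  case: p => x z; apply/rowP => k; rewrite /row_cons !mxE.
  case: (splitP (k : 'I_(1 + n))) => j jE.
    have -> : k = ord0 by apply/val_inj; rewrite /= jE; case: j {jE} => -[].
    by rewrite !mxE.
  rewrite !mxE /S'; congr (S _ _); apply/val_inj; rewrite /= jE.
    by rewrite /bump leq0n.
have mA' : measurable (@row_cons _ T n @^-1` A).
  by rewrite -[X in measurable X]setTI; exact: measurable_row_cons.
rewrite -(h _ mA').
have -> // : @row_cons _ T n @^-1` (rowmap S @^-1` A) =
  (fun z => (S ord0 z.1, rowmap S' z.2)) @^-1` (@row_cons _ T n @^-1` A).
by apply/seteqP; split=> p /=; rewrite E.
Qed.

Lemma ge0_integral_rows n (g : T -> R) : measurable_fun setT g ->
  (forall x, 0 <= g x) ->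
  (\int[row_power mu n]_z (\prod_k g (z ord0 k))%:E =
   (\int[mu]_x (g x)%:E) ^+ n)%E.
Proof.
move=> mg g0; elim: n => [|n ih].
  rewrite /= (eq_integral (fun=> 1%:E)); last by move=> z _; rewrite big_ord0.
  by rewrite integral_dirac// diracT mul1e.
have mP k : measurable_fun setT (fun z : 'rV[T]_k => (\prod_i g (z ord0 i))%:E).
  apply/measurable_EFinP; apply: measurable_prod => i _.
  by apply: measurableT_comp => //; exact: measurable_row_coord.
have P0 k (z : 'rV[T]_k) : (0 <= (\prod_i g (z ord0 i))%:E)%E.
  by rewrite lee_fin prodr_ge0.
rewrite expeS -ih /= /row_succ (ge0_integral_pushforward (@measurable_row_cons _ T n))//; last first.
  by move=> z _; exact: P0.
  exact: (mP n.+1).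
rewrite preimage_setT.
rewrite (eq_integral (fun p : T * 'rV[T]_n => ((g p.1)%:E * (\prod_i g (p.2 ord0 i))%:E)%E)); last first.
  move=> [x z] _ /=; rewrite -EFinM big_ord_recl; congr (_ * _)%:E.
    by rewrite /row_cons mxE; case: splitP => // j _; rewrite mxE.
  apply: eq_bigr => i _; rewrite /row_cons mxE; case: splitP => [[[]//]|j].
  by rewrite /= /bump leq0n !add1n => -[] /val_inj ->.
have mg1 : measurable_fun setT (fun p : T * 'rV[T]_n => (g p.1)%:E).
  by apply/measurable_EFinP; exact: measurableT_comp.
have mg2 : measurable_fun setT (fun p : T * 'rV[T]_n => (\prod_i g (p.2 ord0 i))%:E).
  exact: (measurableT_comp (mP n) measurable_snd).
rewrite (fubini_tonelli1 (fun p : T * 'rV[T]_n => ((g p.1)%:E *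
  (\prod_i g (p.2 ord0 i))%:E)%E)); last 2 first.
- exact: (emeasurable_funM mg1 mg2).
- by move=> p; apply: mule_ge0; [rewrite lee_fin|exact: P0].
rewrite -ge0_integralZr//; last 3 first.
- by apply/measurable_EFinP.
- by move=> x _; rewrite lee_fin.
- by apply: integral_ge0 => z _; exact: P0.
apply: eq_integral => x _; rewrite /fubini_F -ge0_integralZl//.
- exact: (mP n).
- by move=> z _; exact: P0.
- by rewrite lee_fin.
Qed.

End rows.

End preserving.

(** * Gaussian weights *)

Section gaussian.
Variable R : realType.
Local Notation C := R[i].

Lemma integral_gauss1 (t : R) : 0 < t ->
  (\int[@lebesgue_measure R]_x (expR (- (t * x ^+ 2)))%:E = (Num.sqrt (pi / t))%:E)%E.
Proof.
(* With this standard deviation the normal density is a multiple of [expR (- (t * x ^+ 2))], and its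
   total mass 1 gives the integral. *)
move=> t0; pose s := Num.sqrt ((2 * t)^-1).
have s2 : s ^+ 2 = (2 * t)^-1 by rewrite sqr_sqrtr// invr_ge0 mulr_ge0// ltW.
have s0 : s != 0 by rewrite gt_eqF// sqrtr_gt0 invr_gt0 mulr_gt0.
have E x : normal_pdf 0 s x = normal_peak s * expR (- (t * x ^+ 2)).
  rewrite normal_pdfE//; congr (_ * expR _).
  by rewrite subr0 s2; field; rewrite gt_eqF.
have := integral_normal_pdf 0 s.
under eq_integral do rewrite E EFinM.
rewrite ge0_integralZl//; last 2 first.
- apply/measurable_EFinP; apply: measurableT_comp => //.
  by apply: measurable_funN; apply: measurable_funM => //; exact: measurable_funX.
- by rewrite lee_fin normal_peak_ge0.
set I := (\int[_]_x _)%E => h.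
have p0 := normal_peak_gt0 s0.
have -> : I = (((normal_peak s)^-1)%:E * ((normal_peak s)%:E * I))%E.
  by rewrite muleA -EFinM mulVf ?mul1e// gt_eqF.
rewrite h mule1 /normal_peak invrK s2 -mulr_natr; congr (Num.sqrt _)%:E.
by field; rewrite gt_eqF.
Qed.

Lemma integral_gaussC (t : R) : 0 < t ->
  (\int[@lebesgueC R]_z (expR (- (t * normc z ^+ 2)))%:E = (pi / t)%:E)%E.
Proof.
move=> t0.
have me : measurable_fun setT (fun x : R => (expR (- (t * x ^+ 2)))%:E).
  apply/measurable_EFinP; apply: measurableT_comp => //.
  by apply: measurable_funN; apply: measurable_funM => //.
have e0 (x : R) : (0 <= (expR (- (t * x ^+ 2)))%:E)%E by rewrite lee_fin expR_ge0.
rewrite -(preserving_ge0_integral (h := fun z : C => (expR (- (t * normc z ^+ 2)))%:E)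
  (of_reals_preserving R)); last 2 first.
- apply/measurable_EFinP; apply: measurableT_comp => //.
  apply: measurable_funN; apply: measurable_funM => //.
  by apply: measurable_funX; apply: (@cmeas_normc _ _ _ id).
- by move=> z; rewrite lee_fin expR_ge0.
rewrite (eq_integral (fun p : measurableTypeR R * measurableTypeR R => ((expR (- (t * p.1 ^+ 2)))%:E *
  (expR (- (t * p.2 ^+ 2)))%:E)%E)); last first.
  by move=> [x y] _; rewrite normc_sq /= -EFinM -expRD; congr (expR _)%:E; ring.
rewrite (fubini_tonelli1 (fun p : measurableTypeR R * measurableTypeR R => ((expR (- (t * p.1 ^+ 2)))%:E *
  (expR (- (t * p.2 ^+ 2)))%:E)%E)); last 2 first.
- apply: emeasurable_funM; first exact: (measurableT_comp me measurable_fst).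
  exact: (measurableT_comp me measurable_snd).
- by move=> p; rewrite mule_ge0.
under eq_integral do rewrite /fubini_F/= ge0_integralZl// integral_gauss1//.
rewrite ge0_integralZr ?lee_fin ?sqrtr_ge0// integral_gauss1// -EFinM -expr2.
by rewrite sqr_sqrtr// divr_ge0 ?pi_ge0// ltW.
Qed.

Variable n : nat.
Local Notation Cn := 'rV[C]_n.

Definition sq (z : Cn) : R := \sum_k normc (z ord0 k) ^+ 2.

Definition gauss (t : R) (z : Cn) : R := expR (- (t * sq z)).

Lemma sq_ge0 z : 0 <= sq z.
Proof. by apply: sumr_ge0 => k _; rewrite sqr_ge0. Qed.

Lemma gauss_gt0 t z : 0 < gauss t z. Proof. exact: expR_gt0. Qed.
Lemma gauss_ge0 t z : 0 <= gauss t z. Proof. exact: expR_ge0. Qed.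

Lemma measurable_coord (k : 'I_n) : measurable_fun setT (fun z : Cn => z ord0 k).
Proof. exact: measurable_row_coord. Qed.

Lemma measurable_sq : measurable_fun setT sq.
Proof.
apply: measurable_sum => k; apply: measurable_funX.
by apply: cmeas_normc; exact: measurable_coord.
Qed.

Lemma measurable_gauss t : measurable_fun setT (gauss t).
Proof.
apply: measurableT_comp => //; apply: measurable_funN.
by apply: measurable_funM => //; exact: measurable_sq.
Qed.

Lemma integral_gauss t : 0 < t ->
  (\int[@dV R n]_z (gauss t z)%:E = ((pi / t) ^+ n)%:E)%E.
Proof.
move=> t0.
rewrite (eq_integral (fun z : Cn =>
    (\prod_k expR (- (t * normc (z ord0 k) ^+ 2)))%:E)); last first.
  by move=> z _; rewrite -expR_sum sumrN -mulr_sumr.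
rewrite (@ge0_integral_rows R _ _ (@lebesgueC R) n
  (fun x => expR (- (t * normc x ^+ 2)))).
- by rewrite integral_gaussC// EFin_expe.
- apply: measurableT_comp => //; apply: measurable_funN; apply: measurable_funM => //.
  by apply: measurable_funX; apply: (@cmeas_normc _ _ _ id).
- by move=> x; exact: expR_ge0.
Qed.

Lemma gauss_integrable t : 0 < t -> (@dV R n).-integrable setT (fun z => (gauss t z)%:E).
Proof.
move=> t0; apply/integrableP; split.
  by apply/measurable_EFinP; exact: measurable_gauss.
under eq_integral do rewrite gee0_abs ?lee_fin ?gauss_ge0//.
by rewrite integral_gauss// ltry.
Qed.

Lemma Rintegral_gauss t : 0 < t -> \int[@dV R n]_z gauss t z = (pi / t) ^+ n.
Proof. by move=> t0; rewrite /Rintegral integral_gauss. Qed.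

Lemma sqnormE (z : Cn) : sqnorm z = (sq z)%:C.
Proof.
rewrite /sqnorm /dot /sq rmorph_sum; apply: eq_bigr => k _.
by rewrite mxE NumconjE mulc_conj.
Qed.

Lemma cexp_real (x : R) : cexp x%:C = (expR x)%:C.
Proof. by rewrite /cexp /= cos0 sin0 mulr1. Qed.

Lemma cexp_sqnorm (t : R) (z : Cn) : cexp (- (t%:C * sqnorm z)) = (gauss t z)%:C.
Proof. by rewrite sqnormE -rmorphM -rmorphN cexp_real. Qed.

Lemma sqZ (c : C) z : sq (c *: z) = normc c ^+ 2 * sq z.
Proof. by rewrite /sq mulr_sumr; apply: eq_bigr => k _; rewrite mxE normcM exprMn. Qed.

Lemma preserving_translate (w : Cn) : preserving (@dV R n) (@dV R n) (fun z => z + w).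
Proof.
rewrite (_ : (fun z => z + w) = rowmap (fun (k : 'I_n) (x : C) => x + w ord0 k)).
  by apply: preserving_rows => k; exact: preserving_translateC.
by apply/funext => z; apply/rowP => k; rewrite !mxE.
Qed.

Lemma preserving_rotate (c : C) : normc c = 1 ->
  preserving (@dV R n) (@dV R n) (fun z => c *: z).
Proof.
move=> c1; rewrite (_ : (fun z => c *: z) = rowmap (fun (_ : 'I_n) (x : C) => c * x)).
  by apply: preserving_rows => k; exact: preserving_rotateC.
by apply/funext => z; apply/rowP => k; rewrite !mxE.
Qed.

Section into_rows.
Context d (T : measurableType d).
Implicit Types f g : T -> Cn.

Lemma cmeas_rowP f : (forall k, measurable_fun setT (fun x => f x ord0 k)) ->
  measurable_fun setT f.
Proof. exact: measurable_fun_row. Qed.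

Lemma cmeas_coord f k : measurable_fun setT f ->
  measurable_fun setT (fun x => f x ord0 k).
Proof. by move=> mf; exact: (measurableT_comp (measurable_coord k) mf). Qed.

Lemma cmeas_rowD f g : measurable_fun setT f -> measurable_fun setT g ->
  measurable_fun setT (fun x => f x + g x).
Proof.
move=> mf mg; apply: cmeas_rowP => k; under eq_fun do rewrite mxE.
by apply: cmeasD; exact: cmeas_coord.
Qed.

Lemma cmeas_rowZ (c : T -> C) f : measurable_fun setT c -> measurable_fun setT f ->
  measurable_fun setT (fun x => c x *: f x).
Proof.
move=> mc mf; apply: cmeas_rowP => k; under eq_fun do rewrite mxE.
by apply: cmeasM => //; exact: cmeas_coord.
Qed.

Lemma cmeas_rowB f g : measurable_fun setT f -> measurable_fun setT g ->
  measurable_fun setT (fun x => f x - g x).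
Proof.
move=> mf mg; apply: cmeas_rowP => k; under eq_fun do rewrite !mxE.
by apply: cmeasB; exact: cmeas_coord.
Qed.

Lemma cmeas_conjv f : measurable_fun setT f -> measurable_fun setT (fun x => conjv (f x)).
Proof.
move=> mf; apply: cmeas_rowP => k; under eq_fun do rewrite !mxE.
by apply: cmeas_conj; exact: cmeas_coord.
Qed.

Lemma cmeas_dot f g : measurable_fun setT f -> measurable_fun setT g ->
  measurable_fun setT (fun x => dot (f x) (g x)).
Proof.
by move=> mf mg; apply: cmeas_sum => k _; apply: cmeasM; exact: cmeas_coord.
Qed.

End into_rows.

End gaussian.

(** * The complex exponential *)

Section cexp_theory.
Variable R : realType.
Local Notation C := R[i].
Implicit Types a b z : C.

Lemma cexpD a b : cexp (a + b) = cexp a * cexp b.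
Proof.
rewrite /cexp cReD cImD expRD cosD sinD rmorphM/= mulrACA; congr (_ * _).
by apply/eqP; rewrite eq_complex /=; apply/andP; split; apply/eqP; ring.
Qed.

Lemma cexp0 : cexp 0 = 1 :> C.
Proof. by rewrite -[0]/((0 : R)%:C) cexp_real expR0. Qed.

Lemma normc_cexp a : normc (cexp a) = expR (complex.Re a).
Proof.
rewrite /cexp normcM normcRe ger0_norm ?expR_ge0//=.
by rewrite cos2Dsin2 sqrtr1 mulr1.
Qed.

Lemma normc_cexp_le a : normc (cexp a) <= expR (normc a).
Proof. by rewrite normc_cexp ler_expR (le_trans (ler_norm _))// normc_Re. Qed.

Lemma cexp_conj a : (cj (cexp a)) = cexp (cj a).
Proof.
rewrite /cexp Reconjc Imconjc cosN sinN.
by apply/eqP; rewrite eq_complex /=; apply/andP; split; apply/eqP; ring.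
Qed.

Lemma cexp_neq0 a : cexp a != 0.
Proof.
apply/eqP => e0; have := normc_cexp a; rewrite e0 normc0 => /esym/eqP.
by rewrite gt_eqF// expR_gt0.
Qed.

Lemma cexp_sum (I : Type) (s : seq I) (F : I -> C) :
  cexp (\sum_(i <- s) F i) = \prod_(i <- s) cexp (F i).
Proof.
by elim: s => [|i s ih]; rewrite ?big_nil ?cexp0// !big_cons cexpD ih.
Qed.

(** The exponential and its Taylor polynomials are differentiated only along a ray [s * a] with [s]
    real, where componentwise real calculus suffices. *)
Let cder (g g' : R -> C) := forall s : R,
  is_derive s 1 (fun s => complex.Re (g s)) (complex.Re (g' s)) /\
  is_derive s 1 (fun s => complex.Im (g s)) (complex.Im (g' s)).

Let cderD f f' g g' : cder f f' -> cder g g' ->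
  cder (fun s => f s + g s) (fun s => f' s + g' s).
Proof.
move=> df dg s; have [df1 df2] := df s; have [dg1 dg2] := dg s.
by split; [under eq_fun do rewrite cReD|under eq_fun do rewrite cImD];
  rewrite ?cReD ?cImD; apply: is_deriveD.
Qed.

Let cderM f f' c : cder f f' -> cder (fun s => c * f s) (fun s => c * f' s).
Proof.
move=> df s; have [df1 df2] := df s.
have df1' k : is_derive s 1 (fun s => k * complex.Re (f s)) (k * complex.Re (f' s)).
  exact: (is_deriveZ k).
have df2' k : is_derive s 1 (fun s => k * complex.Im (f s)) (k * complex.Im (f' s)).
  exact: (is_deriveZ k).
split.
  by under eq_fun do rewrite cReM; rewrite cReM; exact: is_deriveB.
by under eq_fun do rewrite cImM; rewrite cImM; exact: is_deriveD.
Qed.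

Let cder_cexp a : cder (fun s => cexp (s%:C * a)) (fun s => a * cexp (s%:C * a)).
Proof.
move=> s; case: a => x y.
have E r : cexp (r%:C * (x +i* y)) =
    (expR (r * x) * cos (r * y)) +i* (expR (r * x) * sin (r * y)).
  by rewrite /cexp /=; simpc.
rewrite E; have d1 (k : R) : is_derive s 1 (fun r : R => r * k) k.
  have := @is_deriveM R R^o id (cst k) s 1 1 0 (is_derive_id s 1) (is_derive_cst k s 1).
  by move=> h; apply: is_derive_eq; rewrite /GRing.scale/= mulr0 add0r mulr1.
have de : is_derive s 1 (fun r => expR (r * x)) (x * expR (s * x)).
  have := @is_derive1_comp _ expR (fun r => r * x) s _ _ (is_derive_expR _) (d1 x).
  by move=> h; apply: (is_derive_eq h); rewrite mulrC.
have dc : is_derive s 1 (fun r => cos (r * y)) (- y * sin (s * y)).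
  have := @is_derive1_comp _ cos (fun r => r * y) s _ _ (is_derive_cos _) (d1 y).
  by move=> h; apply: (is_derive_eq h); ring.
have ds : is_derive s 1 (fun r => sin (r * y)) (y * cos (s * y)).
  have := @is_derive1_comp _ sin (fun r => r * y) s _ _ (is_derive_sin _) (d1 y).
  by move=> h; apply: (is_derive_eq h); ring.
split; under eq_fun do rewrite E /=.
  apply: (is_derive_eq (is_deriveM de dc)).
  by rewrite /GRing.scale/=; ring.
apply: (is_derive_eq (is_deriveM de ds)).
by rewrite /GRing.scale/=; ring.
Qed.

Definition taylor_exp (N : nat) a : C := \sum_(k < N) a ^+ k / k`!%:R.

Let is_deriveXn (f : R -> R) k (x df : R) : is_derive x 1 f df ->
  is_derive x 1 (fun y => f y ^+ k) (k%:R * f x ^+ k.-1 * df).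
Proof. by move=> /(is_deriveX k); rewrite exprfctE. Qed.

Let cder_taylor N a : cder (fun s => taylor_exp N.+1 (s%:C * a))
  (fun s => a * taylor_exp N (s%:C * a)).
Proof.
elim: N => [|N ih].
  have -> : (fun s : R => taylor_exp 1 (s%:C * a)) = fun=> 1.
    by apply/funext => s; rewrite /taylor_exp big_ord1 expr0 fact0 divr1.
  move=> s; rewrite /taylor_exp big_ord0 mulr0.
  by split; apply: (is_derive_eq (is_derive_cst _ s 1)).
have E : (fun s : R => taylor_exp N.+2 (s%:C * a)) =
    (fun s => taylor_exp N.+1 (s%:C * a) + (a ^+ N.+1 / (N.+1)`!%:R) * (s ^+ N.+1)%:C).
  apply/funext => s; rewrite /taylor_exp [LHS]big_ord_recr/=; congr (_ + _).
  by rewrite exprMn realcX; ring.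
have E' : (fun s : R => a * taylor_exp N.+1 (s%:C * a)) =
    (fun s => a * taylor_exp N (s%:C * a) +
       (a ^+ N.+1 / (N.+1)`!%:R) * (N.+1%:R * s ^+ N)%:C).
  apply/funext => s; rewrite /taylor_exp big_ord_recr/= mulrDr; congr (_ + _).
  rewrite exprMn realcM realcX realc_nat factS natrM exprS.
  by field; rewrite nat1r !pnatr_eq0 -!lt0n fact_gt0.
rewrite E E'; apply: cderD => //; apply: cderM => s /=; split; last exact: is_derive_cst.
apply: (is_derive_eq (is_deriveXn N.+1 (is_derive_id s 1))).
by rewrite mulr1.
Qed.

(** Induction on the order: along the ray the remainder of order [N + 1] has derivative [a] times
    the remainder of order [N], and the claimed bound grows at least as fast as the induction
    hypothesis allows. The parameter [s] gives access to that hypothesis at intermediate points. *)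
Let taylor_exp_bound_aux N a (s : R) : 0 <= s ->
  normc (cexp (s%:C * a) - taylor_exp N (s%:C * a)) <=
  (s * normc a) ^+ N / N`!%:R * expR (s * normc a).
Proof.
move=> s0; set A := normc a; have A0 : 0 <= A by exact: normc_ge0.
elim: N s s0 => [|N ih] s s0.
  rewrite /taylor_exp big_ord0 subr0 expr0 fact0 divr1 mul1r.
  by rewrite (le_trans (normc_cexp_le _))// ler_expR normcM normcRe ger0_norm.
pose D N (r : R) : C := cexp (r%:C * a) - taylor_exp N (r%:C * a).
pose B N (r : R) : R := (r * A) ^+ N / N`!%:R * expR (r * A).
rewrite -/(D N.+1 s) -/(B N.+1 s).
have B0 M r : 0 <= r -> 0 <= B M r.
  by move=> r0; rewrite /B !mulr_ge0 ?invr_ge0 ?expR_ge0 ?exprn_ge0 ?mulr_ge0.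
move: s0; rewrite le_eqVlt => /predU1P[<-|s0].
  rewrite /D mul0r cexp0 /taylor_exp big_ord_recl expr0 fact0 divr1 big1 ?addr0.
    by rewrite subrr normc0 B0.
  by move=> i _; rewrite exprS !mul0r.
have dD : cder (D N.+1) (fun r => a * D N r).
  rewrite /D; have E : (fun r => a * (cexp (r%:C * a) - taylor_exp N (r%:C * a))) =
      (fun r => a * cexp (r%:C * a) + (-1) * (a * taylor_exp N (r%:C * a))).
    by apply/funext => r; ring.
  have -> : (fun r => cexp (r%:C * a) - taylor_exp N.+1 (r%:C * a)) =
      (fun r => cexp (r%:C * a) + (-1) * taylor_exp N.+1 (r%:C * a)).
    by apply/funext => r; ring.
  by rewrite E; apply: cderD => //; exact: cderM.
have [->|Ds0] := eqVneq (D N.+1 s) 0; first by rewrite normc0 B0// ltW.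
have nD : 0 < normc (D N.+1 s).
  rewrite lt_neqAle normc_ge0 andbT eq_sym.
  by apply: contra Ds0 => /eqP/eq0_normc ->.
(* Unit factor that makes the remainder at the endpoint [s] real and positive, so that only a real
   part has to be compared. *)
pose c := (cj (D N.+1 s)) * ((normc (D N.+1 s))^-1)%:C.
have c1 : normc c = 1.
  rewrite normcM normc_conj normcRe ger0_norm ?invr_ge0 ?normc_ge0//.
  by rewrite divff// gt_eqF.
have cD : c * D N.+1 s = (normc (D N.+1 s))%:C.
  rewrite /c mulrAC (mulrC (cj _)) mulc_conj -rmorphM/=; congr (_%:C).
  by rewrite expr2 -mulrA divff ?mulr1// gt_eqF.
have -> : normc (D N.+1 s) = complex.Re (c * D N.+1 s) by rewrite cD.
(* [psi] vanishes at 0 and has nonnegative derivative on ]0, s[; its value at [s] is the gap in the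
   bound. *)
pose psi (r : R) : R := B N.+1 r - complex.Re (c * D N.+1 r).
pose B' (r : R) : R := A * B N r + A * B N.+1 r.
have d1 (r : R) : is_derive r 1 (fun r : R => r * A) A.
  have := @is_deriveM R R^o id (cst A) r 1 1 0 (is_derive_id r 1) (is_derive_cst A r 1).
  by move=> h; apply: is_derive_eq; rewrite /GRing.scale/= mulr0 add0r mulr1.
have dB (r : R) : is_derive r 1 (B N.+1) (B' r).
  have d2 := @is_derive1_comp _ expR (fun r => r * A) r _ _ (is_derive_expR _) (d1 r).
  have d3 := is_deriveZ (N.+1`!%:R^-1) (is_deriveXn N.+1 (d1 r)).
  have -> : B N.+1 = (fun r => N.+1`!%:R^-1 * (r * A) ^+ N.+1 * expR (r * A)).
    by apply/funext => x; rewrite /B (mulrC _^-1).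
  apply: (is_derive_eq (is_deriveM d3 d2)).
  rewrite /B' /B /GRing.scale/= factS natrM.
  rewrite -[X in X + _ = _]/((N.+1%:R * N`!%:R)^-1 * (r * A) ^+ N.+1 *
    (expR (r * A) * A)).
  by field; rewrite nat1r !pnatr_eq0 -!lt0n fact_gt0.
have dpsi (r : R) : is_derive r 1 psi (B' r - complex.Re (c * (a * D N r))).
  by apply: is_deriveB; have [] := cderM c dD r.
have cpsi : continuous psi.
  move=> r; apply: differentiable_continuous; apply/derivable1_diffP.
  by have [] := dpsi r.
have [r /[!in_itv]/= /andP[r0 rs]] :=
  MVT s0 (fun r _ => dpsi r) (continuous_subspaceT cpsi).
have -> : psi 0 = 0.
  rewrite /psi /B /D mul0r (mul0r a) cexp0 /taylor_exp big_ord_recl expr0 fact0 divr1 big1 ?addr0.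
    by rewrite subrr mulr0 exprS !mul0r subr0.
  by move=> i _; rewrite exprS !mul0r.
rewrite !subr0 -subr_ge0 -/(psi s) => ->.
apply: mulr_ge0; last exact: ltW.
rewrite subr_ge0 (@le_trans _ _ (A * B N r))//.
  rewrite (le_trans (ler_norm _))// (le_trans (normc_Re _))// normcM c1 mul1r normcM.
  by rewrite ler_wpM2l// ih// ltW.
by rewrite lerDl mulr_ge0// B0// ltW.
Qed.

Lemma taylor_exp_bound N a :
  normc (cexp a - taylor_exp N a) <= normc a ^+ N / N`!%:R * expR (normc a).
Proof.
by have := @taylor_exp_bound_aux N a 1 ler01; rewrite rmorph1 !mul1r.
Qed.

Lemma normc_taylor_exp_le N a : normc (taylor_exp N a) <= expR (normc a).
Proof.
have h : normc (taylor_exp N a) <= \sum_(k < N) normc a ^+ k / k`!%:R.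
  apply: le_trans (normc_sum _ _ _) _; apply: ler_sum => k _.
  rewrite normcM normcX normcV ler_wpM2l ?exprn_ge0 ?normc_ge0//.
  by rewrite -(rmorph_nat (real_complex R)) normcRe ger0_norm.
apply: (le_trans h).
have -> : \sum_(k < N) normc a ^+ k / k`!%:R = series (exp_coeff (normc a)) N.
  by rewrite /series/= big_mkord.
apply: nondecreasing_cvgn_le; last exact: is_cvg_series_exp_coeff.
apply: nondecreasing_series => k _ _.
by rewrite /exp_coeff/= divr_ge0// exprn_ge0// normc_ge0.
Qed.

End cexp_theory.

(** * Goursat's theorem and circular means *)

Section complex_derivative.
Variable R : realType.
Local Notation C := R[i].
Implicit Types (F G : C -> C) (z l : C).

(** Complex derivative in division-free form: the increment [w = 0] needs no exception, and
    compositions can be estimated directly. *)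
Definition cderiv F z l := forall e : R, 0 < e -> exists2 d : R, 0 < d &
  forall w, normc w < d -> normc (F (z + w) - F z - l * w) <= e * normc w.

Definition cholo F := forall z, exists l, cderiv F z l.

Lemma cderiv_locally_lipschitz F z l : cderiv F z l ->
  exists2 d : R, 0 < d & forall w, normc w < d ->
    normc (F (z + w) - F z) <= (normc l + 1) * normc w.
Proof.
move=> /(_ 1 ltr01)[d d0 h]; exists d => // w /h hw.
rewrite -(subrK (l * w) (_ - _)) (le_trans (normcD _ _))//.
by rewrite normcM mulrDl addrC lerD2l.
Qed.

Lemma cderiv_cont F z l : cderiv F z l -> forall e : R, 0 < e ->
  exists2 d : R, 0 < d & forall w, normc w < d -> normc (F (z + w) - F z) <= e.
Proof.
move=> /cderiv_locally_lipschitz[d d0 h] e e0.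
have k0 : 0 < normc l + 1 by rewrite ltr_wpDl ?normc_ge0.
exists (Num.min d (e / (normc l + 1))); first by rewrite lt_min d0 divr_gt0.
move=> w; rewrite lt_min => /andP[wd we]; rewrite (le_trans (h w wd))//.
by rewrite mulrC -ler_pdivlMr// ltW.
Qed.

Lemma cderiv_cst c z : cderiv (fun=> c) z 0.
Proof.
move=> e e0; exists 1 => // w _.
by rewrite subrr mul0r subr0 normc0 mulr_ge0 ?normc_ge0// ltW.
Qed.

Lemma cderiv_id z : cderiv id z 1.
Proof.
move=> e e0; exists 1 => // w _.
rewrite /= (_ : _ - _ - _ = 0); last by ring.
by rewrite normc0 mulr_ge0 ?normc_ge0// ltW.
Qed.

Lemma cderivD F G z l k : cderiv F z l -> cderiv G z k ->
  cderiv (fun x => F x + G x) z (l + k).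
Proof.
move=> dF dG e e0; have e2 : 0 < e / 2 by rewrite divr_gt0.
have [d1 d10 h1] := dF _ e2; have [d2 d20 h2] := dG _ e2.
exists (Num.min d1 d2); first by rewrite lt_min d10.
move=> w; rewrite lt_min => /andP[/h1 w1 /h2 w2].
rewrite (_ : _ - _ - _ = (F (z + w) - F z - l * w) + (G (z + w) - G z - k * w)); last by ring.
by rewrite (le_trans (normcD _ _))// (splitr e) mulrDl lerD.
Qed.

Lemma cderivM F G z l k : cderiv F z l -> cderiv G z k ->
  cderiv (fun x => F x * G x) z (l * G z + F z * k).
Proof.
move=> dF dG e e0.
have [d0 d00 h0] := cderiv_locally_lipschitz dF.
(* [K - 1] is the total weight with which the tolerance [e / K] enters the three terms of the
   product remainder; the extra 1 keeps [K] positive. *)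
pose K := normc (G z) + normc (F z) + (normc l + 1) * (normc k + 1) + 1.
have K1 : 1 <= K by rewrite lerDr !addr_ge0 ?mulr_ge0 ?addr_ge0 ?normc_ge0.
have K0 : 0 < K by rewrite (lt_le_trans ltr01).
have e2 : 0 < e / K by rewrite divr_gt0.
have [d1 d10 h1] := dF _ e2; have [d2 d20 h2] := dG _ e2.
have [d3 d30 h3] := cderiv_locally_lipschitz dG.
exists (Num.min (Num.min d0 (Num.min d3 (e / K))) (Num.min d1 d2)).
  by rewrite !lt_min d00 d10 d20 d30 e2.
move=> w; rewrite !lt_min => /andP[/and3P[/h0 w0 /h3 w3 we] /andP[/h1 w1 /h2 w2]].
rewrite (_ : _ - _ - _ = (F (z + w) - F z - l * w) * G z +
  F z * (G (z + w) - G z - k * w) + (F (z + w) - F z) * (G (z + w) - G z)); last by ring.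
have nw := normc_ge0 w; have := normc_ge0 (G z); have := normc_ge0 (F z) => F0 G0.
have l1 : 0 <= normc l + 1 by rewrite addr_ge0 ?normc_ge0.
have k1 : 0 <= normc k + 1 by rewrite addr_ge0 ?normc_ge0.
apply: (@le_trans _ _ (e / K * normc w * normc (G z) + normc (F z) * (e / K * normc w) +
  ((normc l + 1) * normc w) * ((normc k + 1) * (e / K)))).
  rewrite (le_trans (normcD _ _))// lerD//.
    by rewrite (le_trans (normcD _ _))// !normcM lerD// ?ler_wpM2r ?ler_wpM2l.
  rewrite normcM ler_pM ?normc_ge0//.
  by rewrite (le_trans w3)// ler_wpM2l// ltW.
rewrite (_ : _ + _ = e / K * (K - 1) * normc w); last by rewrite /K; ring.
rewrite ler_wpM2r// mulrAC ler_pdivrMr// ler_wpM2l ?ltW//.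
by rewrite ltrBlDr ltrDl.
Qed.

Lemma cderiv_comp F G z l k : cderiv G z k -> cderiv F (G z) l ->
  cderiv (fun x => F (G x)) z (l * k).
Proof.
move=> dG dF e e0.
have [d0 d00 h0] := cderiv_locally_lipschitz dG.
have k1 : 0 < normc k + 1 by rewrite ltr_wpDl ?normc_ge0.
have l1 : 0 < normc l + 1 by rewrite ltr_wpDl ?normc_ge0.
have e1 : 0 < e / 2 / (normc k + 1) by rewrite !divr_gt0.
have e2 : 0 < e / 2 / (normc l + 1) by rewrite !divr_gt0.
have [d1 d10 h1] := dF _ e1; have [d2 d20 h2] := dG _ e2.
exists (Num.min (Num.min d0 d2) (d1 / (normc k + 1))).
  by rewrite !lt_min d00 d20 divr_gt0.
move=> w; rewrite !lt_min ltr_pdivlMr// => /andP[/andP[/h0 w0 /h2 w2] w1].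
have w3 : normc (G (z + w) - G z) < d1 by rewrite (le_lt_trans w0)// mulrC.
have := h1 _ w3; rewrite [G z + _]addrC subrK => h3.
rewrite (_ : _ - _ - _ = (F (G (z + w)) - F (G z) - l * (G (z + w) - G z)) +
  l * (G (z + w) - G z - k * w)); last by ring.
rewrite (le_trans (normcD _ _))// (splitr e) mulrDl lerD//.
  rewrite (le_trans h3)// (le_trans (ler_wpM2l (ltW e1) w0))//.
  by rewrite mulrA divfK// gt_eqF.
rewrite normcM (le_trans (ler_wpM2l (normc_ge0 l) w2))// mulrA ler_wpM2r ?normc_ge0//.
rewrite mulrA ler_pdivrMr// [leLHS]mulrC ler_wpM2l ?divr_ge0 ?(ltW e0)//.
by rewrite lerDl ler01.
Qed.

Lemma cderiv_conj F z l : cderiv F (cj z) l ->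
  cderiv (fun x => (cj (F (cj x)))) z (cj l).
Proof.
move=> dF e /dF[d d0 h]; exists d => // w wd.
have := h (cj w); rewrite !normc_conj => /(_ wd).
rewrite (_ : _ - _ - (cj l) * w = (cj (F ((cj z) + (cj w)) - F (cj z) - l * (cj w)))) ?normc_conj//.
by rewrite !conjcD !conjcN conjcM cjK.
Qed.

Lemma cderiv_cexp z : cderiv (@cexp R) z (cexp z).
Proof.
move=> e e0; have K0 : 0 < normc (cexp z) * expR 1.
  by rewrite normc_cexp mulr_gt0 ?expR_gt0.
exists (Num.min 1 (e / (normc (cexp z) * expR 1))).
  by rewrite lt_min ltr01 divr_gt0.
move=> w; rewrite lt_min => /andP[w1 we].
rewrite cexpD (_ : _ - _ - _ = cexp z * (cexp w - taylor_exp 2 w)); last first.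
  by rewrite /taylor_exp !big_ord_recr big_ord0/= expr0 expr1 !divr1; ring.
rewrite normcM (le_trans (ler_wpM2l (normc_ge0 _) (taylor_exp_bound 2 w)))//.
have nw := normc_ge0 w.
rewrite (@le_trans _ _ (normc (cexp z) * (normc w ^+ 2 * expR 1)))//.
  rewrite ler_wpM2l ?normc_ge0// ler_pM ?divr_ge0 ?sqr_ge0 ?expR_ge0//.
    by rewrite ler_pdivrMr ?ltr0n// ler_peMr ?sqr_ge0// ler1n.
  by rewrite ler_expR ltW.
rewrite expr2 (_ : _ * _ = normc (cexp z) * expR 1 * normc w * normc w); last by ring.
by rewrite ler_wpM2r// mulrC -ler_pdivlMr// ltW.
Qed.

Lemma choloD F G : cholo F -> cholo G -> cholo (fun x => F x + G x).
Proof.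
by move=> hF hG z; have [l dl] := hF z; have [k dk] := hG z;
  exists (l + k); exact: cderivD.
Qed.

Lemma choloM F G : cholo F -> cholo G -> cholo (fun x => F x * G x).
Proof.
by move=> hF hG z; have [l dl] := hF z; have [k dk] := hG z; exists (l * G z + F z * k); exact: cderivM.
Qed.

Lemma cholo_comp F G : cholo G -> cholo F -> cholo (fun x => F (G x)).
Proof.
by move=> hG hF z; have [k dk] := hG z; have [l dl] := hF (G z);
  exists (l * k); exact: cderiv_comp dk dl.
Qed.

Lemma cholo_conj F : cholo F -> cholo (fun x => (cj (F (cj x)))).
Proof. by move=> hF z; have [l dl] := hF (cj z); exists (cj l); exact: cderiv_conj. Qed.

Lemma cholo_cexp : cholo (@cexp R).
Proof. by move=> z; exists (cexp z); exact: cderiv_cexp. Qed.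

Lemma cholo_cst c : cholo (fun=> c).
Proof. by move=> z; exists 0; exact: cderiv_cst. Qed.

Lemma cholo_id : cholo id.
Proof. by move=> z; exists 1; exact: cderiv_id. Qed.

End complex_derivative.

(** * Integrals over bounded intervals, and Goursat's theorem on rectangles *)

Section goursat.
Variable R : realType.
Local Notation C := R[i].
Local Notation leb := (@lebesgue_measure R).

(** Half-open intervals make the indicators of adjacent intervals add up exactly, so that splitting
    an interval is a pointwise identity. *)
Definition itg (f : R -> C) (a b : R) : C :=
  cintegral leb (fun x => (\1_(`]a, b]%classic) x)%:C * f x).

Definition locbdd (f : R -> C) :=
  measurable_fun setT (f : measurableTypeR R -> C) /\
  forall a b, exists M : R, forall x, a <= x <= b -> normc (f x) <= M.

Lemma integrable_indic_oc (a b M : R) :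
  leb.-integrable setT (fun x => (\1_(`]a, b]%classic) x * M)%:E).
Proof.
have := integrableZr measurableT M (integrable_indic_itv a b false false).
exact: eq_integrable.
Qed.

Lemma Rintegral_indic_oc (a b M : R) : a <= b ->
  \int[leb]_x (\1_(`]a, b]%classic) x * M) = (b - a) * M.
Proof.
move=> ab; rewrite /Rintegral.
under eq_integral do rewrite EFinM.
rewrite integralZr//; last exact: (integrable_indic_itv a b false false).
rewrite integral_indic// setIT /= lebesgue_measure_itv/= lte_fin.
case: ltP => [_|ba]; first by [].
by rewrite mul0e (_ : a = b) ?subrr ?mul0r//; apply/eqP; rewrite eq_le ab.
Qed.

Lemma itg_integrable f a b : locbdd f ->
  cintegrable leb (fun x => (\1_(`]a, b]%classic) x)%:C * f x).
Proof.
move=> [mf /(_ a b)[M hM]].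
apply: (@cintegrable_ler _ (measurableTypeR R) R leb _
  (fun x : measurableTypeR R => (\1_(`]a, b]%classic) x * M : R))).
- apply: cmeasM => //; apply: cmeas_real; exact: measurable_indic.
- exact: integrable_indic_oc.
move=> x; rewrite normcM normcRe indicE; case: (boolP (x \in _)) => [|_].
  rewrite inE/= in_itv/= => /andP[ax xb]; rewrite normr1 !mul1r hM//.
  by rewrite xb ltW.
by rewrite normr0 !mul0r.
Qed.

Lemma itgD f g a b : locbdd f -> locbdd g ->
  itg (fun x => f x + g x) a b = itg f a b + itg g a b.
Proof.
move=> bf bg; rewrite /itg -cintegralD; [|exact: itg_integrable..].
by apply: eq_cintegral => x; rewrite mulrDr.
Qed.

Lemma itgB f g a b : locbdd f -> locbdd g ->
  itg (fun x => f x - g x) a b = itg f a b - itg g a b.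
Proof.
move=> bf bg; rewrite /itg -cintegralB; [|exact: itg_integrable..].
by apply: eq_cintegral => x; rewrite mulrBr.
Qed.

Lemma locbdd_cst c : locbdd (fun=> c).
Proof. by split; [exact: measurable_cst|move=> a b; exists (normc c)]. Qed.

Lemma locbddD f g : locbdd f -> locbdd g -> locbdd (fun x => f x + g x).
Proof.
move=> [mf bf] [mg bg]; split; first exact: cmeasD.
move=> a b; have [M hM] := bf a b; have [N hN] := bg a b; exists (M + N) => x ab.
by rewrite (le_trans (normcD _ _))// lerD ?hM ?hN.
Qed.

Lemma locbddN f : locbdd f -> locbdd (fun x => - f x).
Proof.
move=> [mf bf]; split; first exact: cmeasN.
by move=> a b; have [M hM] := bf a b; exists M => x /hM; rewrite normcN.
Qed.

Lemma itg_cst c a b : a <= b -> itg (fun=> c) a b = c * (b - a)%:C.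
Proof.
move=> ab; rewrite /itg cintegralZr; last first.
  apply: cintegrable_real.
  by have := integrable_indic_oc a b 1; apply: eq_integrable => // x _; rewrite mulr1.
rewrite cintegral_real mulrC; congr (_ * _%:C).
have := Rintegral_indic_oc 1 ab; rewrite mulr1 => <-.
by apply: eq_Rintegral => x _; rewrite mulr1.
Qed.

Lemma itg_split f a c b : locbdd f -> a <= c -> c <= b ->
  itg f a b = itg f a c + itg f c b.
Proof.
move=> bf ac cb; rewrite /itg -cintegralD; [|exact: itg_integrable..].
apply: eq_cintegral => x; rewrite -mulrDl -realcD; congr (_%:C * _).
rewrite !indicE !mem_setE !in_itv/=.
have [ax|xa] := ltP a x; have [xc|cx] := leP x c; rewrite ?andbF ?andbT/=.
- by rewrite (le_trans xc cb) addr0.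
- by rewrite add0r.
- by rewrite addr0.
- by have := lt_le_trans cx xa; rewrite ltNge ac.
Qed.

Lemma normc_itg_le f a b M : a <= b -> locbdd f ->
  (forall x, a <= x <= b -> normc (f x) <= M) -> normc (itg f a b) <= (b - a) * M.
Proof.
move=> ab bf hM; rewrite -Rintegral_indic_oc//.
apply: normc_cintegral_le; [exact: itg_integrable|exact: integrable_indic_oc|].
move=> x; rewrite normcM normcRe indicE; case: (boolP (x \in _)) => [|_].
  rewrite inE/= in_itv/= => /andP[ax xb]; rewrite normr1 !mul1r hM//.
  by rewrite xb ltW.
by rewrite normr0 !mul0r.
Qed.

End goursat.

Lemma normc_i (R : realType) : normc ('i : R[i]) = 1.
Proof. by rewrite /= expr0n expr1n add0r sqrtr1. Qed.

Lemma normc_dist (R : realType) (a b : R[i]) : `|normc a - normc b| <= normc (a - b).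
Proof.
have h1 : normc a <= normc (a - b) + normc b.
  by rewrite (le_trans _ (normcD _ _))// subrK.
have h2 : normc b <= normc (a - b) + normc a.
  have -> : normc (a - b) = normc (b - a) by rewrite -[LHS]normcN opprB.
  by rewrite (le_trans _ (normcD _ _))// subrK.
by rewrite ler_norml; lra.
Qed.

Section goursat_rectangle.
Variable R : realType.
Local Notation C := R[i].
Variable h : C -> C.
Hypotheses (mh : measurable_fun setT h) (hh : cholo h).

Let bdd_line (p : R -> C) : measurable_fun setT (p : measurableTypeR R -> C) ->
  (forall x t, normc (p t - p x) <= `|t - x|) -> locbdd (fun x => h (p x)).
Proof.
move=> mp pl; split; first exact: (measurableT_comp mh mp).
move=> a b; pose r (x : R) : R := normc (h (p x)).
have cr : continuous r.
  move=> x; apply/cvgrPdist_le => e e0.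
  have [l /cderiv_cont/(_ e e0)[d d0 hd]] := hh (p x).
  apply/nbhs_ballP; exists d => //= t; rewrite /ball/= => xt.
  have := hd (p t - p x) (le_lt_trans (pl _ _) _); rewrite distrC => /(_ xt).
  rewrite (addrC (p x)) subrK => le.
  by rewrite distrC (le_trans (normc_dist _ _)).
have [ab|ba] := leP a b.
  have [c _ hc] := EVT_max ab (continuous_subspaceT cr).
  by exists (r c) => x xab; apply: hc; rewrite in_itv.
by exists 0 => x /andP[ax xb]; have := le_lt_trans (le_trans ax xb) ba; rewrite ltxx.
Qed.

Lemma goursat_bddH y : locbdd (fun x => h (x +i* y)).
Proof.
apply: bdd_line; first by apply/cmeasurableP; split=> //=; exact: measurable_cst.
move=> x t; rewrite (_ : _ - _ = (t - x)%:C) ?normcRe//.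
by apply/eqP; rewrite eq_complex /= subrr !eqxx.
Qed.

Lemma goursat_bddV x : locbdd (fun y => h (x +i* y)).
Proof.
apply: bdd_line; first by apply/cmeasurableP; split=> //=; exact: measurable_cst.
move=> s t; rewrite (_ : _ - _ = 'i * (t - s)%:C).
  by rewrite normcM normcRe normc_i mul1r.
by apply/eqP; rewrite eq_complex /=; apply/andP; split; apply/eqP; ring.
Qed.

Let bddH : forall y, locbdd (fun x => h (x +i* y)) := goursat_bddH.
Let bddV : forall x, locbdd (fun y => h (x +i* y)) := goursat_bddV.

(** Integral of [h dz] counterclockwise along the boundary of the rectangle with lower left corner
    [a +i* b], width [l] and height [m]; on the vertical sides [dz] is ['i] times [dy]. *)
Definition rect (a l b m : R) : C :=
  itg (fun x => h (x +i* b)) a (a + l) - itg (fun x => h (x +i* (b + m))) a (a + l)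
  + 'i * (itg (fun y => h ((a + l) +i* y)) b (b + m)
          - itg (fun y => h (a +i* y)) b (b + m)).

Let rect_split (a l b m : R) : 0 <= l -> 0 <= m ->
  rect a l b m = (rect a (l / 2) b (m / 2) + rect (a + l / 2) (l / 2) b (m / 2)) +
   (rect a (l / 2) (b + m / 2) (m / 2) + rect (a + l / 2) (l / 2) (b + m / 2) (m / 2)).
Proof.
move=> l0 m0; have s1 : a + l / 2 + l / 2 = a + l by rewrite -addrA -splitr.
have s2 : b + m / 2 + m / 2 = b + m by rewrite -addrA -splitr.
rewrite /rect s1 s2.
have l2 : 0 <= l / 2 by rewrite divr_ge0.
have m2 : 0 <= m / 2 by rewrite divr_ge0.
have sH y : itg (fun x => h (x +i* y)) a (a + l) =
    itg (fun x => h (x +i* y)) a (a + l / 2) + itg (fun x => h (x +i* y)) (a + l / 2) (a + l).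
  apply: itg_split => //; first by rewrite lerDl.
  by rewrite lerD2l ler_pdivrMr// ler_peMr// ler1n.
have sV x : itg (fun y => h (x +i* y)) b (b + m) =
    itg (fun y => h (x +i* y)) b (b + m / 2) + itg (fun y => h (x +i* y)) (b + m / 2) (b + m).
  apply: itg_split => //; first by rewrite lerDl.
  by rewrite lerD2l ler_pdivrMr// ler_peMr// ler1n.
rewrite !sH !sV.
have alg (h1 h2 t1 t2 r1 r2 k1 k2 n1 n2 v1 v2 I : C) :
  h1 + h2 - (t1 + t2) + I * (r1 + r2 - (k1 + k2)) =
  h1 - n1 + I * (v1 - k1) + (h2 - n2 + I * (r1 - v1)) +
  (n1 - t1 + I * (v2 - k2) + (n2 - t2 + I * (r2 - v2))) by ring.
exact: alg.
Qed.

(** Pigeonhole: the inner sides cancel in the sum over the four quarters, so one quarter carries at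
    least a fourth of the modulus. *)
Let rect_pick (a l b m : R) : 0 <= l -> 0 <= m -> exists p : R * R,
  [/\ a <= p.1, p.1 + l / 2 <= a + l, b <= p.2, p.2 + m / 2 <= b + m &
   normc (rect a l b m) <= 4 * normc (rect p.1 (l / 2) p.2 (m / 2))].
Proof.
move=> l0 m0; apply: contrapT => nex.
have l2 : 0 <= l / 2 by rewrite divr_ge0.
have m2 : 0 <= m / 2 by rewrite divr_ge0.
have lt p : [/\ a <= p.1, p.1 + l / 2 <= a + l, b <= p.2 & p.2 + m / 2 <= b + m] ->
    4 * normc (rect p.1 (l / 2) p.2 (m / 2)) < normc (rect a l b m).
  by move=> [? ? ? ?]; rewrite ltNge; apply/negP => ?; apply: nex; exists p.
have e1 : a + l / 2 <= a + l by rewrite lerD2l ler_pdivrMr// ler_peMr// ler1n.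
have e2 : b + m / 2 <= b + m by rewrite lerD2l ler_pdivrMr// ler_peMr// ler1n.
have e3 : a + l / 2 + l / 2 <= a + l by rewrite -addrA -splitr.
have e4 : b + m / 2 + m / 2 <= b + m by rewrite -addrA -splitr.
have e5 : a <= a + l / 2 by rewrite lerDl.
have e6 : b <= b + m / 2 by rewrite lerDl.
have h1 : 4 * normc (rect a (l / 2) b (m / 2)) < normc (rect a l b m) :=
  lt (a, b) (And4 (lexx _) e1 (lexx _) e2).
have h2 : 4 * normc (rect (a + l / 2) (l / 2) b (m / 2)) < normc (rect a l b m) :=
  lt (a + l / 2, b) (And4 e5 e3 (lexx _) e2).
have h3 : 4 * normc (rect a (l / 2) (b + m / 2) (m / 2)) < normc (rect a l b m) :=
  lt (a, b + m / 2) (And4 (lexx _) e1 e6 e4).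
have h4 : 4 * normc (rect (a + l / 2) (l / 2) (b + m / 2) (m / 2)) < normc (rect a l b m) :=
  lt (a + l / 2, b + m / 2) (And4 e5 e3 e6 e4).
have : normc (rect a l b m) <= normc (rect a (l / 2) b (m / 2)) +
    normc (rect (a + l / 2) (l / 2) b (m / 2)) +
    (normc (rect a (l / 2) (b + m / 2) (m / 2)) +
     normc (rect (a + l / 2) (l / 2) (b + m / 2) (m / 2))).
  by rewrite (rect_split a b l0 m0) (le_trans (normcD _ _))// lerD// normcD.
move: h1 h2 h3 h4.
repeat match goal with |- context [normc ?x] => generalize (normc x); intro end.
by lra.
Qed.

(** The boundary integral of an affine function vanishes, so [h] may be replaced by its first-order
    remainder at [z], which is at most [e * rho] on the rectangle. *)
Let rect_bound (a l b m : R) (z L : C) (e rho : R) : 0 <= l -> 0 <= m ->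
  (forall x y, a <= x <= a + l -> b <= y <= b + m ->
     normc (h (x +i* y) - h z - L * ((x +i* y) - z)) <= e * rho) ->
  normc (rect a l b m) <= 2 * (e * rho) * (l + m).
Proof.
move=> l0 m0 H.
have al : a <= a + l by rewrite lerDl.
have bm : b <= b + m by rewrite lerDl.
pose D1 (x : R) := h (x +i* b) - h (x +i* (b + m)).
pose D2 (y : R) := h ((a + l) +i* y) - h (a +i* y).
have bD1 : locbdd D1 by apply: locbddD => //; exact: locbddN.
have bD2 : locbdd D2 by apply: locbddD => //; exact: locbddN.
(* Up to sign, what the affine part contributes to the two pairs of opposite sides; the total is
   zero because [c1 * l = 'i * c2 * m]. *)
pose c1 : C := L * 'i * m%:C.
pose c2 : C := L * l%:C.
have E : rect a l b m = itg (fun x => D1 x + c1) a (a + l) +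
    'i * itg (fun y => D2 y - c2) b (b + m).
  rewrite itgD//; last exact: locbdd_cst.
  rewrite itgB//; last exact: locbdd_cst.
  rewrite itgB// itgB// !itg_cst//.
  rewrite (_ : a + l - a = l); last by ring.
  rewrite (_ : b + m - b = m); last by ring.
  rewrite /rect /c1 /c2.
  repeat match goal with |- context [itg ?f ?x ?y] => generalize (itg f x y); intro end.
  by ring.
have b1 : normc (itg (fun x => D1 x + c1) a (a + l)) <= l * (2 * (e * rho)).
  rewrite -[l in leRHS](addrK a) (addrC l); apply: normc_itg_le => //.
    by apply: locbddD => //; exact: locbdd_cst.
  move=> x xa; have h1 := H x b xa; have h2 := H x (b + m) xa.
  rewrite (_ : _ + _ = (h (x +i* b) - h z - L * ((x +i* b) - z)) -
     (h (x +i* (b + m)) - h z - L * ((x +i* (b + m)) - z))); last first.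
    rewrite /c1 /D1 (_ : x +i* (b + m) = (x +i* b) + 'i * m%:C); first by ring.
    by apply/eqP; rewrite eq_complex /=; apply/andP; split; apply/eqP; ring.
  rewrite (le_trans (normcD _ _))// normcN mulr_natl mulr2n lerD//.
    by apply: h1; rewrite lexx.
  by apply: h2; rewrite lexx bm.
have b2 : normc (itg (fun y => D2 y - c2) b (b + m)) <= m * (2 * (e * rho)).
  rewrite -[m in leRHS](addrK b) (addrC m); apply: normc_itg_le => //.
    by apply: locbddD => //; exact: locbdd_cst.
  move=> y yb; have h1 := H a y _ yb; have h2 := H (a + l) y _ yb.
  rewrite (_ : _ - _ = (h ((a + l) +i* y) - h z - L * (((a + l) +i* y) - z)) -
     (h (a +i* y) - h z - L * ((a +i* y) - z))); last first.
    rewrite /c2 /D2 (_ : (a + l) +i* y = (a +i* y) + l%:C); first by ring.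
    by apply/eqP; rewrite eq_complex /=; apply/andP; split; apply/eqP; ring.
  rewrite (le_trans (normcD _ _))// normcN mulr_natl mulr2n lerD//.
    by apply: h2; rewrite lexx al.
  by apply: h1; rewrite lexx.
rewrite E (le_trans (normcD _ _))// normcM normc_i mul1r.
by rewrite mulrDr lerD// mulrC.
Qed.

Theorem goursat (a l b m : R) : 0 <= l -> 0 <= m -> rect a l b m = 0.
Proof.
move=> l0 m0.
have hl k : 0 <= l / 2 ^+ k by rewrite divr_ge0// exprn_ge0.
have hm k : 0 <= m / 2 ^+ k by rewrite divr_ge0// exprn_ge0.
(* The step number is carried along with the corner because the current side lengths [l / 2 ^+ k]
   and [m / 2 ^+ k] depend on it. *)
have /choice[nxt nxtP] : forall q : nat * (R * R), exists p : R * R,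
   [/\ q.2.1 <= p.1, p.1 + l / 2 ^+ q.1 / 2 <= q.2.1 + l / 2 ^+ q.1,
      q.2.2 <= p.2, p.2 + m / 2 ^+ q.1 / 2 <= q.2.2 + m / 2 ^+ q.1 &
   normc (rect q.2.1 (l / 2 ^+ q.1) q.2.2 (m / 2 ^+ q.1)) <=
   4 * normc (rect p.1 (l / 2 ^+ q.1 / 2) p.2 (m / 2 ^+ q.1 / 2))].
  by move=> [k [p1 p2]]; exact: rect_pick.
pose P := fix P k := if k is k'.+1 then nxt (k', P k') else (a, b).
have half x k : x / 2 ^+ k / 2 = x / 2 ^+ k.+1 :> R.
  by rewrite exprSr invfM mulrA.
have stepP k := nxtP (k, P k).
have mono1 j k : (P j).1 <= (P (j + k)%N).1 /\
    (P (j + k)%N).1 + l / 2 ^+ (j + k) <= (P j).1 + l / 2 ^+ j.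
  elim: k => [|k [ih1 ih2]]; first by rewrite addn0 !lexx.
  have [s1 s2 _ _ _] := stepP (j + k)%N.
  rewrite addnS; split; first exact: le_trans ih1 s1.
  by rewrite (le_trans _ ih2)// -half.
have mono2 j k : (P j).2 <= (P (j + k)%N).2 /\
    (P (j + k)%N).2 + m / 2 ^+ (j + k) <= (P j).2 + m / 2 ^+ j.
  elim: k => [|k [ih1 ih2]]; first by rewrite addn0 !lexx.
  have [_ _ s1 s2 _] := stepP (j + k)%N.
  rewrite addnS; split; first exact: le_trans ih1 s1.
  by rewrite (le_trans _ ih2)// -half.
have growth k : normc (rect a l b m) <=
    4 ^+ k * normc (rect (P k).1 (l / 2 ^+ k) (P k).2 (m / 2 ^+ k)).
  elim: k => [|k ih]; first by rewrite expr0 mul1r !divr1.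
  have [_ _ _ _] := stepP k; rewrite /= (half l) (half m) => s.
  apply: (le_trans ih); rewrite (exprSr 4 k) -(mulrA (4 ^+ k)).
  by apply: ler_wpM2l s; rewrite exprn_ge0.
(* Nested intervals: the supremum of the left endpoints lies in all of them. *)
have nest (Q : nat -> R) (w : R) : (forall k, 0 <= w / 2 ^+ k) ->
    (forall j k, Q j <= Q (j + k)%N /\ Q (j + k)%N + w / 2 ^+ (j + k) <= Q j + w / 2 ^+ j) ->
    exists x, forall k, Q k <= x <= Q k + w / 2 ^+ k.
  move=> w0 mQ; pose S := range Q.
  have ubS k : ubound S (Q k + w / 2 ^+ k).
    move=> _ [j _ <-]; have [jk|kj] := leqP j k.
      have [q1 _] := mQ j (k - j)%N; move: q1; rewrite subnKC// => q1.
      by rewrite (le_trans q1)// lerDl.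
    have [_ q2] := mQ k (j - k)%N; move: q2; rewrite subnKC ?(ltnW kj)// => q2.
    by rewrite (le_trans _ q2)// lerDl.
  have hsS : has_sup S by split; [exists (Q 0%N), 0%N|exists (Q 0%N + w / 2 ^+ 0)].
  exists (sup S) => k; apply/andP; split.
    by apply: sup_upper_bound => //; exists k.
  by apply: sup_le_ub => //; case: hsS.
have [x0 hx0] := nest (fun k => (P k).1) l hl mono1.
have [y0 hy0] := nest (fun k => (P k).2) m hm mono2.
have [L dL] := hh (x0 +i* y0).
have key e : 0 < e -> normc (rect a l b m) <= 2 * e * (l + m) ^+ 2.
  move=> e0; have [d d0 hd] := dL e e0.
  have [k hk] : exists k, (l + m) / 2 ^+ k < d.
    have cv : (fun k => (l + m) * (2^-1) ^+ k) @ \oo --> (0 : R).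
      rewrite -[0](mulr0 (l + m)); apply: cvgMr; apply: cvg_expr.
      by rewrite ger0_norm ?invr_ge0// invf_lt1// ltr1n.
    have /cvgrPdist_lt/(_ d d0)[N _ hN] := cv; exists N.
    have := hN N (leqnn N); rewrite sub0r normrN; apply: le_lt_trans.
    by rewrite exprVn ler_norm.
  set w := 2 ^+ k in hk *; have w0 : 0 < w by rewrite exprn_gt0.
  apply: (le_trans (growth k)).
  have := @rect_bound (P k).1 (l / w) (P k).2 (m / w) (x0 +i* y0) L e ((l + m) / w)
    (hl k) (hm k).
  have dist x y : (P k).1 <= x <= (P k).1 + l / w -> (P k).2 <= y <= (P k).2 + m / w ->
      normc ((x +i* y) - (x0 +i* y0)) <= (l + m) / w.
    move=> /andP[x1 x2] /andP[y1 y2]; have /andP[u1 u2] := hx0 k.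
    have /andP[v1 v2] := hy0 k.
    rewrite (le_trans (normc_le _))//= mulrDl lerD// ler_norml; lra.
  set Rk := rect _ _ _ _ => bd.
  have {}bd : normc Rk <= 2 * (e * ((l + m) / w)) * (l / w + m / w).
    apply: bd => x y hx hy; have dxy := dist _ _ hx hy.
    have := hd ((x +i* y) - (x0 +i* y0)) (le_lt_trans dxy hk).
    rewrite [(x0 +i* y0) + _]addrC subrK => h1; rewrite (le_trans h1)//.
    by rewrite ler_wpM2l// ltW.
  (* The factor [4 ^+ k] from [k] subdivisions is offset by the perimeter and the diameter bound,
     each of which carries a factor [w^-1]. *)
  have w4 : 4 ^+ k = w ^+ 2 by rewrite /w exprAC expr2 -natrM.
  rewrite w4 (le_trans (ler_wpM2l (sqr_ge0 w) bd))// le_eqVlt; apply/orP; left.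
  by apply/eqP; field; rewrite gt_eqF.
apply: eq0_normc; apply/eqP; rewrite eq_le normc_ge0 andbT; apply/ler_addgt0Pl => e e0.
rewrite addr0; pose K := 2 * ((l + m) ^+ 2 + 1).
have K0 : 0 < K by rewrite mulr_gt0// ltr_wpDl// sqr_ge0.
have := key (e / K) (divr_gt0 e0 K0) => /le_trans; apply.
rewrite mulrAC mulrA ler_pdivrMr// mulrC ler_wpM2l ?(ltW e0)//.
by rewrite /K ler_wpM2l// lerDl.
Qed.

End goursat_rectangle.

Lemma expRN_lt (R : realType) (d : R) : 0 < d ->
  exists2 A, 0 <= A & expR (- A) < d.
Proof.
move=> d0; exists (`|ln (d / 2)|); first exact: normr_ge0.
rewrite (@le_lt_trans _ _ (d / 2))//; last by rewrite ltr_pdivrMr// ltr_pMr// ltr1n.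
rewrite -[leRHS]lnK ?posrE ?divr_gt0// ler_expR.
by rewrite lerNl -normrN ler_norm.
Qed.

Section circle.
Variable R : realType.
Local Notation C := R[i].
Variables (F : C -> C) (T : R).
Hypotheses (T0 : 0 < T) (cosT : cos T = 1) (sinT : sin T = 0).
Hypotheses (mF : measurable_fun setT F) (hF : cholo F).

(* Goursat's theorem for [F \o cexp] on the rectangle ]-A, 0] x ]0, T]: the
   horizontal sides cancel by periodicity, and cexp maps the left vertical side
   to a circle of radius e^-A. *)
Lemma circle_mean :
  itg (fun t => F (cexp (0 +i* t))) 0 T = F 0 * T%:C.
Proof.
pose h z := F (cexp z).
have mh : measurable_fun setT h.
  by apply: (measurableT_comp mF); apply: (@cmeas_exp _ _ _ id).
have hh : cholo h by apply: cholo_comp => //; exact: cholo_cexp.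
have pi2 : 0 <= T by exact: ltW.
have bl x : locbdd (fun y => h (x +i* y)).
  split; first by apply: (measurableT_comp mh); apply/cmeasurableP; split=> //=;
    exact: measurable_cst.
  exact: (goursat_bddV mh hh x).2.
apply: subr0_eq; apply: eq0_normc; apply/eqP.
rewrite eq_le normc_ge0 andbT; apply/ler_addgt0Pl => e e0; rewrite addr0.
have [l dl] := hF 0.
have [d d0 hd] := cderiv_cont dl (divr_gt0 e0 T0).
(* Puts the small circle inside the disc where [F] differs from [F 0] by at most [e / T]. *)
have [A A0 Ad] := expRN_lt d0.
have := goursat mh hh (- A) 0 A0 pi2.
rewrite /rect addNr add0r.
have -> : (fun x => h (x +i* T)) = (fun x => h (x +i* 0)).
  by apply/funext => x; rewrite /h /cexp /= cosT sinT cos0 sin0.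
rewrite subrr add0r => /eqP; rewrite mulf_eq0 => /orP[/eqP /(congr1 (@normc R))|].
  by rewrite normc_i normc0 => /eqP; rewrite oner_eq0.
rewrite subr_eq0 => /eqP; rewrite -/(h _) => E.
have -> : itg (fun t => F (cexp (0 +i* t))) 0 T - F 0 * T%:C =
    itg (fun t => h (- A +i* t) - F 0) 0 T.
  rewrite itgB; [|exact: bl|exact: locbdd_cst].
  by rewrite -E (itg_cst _ pi2) (subr0 T).
rewrite (_ : e = (T - 0) * (e / T)); last first.
  by rewrite (subr0 T) (mulrC T) divfK ?gt_eqF.
apply: normc_itg_le; first exact: pi2.
  by apply: locbddD; [exact: bl|apply: locbddN; exact: locbdd_cst].
move=> t _; rewrite /h -[cexp _]add0r; apply: hd.
by rewrite normc_cexp; exact: Ad.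
Qed.

End circle.

Lemma cmeas_normcE d (T : measurableType d) (R : realType) (F : T -> R[i]) :
  measurable_fun setT F -> measurable_fun setT (fun x => (normc (F x))%:E).
Proof. by move=> mF; apply/measurable_EFinP; exact: cmeas_normc. Qed.

(** * The reproducing property *)

Section mean_value.
Variables (R : realType) (n : nat).
Local Notation C := R[i].
Local Notation Cn := 'rV[C]_n.
Local Notation leb := (@lebesgue_measure R).

(** Holomorphy on each complex line separately is all that the later arguments ask for, and it
    reduces everything to one-variable calculus. *)
Definition line_holo (h : Cn -> C) := forall p q, cholo (fun l : C => h (p + l *: q)).

(** Volume and [rho] are invariant under multiplication by a unit complex number, so the integral
    equals its average over rotations. Exchanging the integrals leaves the circular means of [h] on
    the complex lines through 0, all equal to [h 0]. *)
Lemma mean_value (h : Cn -> C) (rho : Cn -> R) :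
  measurable_fun setT h -> (forall z, cholo (fun l : C => h (l *: z))) ->
  measurable_fun setT rho ->
  (forall c z, normc c = 1 -> rho (c *: z) = rho z) ->
  cintegrable (@dV R n) (fun z => h z * (rho z)%:C) ->
  (@dV R n).-integrable setT (fun z => (rho z)%:E) ->
  cintegral (@dV R n) (fun z => h z * (rho z)%:C) =
  h 0 * (\int[@dV R n]_z rho z)%:C.
Proof.
move=> mh hh mrho rrho ih irho.
have [T [T0 [cosT sinT]]] : exists T : R, 0 < T /\ cos T = 1 /\ sin T = 0.
  exists (pi *+ 2); split; first by rewrite mulrn_wgt0// pi_gt0.
  by split; [exact: cos2pi|exact: sin2pi].
pose e (t : R) : C := cexp (0 +i* t).
have e1 t : normc (e t) = 1 by rewrite normc_cexp expR0.
have me : measurable_fun setT (e : measurableTypeR R -> C).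
  by apply: cmeas_exp; apply/cmeasurableP; split=> //=; exact: measurable_cst.
pose ind (t : R) : R := \1_(`]0, T]%classic) t.
have mind : measurable_fun setT (fun t : measurableTypeR R => (ind t)%:C).
  by apply: cmeas_real; exact: measurable_indic.
have ind0 t : 0 <= ind t by rewrite /ind indicE ler0n.
have ind0E t : (0 <= (ind t)%:E)%E by rewrite lee_fin.
pose F (x : measurableTypeR R * Cn) : C := (ind x.1)%:C * (h (e x.1 *: x.2) * (rho x.2)%:C).
have mF : measurable_fun setT F.
  apply: cmeasM; first exact: (measurableT_comp mind measurable_fst).
  apply: cmeasM.
    apply: (measurableT_comp mh); apply: cmeas_rowZ.
      exact: (measurableT_comp me measurable_fst).
    exact: measurable_snd.
  by apply: cmeas_real; exact: (measurableT_comp mrho measurable_snd).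
pose hr z := h z * (rho z)%:C.
have Fhr t z : F (t, z) = (ind t)%:C * hr (e t *: z).
  by rewrite /F /hr/= rrho.
have irot t : cintegrable (@dV R n) (fun z => hr (e t *: z)).
  exact: (preserving_cintegrable (preserving_rotate n (e1 t)) ih).
have Irot t : cintegral (@dV R n) (fun z => hr (e t *: z)) = cintegral (@dV R n) hr.
  by apply: (preserving_cintegral (preserving_rotate n (e1 t))); case: ih.
have iind : leb.-integrable setT (fun t => (ind t)%:E).
  exact: (integrable_indic_itv 0 T false false).
have iF : cintegrable (leb \x @dV R n)%E F.
  apply: cintegrable_prod => //.
  have -> : (fun t => \int[@dV R n]_y (normc (F (t, y)))%:E)%E =
      (fun t => (ind t)%:E * \int[@dV R n]_y (normc (hr y))%:E)%E.
    apply/funext => t.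
    have mN : measurable_fun setT (fun y => (normc (hr y))%:E).
      by apply/measurable_EFinP; apply: cmeas_normc; case: ih.
    rewrite -(preserving_ge0_integral (preserving_rotate n (e1 t)) mN); last first.
      by move=> z; rewrite lee_fin normc_ge0.
    rewrite -ge0_integralZl//.
    - by apply: eq_integral => z _; rewrite Fhr normcM normcRe EFinM ger0_norm ?ind0.
    - by apply: cmeas_normcE; case: (irot t).
    - by move=> z _; rewrite lee_fin normc_ge0.
  have ioo : (\int[@dV R n]_y (normc (hr y))%:E < +oo)%E by case: ih.
  have i0 : (0 <= \int[@dV R n]_y (normc (hr y))%:E)%E.
    by apply: integral_ge0 => z _; rewrite lee_fin normc_ge0.
  rewrite ge0_integralZr//; last by apply/measurable_EFinP; exact: measurable_indic.
  rewrite lte_mul_pinfty//.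
    by apply: integral_ge0 => t _; exact: ind0E.
  rewrite ge0_fin_numE; last by apply: integral_ge0 => t _; exact: ind0E.
  have /integrableP[_] := iind.
  suff -> : (\int[leb]_t (ind t)%:E = \int[leb]_t `|(ind t)%:E|)%E by [].
  by apply: eq_integral => t _; rewrite gee0_abs ?ind0E.
have indT : cintegral leb (fun t => (ind t)%:C) = T%:C.
  have := @itg_cst R 1 0 T (ltW T0); rewrite mul1r subr0 => <-.
  by apply: eq_cintegral => t; rewrite mulr1.
(* [E1] and [E2] evaluate one double integral in the two orders; the factor [T] is cancelled at the
   end. *)
have E1 : cintegral leb (fun t => cintegral (@dV R n) (fun z => F (t, z))) =
    T%:C * cintegral (@dV R n) hr.
  under eq_cintegral => t do (under eq_cintegral do rewrite Fhr; rewrite cintegralZ// Irot).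
  by rewrite cintegralZr ?indT//; exact: cintegrable_real.
have E2 : cintegral leb (fun t => cintegral (@dV R n) (fun z => F (t, z))) =
    T%:C * (h 0 * (\int[@dV R n]_z rho z)%:C).
  rewrite (cfubini iF).
  have -> : (fun z => cintegral leb (fun t => F (t, z))) =
      (fun z => (T%:C * h 0) * (rho z)%:C).
    apply/funext => z.
    have mz : measurable_fun setT (fun l : C => h (l *: z)).
      by apply: (measurableT_comp mh); apply: cmeas_rowZ => //; exact: measurable_cst.
    have := circle_mean T0 cosT sinT mz (hh z); rewrite scale0r => E.
    transitivity (cintegral leb (fun t => (rho z)%:C * ((ind t)%:C * h (e t *: z)))).
      by apply: eq_cintegral => t; rewrite /F /=; ring.
    rewrite cintegralZ; last first.
      apply: (@itg_integrable R (fun t => h (e t *: z))).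
      split; first by apply: (measurableT_comp mz me).
      have := (@goursat_bddV R (fun x => h (cexp x *: z)) _ _ 0).2; apply.
        apply: (measurableT_comp mz); exact: (@cmeas_exp _ _ _ id).
      by apply: (cholo_comp (@cholo_cexp R) (hh z)).
    by rewrite -/(itg (fun t => h (e t *: z)) 0 T) E; ring.
  rewrite cintegralZ; last exact: cintegrable_real.
  by rewrite cintegral_real mulrA.
have TC : T%:C != 0 by apply/eqP => /complexI /eqP; rewrite gt_eqF.
by apply: (mulfI TC); rewrite -E1 E2.
Qed.

End mean_value.

(** * Hermitian products, the reproducing formula and growth bounds *)

Section growth.
Variables (R : realType) (n : nat).
Local Notation C := R[i].
Local Notation Cn := 'rV[C]_n.
Implicit Types (h k : Cn -> C) (z w p q : Cn).

Definition hdot z w : C := dot z (conjv w).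

Lemma hdotDl z p w : hdot (z + p) w = hdot z w + hdot p w.
Proof. by rewrite /hdot /dot -big_split; apply: eq_bigr => k _; rewrite !mxE mulrDl. Qed.

Lemma hdotDr w z p : hdot w (z + p) = hdot w z + hdot w p.
Proof.
rewrite /hdot /dot -big_split; apply: eq_bigr => k _.
by rewrite !mxE !NumconjE conjcD mulrDr.
Qed.

Lemma hdotZl c z w : hdot (c *: z) w = c * hdot z w.
Proof. by rewrite /hdot /dot mulr_sumr; apply: eq_bigr => k _; rewrite !mxE mulrA. Qed.

Lemma hdot0l w : hdot 0 w = 0.
Proof. by rewrite -(scale0r (0 : Cn)) hdotZl mul0r. Qed.

Lemma hdot_cj z w : cj (hdot z w) = hdot w z.
Proof.
rewrite /hdot /dot conjc_sum; apply: eq_bigr => k _.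
by rewrite !mxE !NumconjE conjcM cjK mulrC.
Qed.

Lemma hdot_sq z : hdot z z = (sq z)%:C.
Proof. exact: sqnormE. Qed.

Lemma sq0 : sq (0 : Cn) = 0.
Proof. by rewrite /sq big1// => k _; rewrite mxE normc0 expr0n. Qed.

Lemma sqN z : sq (- z) = sq z.
Proof. by rewrite /sq; apply: eq_bigr => k _; rewrite mxE normcN. Qed.

Lemma sqD_le z w : sq (z + w) <= 2 * sq z + 2 * sq w.
Proof.
rewrite /sq !mulr_sumr -big_split; apply: ler_sum => k _ /=; rewrite mxE.
have h := normcD (z ord0 k) (w ord0 k).
have := normc_ge0 (z ord0 k + w ord0 k); have := normc_ge0 (z ord0 k).
have := normc_ge0 (w ord0 k).
move: (normc (z ord0 k)) (normc (w ord0 k)) (normc (_ + _)) h => a b c h b0 a0 c0.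
have : c ^+ 2 <= (a + b) ^+ 2 by rewrite ler_pXn2r ?nnegrE ?addr_ge0.
have := sqr_ge0 (a - b); rewrite !expr2; lra.
Qed.

Definition absdot z w : R := \sum_k normc (z ord0 k) * normc (w ord0 k).

Lemma absdot_ge0 z w : 0 <= absdot z w.
Proof. by apply: sumr_ge0 => k _; rewrite mulr_ge0 ?normc_ge0. Qed.

Lemma normc_hdot_le z w : normc (hdot z w) <= absdot z w.
Proof.
rewrite (le_trans (normc_sum _ _ _))//; apply: ler_sum => k _.
by rewrite normcM mxE NumconjE normc_conj.
Qed.

(* AM-GM in each coordinate: [a b <= s a^2 + b^2 / (4 s)]. *)
Lemma absdot_young (s : R) z w : 0 < s -> absdot z w <= s * sq z + (4 * s)^-1 * sq w.
Proof.
move=> s0; rewrite /absdot /sq !mulr_sumr -big_split; apply: ler_sum => k _ /=.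
set a := normc _; set b := normc (w ord0 k).
rewrite -subr_ge0 (_ : _ - _ = s * (a - (2 * s)^-1 * b) ^+ 2); last first.
  by field; rewrite gt_eqF.
by rewrite mulr_ge0 ?sqr_ge0 ?ltW.
Qed.

Lemma measurable_hdotl w : measurable_fun setT (fun z => hdot z w).
Proof. by apply: cmeas_dot => //; exact: measurable_cst. Qed.

Lemma measurable_hdotr w : measurable_fun setT (fun z => hdot w z).
Proof. by apply: cmeas_dot; [exact: measurable_cst|exact: cmeas_conjv]. Qed.

Lemma cmeas_hdot d (T : measurableType d) (f g : T -> Cn) :
  measurable_fun setT f -> measurable_fun setT g ->
  measurable_fun setT (fun x => hdot (f x) (g x)).
Proof. by move=> mf mg; apply: cmeas_dot => //; exact: cmeas_conjv. Qed.

Lemma line_holoM h k : line_holo h -> line_holo k -> line_holo (fun z => h z * k z).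
Proof. by move=> hh hk p q; exact: choloM. Qed.

Lemma line_holo_cst c : line_holo (fun _ : Cn => c).
Proof. by move=> p q; exact: cholo_cst. Qed.

Lemma line_holo_affine h (c : C) w : line_holo h -> line_holo (fun z => h (w + c *: z)).
Proof.
move=> hh p q; have := hh (w + c *: p) (c *: q).
have E (l : C) : w + c *: p + l *: (c *: q) = w + c *: (p + l *: q).
  by rewrite scalerDr !scalerA (mulrC c) addrA.
by under eq_fun do rewrite E.
Qed.

Lemma line_holo_hdot w : line_holo (fun z => hdot z w).
Proof.
move=> p q; under eq_fun do rewrite hdotDl hdotZl.
apply: choloD; first exact: cholo_cst.
by apply: choloM; [exact: cholo_id|exact: cholo_cst].
Qed.

Lemma line_holo_cexp h : line_holo h -> line_holo (fun z => cexp (h z)).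
Proof. by move=> hh p q; apply: (cholo_comp (hh p q)); exact: cholo_cexp. Qed.

Lemma gauss_rotate t c z : normc c = 1 -> gauss t (c *: z) = gauss t z.
Proof. by move=> c1; rewrite /gauss sqZ c1 expr1n mul1r. Qed.

Lemma gaussC t z : (gauss t z)%:C = cexp (- (t%:C * hdot z z)).
Proof. by rewrite hdot_sq -realcM -realcN cexp_real. Qed.

Lemma normc_gauss t z : normc (gauss t z)%:C = gauss t z.
Proof. by rewrite normcRe ger0_norm// gauss_ge0. Qed.

Lemma normc_cexp_hdot (t s : R) w z : 0 <= t -> 0 < s ->
  normc (cexp (t%:C * hdot w z)) <= expR (t * (s * sq w + (4 * s)^-1 * sq z)).
Proof.
move=> t0 s0; rewrite normc_cexp ler_expR (le_trans (ler_norm _))//.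
rewrite (le_trans (normc_Re _))// normcM normcRe ger0_norm//.
apply: ler_wpM2l => //.
by rewrite (le_trans (normc_hdot_le _ _))// absdot_young.
Qed.

(* After translation by w the integrand becomes a holomorphic function times a
   rotation invariant weight. *)
Lemma reproducing t h w : 0 < t -> measurable_fun setT h -> line_holo h ->
  cintegrable (@dV R n) (fun z => h z * cexp (t%:C * hdot w z) * (gauss t z)%:C) ->
  cintegral (@dV R n) (fun z => h z * cexp (t%:C * hdot w z) * (gauss t z)%:C) =
  h w * ((pi / t) ^+ n)%:C.
Proof.
move=> t0 mh hh; set G := fun z => _ => iG.
have pw := preserving_translate w.
rewrite -(preserving_cintegral pw); last by case: iG.
have iG' := preserving_cintegrable pw iG.
pose k z := h (w + 1 *: z) * cexp (- t%:C * hdot z w).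
have GE z : G (z + w) = k z * (gauss t z)%:C.
  (* The antiholomorphic cross term [hdot w z] cancels, which leaves a holomorphic exponent plus
     that of the centred Gaussian. *)
  have arg : t%:C * hdot w (w + z) + - (t%:C * hdot (w + z) (w + z)) =
      - t%:C * hdot z w + - (t%:C * hdot z z).
    rewrite hdotDl !hdotDr.
    by move: (hdot w w) (hdot w z) (hdot z w) (hdot z z) => a b c d; ring.
  rewrite /G.
  rewrite /k.
  rewrite scale1r.
  rewrite (addrC z).
  rewrite (gaussC t z).
  rewrite (gaussC t (w + z)).
  rewrite -(mulrA (h _)).
  rewrite -cexpD.
  rewrite arg.
  rewrite cexpD.
  by rewrite mulrA.
have E : (fun z => G (z + w)) = (fun z => k z * (gauss t z)%:C) by apply/funext.
rewrite E in iG' *.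
have k0 : k 0 = h w.
  by rewrite /k scaler0 addr0 hdot0l mulr0 cexp0 mulr1.
have lk : line_holo k.
  apply: line_holoM; first exact: line_holo_affine.
  apply: line_holo_cexp; apply: line_holoM; first exact: line_holo_cst.
  exact: line_holo_hdot.
rewrite mean_value//; last 5 first.
- apply: cmeasM.
    apply: (measurableT_comp mh); apply: cmeas_rowD; first exact: measurable_cst.
    by apply: cmeas_rowZ => //; exact: measurable_cst.
  apply: cmeas_exp; apply: cmeasM; first exact: measurable_cst.
  exact: measurable_hdotl.
- by move=> z; have := lk 0 z; under eq_fun do rewrite add0r.
- exact: measurable_gauss.
- by move=> c z; exact: gauss_rotate.
- exact: gauss_integrable.
by rewrite Rintegral_gauss// k0.
Qed.

(** Pointwise counterpart of [in_Sym]. Since [c] is at choice, such bounds survive products, shifts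
    and multiplication by kernels. *)
Definition tame h := [/\ measurable_fun setT h, line_holo h &
  forall c : R, 0 < c -> exists M : R, forall z, normc (h z) <= M * expR (c * sq z)].

Lemma gauss_integrableM (M t : R) : 0 < t ->
  (@dV R n).-integrable setT (fun z => (M * gauss t z)%:E).
Proof.
move=> t0; have := integrableZl measurableT M (gauss_integrable n t0).
exact: eq_integrable.
Qed.

(** An essential bound says nothing at a given point, but [reproducing] writes each value of [h] as
    an integral, on which the essential bound does act. *)
Lemma in_Sym_tame h : in_Sym h -> line_holo h -> tame h.
Proof.
move=> [mh hs] hh; split=> // t t0.
(* In the exponent of [sq z] the growth of [h] takes [t / 4] and the kernel, split by AM-GM with
   [s = 1], another [t / 4]. The Gaussian of rate [t] keeps rate [t / 2], and [t * sq w] is what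
   remains outside the integral. *)
have t4 : 0 < t / 4 by rewrite divr_gt0.
have [M0 aeM] := hs (t / 4) t4.
pose G w z := h z * cexp (t%:C * hdot w z) * (gauss t z)%:C.
have mG w : measurable_fun setT (G w).
  apply: cmeasM; last by apply: cmeas_real; exact: measurable_gauss.
  apply: cmeasM => //; apply: cmeas_exp; apply: cmeasM; first exact: measurable_cst.
  exact: measurable_hdotr.
pose M := `|M0|.
have aeG w : {ae @dV R n, forall z, [set: Cn] z ->
    ((normc (G w z))%:E <= (M * expR (t * sq w) * gauss (t / 2) z)%:E)%E}.
  apply: filterS aeM => z + _.
  rewrite cexp_sqnorm normcC normcM normcRe lecR ger0_norm ?gauss_ge0// => hz.
  have {hz} : normc (h z) <= M * expR (t / 4 * sq z).
    have -> : normc (h z) = normc (h z) * gauss (t / 4) z * expR (t / 4 * sq z).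
      by rewrite /gauss -mulrA -expRD addNr expR0 mulr1.
    by apply: ler_wpM2r; [exact: expR_ge0|rewrite (le_trans hz)// ler_norm].
  move=> hz; rewrite lee_fin /G normcM normc_gauss normcM.
  have -> : M * expR (t * sq w) * gauss (t / 2) z =
      M * expR (t / 4 * sq z) * expR (t * (1 * sq w + (4 * 1)^-1 * sq z)) * gauss t z.
    rewrite /gauss -!mulrA -!expRD; congr (_ * expR _).
    by move: (sq z) (sq w) => a b; field.
  apply: ler_wpM2r; first exact: gauss_ge0.
  apply: ler_pM; [exact: normc_ge0|exact: normc_ge0|exact: hz|].
  by apply: normc_cexp_hdot => //; exact: ltW.
have t2 : 0 < t / 2 by rewrite divr_gt0.
have Gle w : (\int[@dV R n]_z (normc (G w z))%:E <=
    (M * expR (t * sq w) * (pi / (t / 2)) ^+ n)%:E)%E.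
  rewrite (le_trans (ae_ge0_le_integral _ _ _ _ _ (aeG w)))//.
  - by move=> z _; rewrite lee_fin normc_ge0.
  - exact: cmeas_normcE.
  - by move=> z _; rewrite lee_fin; do 2 (apply: mulr_ge0; last exact: expR_ge0);
      exact: normr_ge0.
  - by have /integrableP[] := gauss_integrableM (M * expR (t * sq w)) t2.
  under eq_integral do rewrite EFinM.
  rewrite ge0_integralZl//.
  - by rewrite integral_gauss.
  - by apply/measurable_EFinP; exact: measurable_gauss.
  - by move=> z _; rewrite lee_fin gauss_ge0.
  - by rewrite lee_fin; apply: mulr_ge0; [exact: normr_ge0|exact: expR_ge0].
have iG w : cintegrable (@dV R n) (G w).
  by split=> //; rewrite (le_lt_trans (Gle w))// ltry.
exists (M * (pi / (t / 2)) ^+ n / (pi / t) ^+ n) => w.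
have P0 : 0 < (pi / t) ^+ n :> R by rewrite exprn_gt0// divr_gt0// pi_gt0.
rewrite mulrAC ler_pdivlMr//.
have -> : normc (h w) * (pi / t) ^+ n = normc (h w * ((pi / t) ^+ n)%:C).
  by rewrite normcM normcRe gtr0_norm.
rewrite -(reproducing t0 mh hh (iG w)) -/(G w).
rewrite (le_trans (normc_cintegral (iG w)))// -lee_fin.
rewrite /Rintegral fineK; last by apply: integrable_fin_num => //; exact: cintegrable_norm.
by rewrite (le_trans (Gle w))// lee_fin mulrAC.
Qed.

End growth.

(** * Integration against the Gaussian measure *)

Section expectation.
Variables (R : realType) (n : nat).
Local Notation C := R[i].
Local Notation Cn := 'rV[C]_n.
Implicit Types (h k : Cn -> C) (z w : Cn).

Definition gw z : R := (pi ^+ n)^-1 * gauss 1 z.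

Definition EV h : C := cintegral (@dV R n) (fun z => h z * (gw z)%:C).

Definition EVI h := cintegrable (@dV R n) (fun z => h z * (gw z)%:C).

Lemma gw_gt0 z : 0 < gw z.
Proof. by rewrite mulr_gt0 ?gauss_gt0// invr_gt0 exprn_gt0// pi_gt0. Qed.

Lemma measurable_gw : measurable_fun setT gw.
Proof. by apply: measurable_funM; [exact: measurable_cst|exact: measurable_gauss]. Qed.

Lemma mu_integralE h : mu_integral h = EV h.
Proof.
rewrite /mu_integral /EV; apply: eq_cintegral => z.
rewrite /gw realcM realcV realcX; congr (_ * (_ * _)).
by have := cexp_sqnorm 1 z; rewrite mul1r.
Qed.

Lemma gw_growth_integrable M c : c < 1 ->
  (@dV R n).-integrable setT (fun z => (M * expR (c * sq z) * gw z)%:E).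
Proof.
move=> c1; have c0 : 0 < 1 - c by rewrite subr_gt0.
have := gauss_integrableM n (M * (pi ^+ n)^-1) c0; apply: eq_integrable => // z _.
congr EFin; rewrite /gw /gauss -!mulrA; congr (_ * _).
by rewrite [RHS]mulrCA -expRD; congr (_ * expR _); ring.
Qed.

Lemma EVI_growth h M c : measurable_fun setT h -> c < 1 ->
  (forall z, normc (h z) <= M * expR (c * sq z)) -> EVI h.
Proof.
move=> mh c1 hM; apply: cintegrable_ler (gw_growth_integrable M c1) _.
  by apply: cmeasM => //; apply: cmeas_real; exact: measurable_gw.
move=> z; rewrite normcM normcRe gtr0_norm ?gw_gt0//.
by apply: ler_wpM2r; [exact/ltW/gw_gt0|exact: hM].
Qed.

Lemma eq_EV h k : h =1 k -> EV h = EV k.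
Proof. by move=> /funext ->. Qed.

Lemma EVZ c h : EVI h -> EV (fun z => c * h z) = c * EV h.
Proof.
by move=> ih; rewrite /EV -cintegralZ//; apply: eq_cintegral => z; rewrite mulrA.
Qed.

Lemma EVZr c h : EVI h -> EV (fun z => h z * c) = EV h * c.
Proof. by move=> ih; under eq_EV do rewrite mulrC; rewrite EVZ// mulrC. Qed.

Lemma EVIZ c h : EVI h -> EVI (fun z => c * h z).
Proof.
move=> ih; rewrite /EVI; under eq_fun do rewrite -mulrA.
exact: cintegrableZ.
Qed.

Lemma EVID h k : EVI h -> EVI k -> EVI (fun z => h z + k z).
Proof.
by move=> ih ik; rewrite /EVI; under eq_fun do rewrite mulrDl; exact: cintegrableD.
Qed.

Lemma EVIB h k : EVI h -> EVI k -> EVI (fun z => h z - k z).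
Proof.
by move=> ih ik; rewrite /EVI; under eq_fun do rewrite mulrBl; exact: cintegrableB.
Qed.

Lemma EVD h k : EVI h -> EVI k -> EV (fun z => h z + k z) = EV h + EV k.
Proof.
by move=> ih ik; rewrite /EV -cintegralD//; apply: eq_cintegral => z; rewrite mulrDl.
Qed.

Lemma EVB h k : EVI h -> EVI k -> EV (fun z => h z - k z) = EV h - EV k.
Proof.
by move=> ih ik; rewrite /EV -cintegralB//; apply: eq_cintegral => z; rewrite mulrBl.
Qed.

Lemma EVI_sum (I : Type) (s : seq I) (P : pred I) (F : I -> Cn -> C) :
  (forall i, P i -> EVI (F i)) -> EVI (fun z => \sum_(i <- s | P i) F i z).
Proof.
move=> iF; rewrite /EVI; under eq_fun do rewrite mulr_suml.
exact: cintegrable_sum.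
Qed.

Lemma EV_sum (I : Type) (s : seq I) (P : pred I) (F : I -> Cn -> C) :
  (forall i, P i -> EVI (F i)) ->
  EV (fun z => \sum_(i <- s | P i) F i z) = \sum_(i <- s | P i) EV (F i).
Proof.
move=> iF; rewrite /EV -cintegral_sum//.
by apply: eq_cintegral => z; rewrite mulr_suml.
Qed.

Lemma EVI_cj h : EVI h -> EVI (fun z => cj (h z)).
Proof.
move=> /cintegrable_conj; rewrite /EVI; congr cintegrable; apply/funext => z.
by rewrite conjcM cj_real.
Qed.

Lemma EV_cj h : EVI h -> EV (fun z => cj (h z)) = cj (EV h).
Proof.
move=> ih; rewrite /EV -cintegral_conj//; apply: eq_cintegral => z.
by rewrite conjcM cj_real.
Qed.

Lemma normc_EV_le h M c : EVI h -> c < 1 ->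
  (forall z, normc (h z) <= M * expR (c * sq z)) ->
  normc (EV h) <= M * (1 - c)^-1 ^+ n.
Proof.
move=> ih c1 hM; have c0 : 0 < 1 - c by rewrite subr_gt0.
have P0 : 0 < pi ^+ n :> R by rewrite exprn_gt0// pi_gt0.
apply: le_trans (normc_cintegral_le ih (gw_growth_integrable M c1) _) _.
  move=> z; rewrite normcM normcRe gtr0_norm ?gw_gt0//.
  by apply: ler_wpM2r; [exact/ltW/gw_gt0|exact: hM].
have -> : \int[@dV R n]_z (M * expR (c * sq z) * gw z) =
    \int[@dV R n]_z (M * (pi ^+ n)^-1 * gauss (1 - c) z).
  apply: eq_Rintegral => z _; rewrite /gw /gauss -!mulrA; congr (_ * _).
  by rewrite mulrCA -expRD; congr (_ * expR _); ring.
rewrite RintegralZl//; last exact: gauss_integrable.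
by rewrite Rintegral_gauss// expr_div_n exprVn -mulrA mulKf// gt_eqF.
Qed.

(** Growth without holomorphy, hence closed under conjugation; the sign condition on [M] allows
    bounds to be multiplied. *)
Definition subgauss (V : Cn -> C) := measurable_fun setT V /\
  forall c : R, 0 < c -> exists2 M : R, 0 <= M & forall z, normc (V z) <= M * expR (c * sq z).

Lemma tame_subgauss h : tame h -> subgauss h.
Proof.
move=> [mh _ hg]; split=> // c /hg[M hM]; exists `|M|; first exact: normr_ge0.
move=> z; apply: le_trans (hM z) _.
by apply: ler_wpM2r; [exact: expR_ge0|exact: ler_norm].
Qed.

Lemma subgauss_EVI h : subgauss h -> EVI h.
Proof.
move=> [mh hg]; have c0 : 0 < 2^-1 :> R by rewrite invr_gt0.
have [M _ hM] := hg _ c0; apply: EVI_growth hM => //.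
by rewrite invf_lt1// ltr1n.
Qed.

Lemma subgaussM h k : subgauss h -> subgauss k -> subgauss (fun z => h z * k z).
Proof.
move=> [mh hh] [mk hk]; split; first exact: cmeasM.
move=> c c0; have c2 : 0 < c / 2 by rewrite divr_gt0.
have [M M0 hM] := hh _ c2; have [N N0 hN] := hk _ c2; exists (M * N).
  exact: mulr_ge0.
move=> z; rewrite normcM (splitr c) mulrDl expRD mulrACA.
by apply: ler_pM; rewrite ?normc_ge0.
Qed.

Lemma subgauss_cj h : subgauss h -> subgauss (fun z => cj (h z)).
Proof.
move=> [mh hh]; split; first exact: cmeas_conj.
by move=> c /hh[M M0 hM]; exists M => // z; rewrite normc_conj.
Qed.

Lemma subgauss_cst c : subgauss (fun=> c).
Proof.
split; first exact: measurable_cst.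
move=> e e0; exists (normc c); first exact: normc_ge0.
move=> z; rewrite -[leLHS]mulr1; apply: ler_wpM2l; first exact: normc_ge0.
by rewrite -expR0 ler_expR mulr_ge0 ?sq_ge0// ltW.
Qed.

Lemma subgaussB h k : subgauss h -> subgauss k -> subgauss (fun z => h z - k z).
Proof.
move=> [mh hh] [mk hk]; split; first exact: cmeasB.
move=> c c0; have [M M0 hM] := hh _ c0; have [N N0 hN] := hk _ c0; exists (M + N).
  exact: addr_ge0.
move=> z; apply: le_trans (normcD _ _) _; rewrite normcN mulrDl.
by apply: lerD.
Qed.

Lemma subgauss_absexp (w : Cn) (b : R) : subgauss (fun z => (expR (b * absdot w z))%:C).
Proof.
have mab : measurable_fun setT (fun z => absdot w z).
  apply: measurable_sum => k; apply: measurable_funM; first exact: measurable_cst.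
  by apply: cmeas_normc; exact: measurable_coord.
split.
  apply: cmeas_real; apply: measurableT_comp => //.
  by apply: measurable_funM.
(* Chosen so that AM-GM leaves exactly [c] in front of [sq z]; the added 1 keeps [s] positive when
   [b = 0]. *)
move=> c c0; pose s := (`|b| + 1) / (4 * c).
have b1 : 0 < `|b| + 1 by rewrite ltr_wpDl.
have s0 : 0 < s by rewrite divr_gt0// mulr_gt0.
exists (expR ((`|b| + 1) * (s * sq w))); first exact: expR_ge0.
move=> z; rewrite normcRe gtr0_norm ?expR_gt0// -expRD ler_expR.
have -> : c * sq z = (`|b| + 1) * ((4 * s)^-1 * sq z).
  rewrite /s; move: (`|b| + 1) (sq z) b1 => B Z B0; field.
  by rewrite !gt_eqF.
rewrite -mulrDr; apply: (@le_trans _ _ ((`|b| + 1) * absdot w z)).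
  apply: ler_wpM2r; first exact: absdot_ge0.
  by rewrite (le_trans (ler_norm b))// lerDl.
by apply: ler_wpM2l; [exact: ltW|exact: absdot_young].
Qed.

Lemma subgauss_le h k : measurable_fun setT h -> subgauss k ->
  (forall z, normc (h z) <= normc (k z)) -> subgauss h.
Proof.
move=> mh [mk hk] hle; split=> // c /hk[M M0 hM]; exists M => // z.
exact: le_trans (hle z) (hM z).
Qed.

Lemma subgauss_cexp_hdot (w : Cn) : subgauss (fun z => cexp (hdot w z)).
Proof.
apply: subgauss_le (subgauss_absexp w 1) _.
  by apply: cmeas_exp; exact: measurable_hdotr.
move=> z; rewrite normcRe gtr0_norm ?expR_gt0// mul1r.
by rewrite (le_trans (normc_cexp_le _))// ler_expR normc_hdot_le.
Qed.

Lemma subgauss_cj_coord (k : 'I_n) : subgauss (fun z => cj (z ord0 k)).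
Proof.
have mc : measurable_fun setT (fun z : Cn => cj (z ord0 k)).
  by apply: cmeas_conj; exact: measurable_coord.
apply: subgauss_le mc (subgauss_absexp (delta_mx ord0 k) 1) _ => z.
rewrite normc_conj normcRe gtr0_norm ?expR_gt0// mul1r.
have -> : absdot (delta_mx ord0 k) z = normc (z ord0 k).
  rewrite /absdot (bigD1 k)//= big1 ?addr0.
    by rewrite mxE !eqxx normc1 mul1r.
  by move=> j jk; rewrite mxE (negbTE jk) andbF normc0 mul0r.
by rewrite (le_trans _ (expR_ge1Dx _))// lerDr.
Qed.

Lemma tameM h k : tame h -> tame k -> tame (fun z => h z * k z).
Proof.
move=> sh sk; have [mm gg] := subgaussM (tame_subgauss sh) (tame_subgauss sk).
case: sh sk => _ lh _ [_ lk _]; split=> //; first exact: line_holoM.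
by move=> c /gg[M _ hM]; exists M.
Qed.

Definition joint_subgauss (n' : nat) (F : 'rV[C]_n' -> Cn -> C) := forall e : R, 0 < e ->
  exists2 M : R, 0 <= M & forall x z, normc (F x z) <= M * expR (e * sq x) * expR (e * sq z).

(** By [sqD_le] the square of the argument is at most [4 * sq w] plus [a] times the squares of both
    variables, so growth of exponent [e / a] is enough. *)
Lemma subgauss_joint h (n' : nat) (w : Cn) (A : 'rV[C]_n' -> Cn) (c : C) (K : R) :
  subgauss h -> (forall x, sq (A x) <= K * sq x) ->
  joint_subgauss (fun x z => h (w + A x + c *: z)).
Proof.
move=> [_ gh] hA e e0; pose a := 4 * (`|K| + normc c ^+ 2 + 1).
have a0 : 0 < a by rewrite mulr_gt0// ltr_wpDl// addr_ge0// sqr_ge0.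
have e1 : 0 < e / a by rewrite divr_gt0.
have [M M0 hM] := gh _ e1; exists (M * expR (e / a * (4 * sq w))).
  by apply: mulr_ge0; rewrite ?expR_ge0.
move=> x z; apply: le_trans (hM _) _; rewrite -!(mulrA M) -!expRD.
apply: ler_wpM2l; [exact: M0|rewrite ler_expR].
have h1 := sqD_le (w + A x) (c *: z); have h2 := sqD_le w (A x).
have h3 := hA x; have h4 : sq (c *: z) = normc c ^+ 2 * sq z by rewrite sqZ.
apply: (@le_trans _ _ (e / a * (4 * sq w + (a * sq x + a * sq z)))).
  apply: ler_wpM2l; first exact: ltW.
  have p1 : K * sq x <= `|K| * sq x by apply: ler_wpM2r; [exact: sq_ge0|exact: ler_norm].
  have p2 : 0 <= normc c ^+ 2 * sq x by rewrite mulr_ge0 ?sqr_ge0 ?sq_ge0.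
  have p3 : 0 <= `|K| * sq z by rewrite mulr_ge0 ?sq_ge0.
  have p4 : 0 <= normc c ^+ 2 * sq z by rewrite mulr_ge0 ?sqr_ge0 ?sq_ge0.
  have p5 := sq_ge0 x; have p6 := sq_ge0 z.
  move: h1 h2 h3 h4 p1 p2 p3 p4 p5 p6; rewrite /a => {hM a0 e1 a}.
  move: (sq (w + A x + c *: z)) (sq (w + A x)) (sq w) (sq (A x)) (sq (c *: z)).
  move: (sq x) (sq z) (normc c ^+ 2) (`|K|) => X Z D N s1 s2 s3 s4 s5.
  by rewrite !(mulrDl, mulrDr) => *; lra.
rewrite le_eqVlt; apply/orP; left; apply/eqP; move: (sq w) (sq x) (sq z) => X Y Z.
by field; rewrite gt_eqF.
Qed.

Lemma tame_affine h (c : C) w : tame h -> tame (fun z => h (w + c *: z)).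
Proof.
move=> sh; have [mh lh _] := sh; split.
- apply: (measurableT_comp mh); apply: cmeas_rowD; first exact: measurable_cst.
  by apply: cmeas_rowZ => //; exact: measurable_cst.
- exact: line_holo_affine.
move=> e e0.
(* With no coordinates in the first variable, the joint bound is a bound in [z] alone. *)
have h0 (x : 'rV[C]_0) : sq (0 : Cn) <= 0 * sq x by rewrite sq0 mul0r.
have [M _ hM] := subgauss_joint w c (tame_subgauss sh) h0 e0; exists M => z.
have := hM 0 z; rewrite addr0 => /le_trans; apply.
by rewrite sq0 mulr0 expR0 mulr1.
Qed.

Lemma tame_shift h w : tame h -> tame (fun z => h (z + w)).
Proof.
move=> sh; have := tame_affine 1 w sh; congr tame; apply/funext => z.
by rewrite scale1r addrC.
Qed.

Lemma tame_hdot w : tame (fun z => cexp (hdot z w)).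
Proof.
split.
- by apply: cmeas_exp; exact: measurable_hdotl.
- by apply: line_holo_cexp; exact: line_holo_hdot.
have [_ h] := subgauss_cj (subgauss_cexp_hdot w); move=> c /h[M _ hM]; exists M => z.
by have := hM z; rewrite cexp_conj hdot_cj.
Qed.

Lemma tame_EVI h w : tame h -> EVI (fun z => h z * cexp (hdot w z)).
Proof. by move=> sh; apply: subgauss_EVI; apply: subgaussM; [exact: tame_subgauss|exact: subgauss_cexp_hdot]. Qed.

Lemma EV_reproducing h w : tame h -> EV (fun z => h z * cexp (hdot w z)) = h w.
Proof.
move=> sh; have [mh lh _] := sh.
have P0 : (pi ^+ n)%:C != 0 :> C.
  by rewrite realcX expf_neq0//; apply/eqP => /complexI /eqP; rewrite gt_eqF// pi_gt0.
have E z : h z * cexp (hdot w z) * (gw z)%:C = ((pi ^+ n)^-1)%:C *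
    (h z * cexp ((1 : R)%:C * hdot w z) * (gauss 1 z)%:C).
  by rewrite mul1r /gw realcM; ring.
have iE : cintegrable (@dV R n)
    (fun z => h z * cexp ((1 : R)%:C * hdot w z) * (gauss 1 z)%:C).
  have := cintegrableZ (pi ^+ n)%:C (tame_EVI w sh); congr cintegrable.
  by apply/funext => z; rewrite E mulrA realcV divff// mul1r.
rewrite /EV; under eq_cintegral do rewrite E.
rewrite cintegralZ// reproducing// divr1 realcV mulrC -mulrA divff ?mulr1//.
Qed.

Lemma EV_mean h : tame h -> EV h = h 0.
Proof.
move=> sh; rewrite -(EV_reproducing 0 sh); apply: eq_EV => z.
by rewrite hdot0l cexp0 mulr1.
Qed.

End expectation.

(** * Iterated Gaussian integrals *)

Section iterated_expectation.
Variables (R : realType) (n1 n2 : nat).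
Local Notation C := R[i].
Variables (F : 'rV[C]_n1 -> 'rV[C]_n2 -> C) (M c : R).
Hypotheses (mF : measurable_fun setT (fun p : 'rV[C]_n1 * 'rV[C]_n2 => F p.1 p.2)).
Hypotheses (c1 : c < 1).
Hypothesis hF : forall x y, normc (F x y) <= M * expR (c * sq x) * expR (c * sq y).

Let G (p : 'rV[C]_n1 * 'rV[C]_n2) := F p.1 p.2 * (gw p.1)%:C * (gw p.2)%:C.

Let mG : measurable_fun setT G.
Proof.
apply: cmeasM; first apply: cmeasM => //; apply: cmeas_real.
  exact: (measurableT_comp (measurable_gw (R := R) (n := n1)) measurable_fst).
exact: (measurableT_comp (measurable_gw (R := R) (n := n2)) measurable_snd).
Qed.

Let iG : cintegrable (@dV R n1 \x @dV R n2)%E G.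
Proof.
apply: (@cintegrable_prod_ler _ _ _ _ _ _ _ _ (fun x => M * expR (c * sq x) * gw x)
  (fun y => 1 * expR (c * sq y) * gw y)) => //.
- exact: gw_growth_integrable.
- exact: gw_growth_integrable.
move=> x y; rewrite /G /= !normcM !normcRe !gtr0_norm ?gw_gt0// mul1r.
rewrite [leRHS]mulrACA -[leLHS]mulrA; apply: ler_wpM2r; last exact: hF.
by rewrite mulr_ge0// ltW// gw_gt0.
Qed.

Lemma measurable_slice1 x : measurable_fun setT (F x).
Proof. exact: (measurableT_comp mF (measurable_pair1 x)). Qed.

Lemma measurable_slice2 y : measurable_fun setT (F ^~ y).
Proof. exact: (measurableT_comp mF (measurable_pair2 y)). Qed.

Lemma EVI_slice1 x : EVI (F x).
Proof. by apply: (EVI_growth (measurable_slice1 x) c1) => y; exact: hF. Qed.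

Lemma EVI_slice2 y : EVI (F ^~ y).
Proof.
apply: (EVI_growth (M := M * expR (c * sq y)) (measurable_slice2 y) c1) => x.
by rewrite mulrAC; exact: hF.
Qed.

Let slice1E x : cintegral (@dV R n2) (fun y => G (x, y)) = EV (F x) * (gw x)%:C.
Proof.
rewrite /EV -cintegralZr; last exact: EVI_slice1.
by apply: eq_cintegral => y; rewrite /G /= mulrAC.
Qed.

Lemma EV_fubini : EV (fun x => EV (F x)) = EV (fun y => EV (F ^~ y)).
Proof.
rewrite /EV; under eq_cintegral do rewrite -/(EV _) -slice1E.
rewrite (cfubini iG); apply: eq_cintegral => y.
rewrite -cintegralZr; last exact: EVI_slice2.
by apply: eq_cintegral.
Qed.

Lemma measurable_EV : measurable_fun setT (fun x => EV (F x)).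
Proof.
have := cintegrable_meas (cintegrable_fubini1 iG).
under eq_fun do rewrite slice1E.
(* Fubini gives measurability of the slice integral times the Gaussian weight; [mg] concerns the
   inverse of that weight. *)
have mg : measurable_fun setT (fun x : 'rV[C]_n1 => (pi ^+ n1 * expR (sq x))%:C).
  apply: cmeas_real; apply: measurable_funM; first exact: measurable_cst.
  by apply: measurableT_comp => //; exact: measurable_sq.
move=> /cmeasM /(_ mg); apply: eq_measurable_fun => x _.
rewrite -mulrA -realcM /gw /gauss mulrACA mul1r mulVf ?mul1r.
  by rewrite -expRD addNr expR0 mulr1.
by rewrite gt_eqF// exprn_gt0// pi_gt0.
Qed.

Lemma normc_EV_slice x : normc (EV (F x)) <= M * (1 - c)^-1 ^+ n2 * expR (c * sq x).
Proof. by rewrite mulrAC; apply: normc_EV_le => //; exact: EVI_slice1. Qed.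

End iterated_expectation.

(** * Shifts under the Gaussian integral *)

Section shifts.
Variables (R : realType) (n : nat).
Local Notation C := R[i].
Local Notation Cn := 'rV[C]_n.
Implicit Types (u g U G : Cn -> C) (z w d : Cn).

Lemma subgauss_ge0P U e : subgauss U -> 0 < e -> exists2 M : R, 0 <= M &
  forall z, normc (U z) <= M * expR (e * sq z).
Proof. by move=> [_ +] e0 => /(_ e e0). Qed.

Lemma normc_cexp_hdot_sq z w :
  normc (cexp (hdot z w)) <= expR (2^-1 * sq z) * expR (2^-1 * sq w).
Proof.
rewrite (le_trans (normc_cexp_le _))// -expRD ler_expR.
rewrite (le_trans (normc_hdot_le _ _))//.
have h : 0 < 2^-1 :> R by rewrite invr_gt0.
rewrite (le_trans (absdot_young z w h))// lerD2l.
by rewrite (_ : (4 * 2^-1)^-1 = 2^-1)//; field.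
Qed.

Lemma measurable_fst_fun U : measurable_fun setT U ->
  measurable_fun setT (fun p : Cn * Cn => U p.1).
Proof. by move=> mU; exact: (measurableT_comp mU measurable_fst). Qed.

Lemma measurable_snd_fun U : measurable_fun setT U ->
  measurable_fun setT (fun p : Cn * Cn => U p.2).
Proof. by move=> mU; exact: (measurableT_comp mU measurable_snd). Qed.

Lemma EV_fubini_kernel U V (s : Cn -> Cn -> C) :
  subgauss U -> subgauss V -> measurable_fun setT (fun p : Cn * Cn => s p.1 p.2) ->
  (forall z y, normc (s z y) <= expR (2^-1 * sq z) * expR (2^-1 * sq y)) ->
  EV (fun z => U z * EV (fun y => V y * s z y)) =
  EV (fun y => V y * EV (fun z => U z * s z y)).
Proof.
move=> gU gV ms hs.
(* The kernel uses up half of the Gaussian exponent in each variable; [1/4] for [U] and for [V]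
   keeps the total below 1. *)
have q0 : 0 < 4^-1 :> R by rewrite invr_gt0.
have [M M0 hM] := subgauss_ge0P gU q0; have [N N0 hN] := subgauss_ge0P gV q0.
pose F z y := U z * (V y * s z y).
have mF : measurable_fun setT (fun p : Cn * Cn => F p.1 p.2).
  apply: cmeasM; first by apply: measurable_fst_fun; case: gU.
  by apply: cmeasM => //; apply: measurable_snd_fun; case: gV.
have c1 : 4^-1 + 2^-1 < 1 :> R by lra.
have hF z y : normc (F z y) <= M * N * expR ((4^-1 + 2^-1) * sq z) *
    expR ((4^-1 + 2^-1) * sq y).
  rewrite /F !normcM !mulrDl !expRD.
  have -> : M * N * (expR (4^-1 * sq z) * expR (2^-1 * sq z)) *
      (expR (4^-1 * sq y) * expR (2^-1 * sq y)) =
    (M * expR (4^-1 * sq z)) * ((N * expR (4^-1 * sq y)) *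
      (expR (2^-1 * sq z) * expR (2^-1 * sq y))).
    by move: (expR _) (expR _) (expR _) (expR _) => a b c d; ring.
  apply: ler_pM; [exact: normc_ge0| |exact: hM|].
    by rewrite mulr_ge0 ?normc_ge0.
  by apply: ler_pM; [exact: normc_ge0|exact: normc_ge0|exact: hN|exact: hs].
have sl z : EVI (fun y => V y * s z y).
  apply: (EVI_growth (M := N * expR (2^-1 * sq z)) _ c1).
    apply: cmeasM; first by case: gV.
    exact: (measurableT_comp ms (measurable_pair1 z)).
  move=> y; rewrite normcM mulrDl expRD.
  have -> : N * expR (2^-1 * sq z) * (expR (4^-1 * sq y) * expR (2^-1 * sq y)) =
    (N * expR (4^-1 * sq y)) * (expR (2^-1 * sq z) * expR (2^-1 * sq y)).
    by move: (expR _) (expR _) (expR _) => a b c; ring.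
  by apply: ler_pM; [exact: normc_ge0|exact: normc_ge0|exact: hN|exact: hs].
have sl2 y : EVI (fun z => U z * s z y).
  apply: (EVI_growth (M := M * expR (2^-1 * sq y)) _ c1).
    apply: cmeasM; first by case: gU.
    exact: (measurableT_comp ms (measurable_pair2 y)).
  move=> z; rewrite normcM mulrDl expRD.
  have -> : M * expR (2^-1 * sq y) * (expR (4^-1 * sq z) * expR (2^-1 * sq z)) =
    (M * expR (4^-1 * sq z)) * (expR (2^-1 * sq z) * expR (2^-1 * sq y)).
    by move: (expR _) (expR _) (expR _) => a b c; ring.
  by apply: ler_pM; [exact: normc_ge0|exact: normc_ge0|exact: hM|exact: hs].
transitivity (EV (fun z => EV (F z))).
  by apply: eq_EV => z; rewrite /F EVZ.
rewrite (EV_fubini mF c1 hF); apply: eq_EV => y; rewrite -EVZ//.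
by apply: eq_EV => z; rewrite /F mulrCA.
Qed.

Lemma measurable_cexp_hdot : measurable_fun setT
  (fun p : Cn * Cn => cexp (hdot p.1 p.2)).
Proof. by apply: cmeas_exp; apply: cmeas_hdot. Qed.

(* Expanding [U (z + d)] by the reproducing property and exchanging the integrals
   leaves the reproducing property of [G]. *)
Lemma EV_shift U G d : tame U -> tame G ->
  EV (fun z => U (z + d) * cj (G z)) = EV (fun z => U z * cj (G z) * cexp (hdot d z)).
Proof.
move=> sU sG.
have E1 z : U (z + d) * cj (G z) =
    cj (G z) * EV (fun y => (U y * cexp (hdot d y)) * cexp (hdot z y)).
  rewrite mulrC; congr (_ * _); rewrite -[LHS](EV_reproducing _ sU).
  by apply: eq_EV => y; rewrite hdotDl cexpD -mulrA; congr (_ * _); rewrite mulrC.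
under eq_EV do rewrite E1.
rewrite EV_fubini_kernel; last 4 first.
- exact/subgauss_cj/tame_subgauss.
- by apply: subgaussM; [exact: tame_subgauss|exact: subgauss_cexp_hdot].
- exact: measurable_cexp_hdot.
- by move=> z y; exact: normc_cexp_hdot_sq.
apply: eq_EV => y; rewrite mulrAC; congr (_ * _ * _).
rewrite -[in RHS](EV_reproducing y sG) -EV_cj; last exact: tame_EVI.
by apply: eq_EV => z; rewrite conjcM cexp_conj hdot_cj.
Qed.

(** [EV_shift] trades the shift of [U] by [y] for the kernel [cexp (hdot y z)]. In the other order
    of integration this kernel evaluates the conjugate of [y |-> G (s *: (z - y))] at [y = z], which
    gives [G 0]; the mean value of [U] remains. This is the analytic form of the shifts being
    uncorrelated. *)
Lemma EV_rotation U G (s : C) : tame U -> tame G ->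
  EV (fun y => EV (fun z => U (z + y) * cj (G (s *: (z - y))))) = U 0 * cj (G 0).
Proof.
move=> sU sG.
have sGy y : tame (fun z => G (s *: (z - y))).
  have := tame_shift (- y) (tame_affine s 0 sG); congr tame; apply/funext => z.
  by rewrite add0r.
have sGz z : tame (fun y => G (s *: (z - y))).
  have := tame_affine (- s) (s *: z) sG; congr tame; apply/funext => y.
  by rewrite scalerBr scaleNr.
under eq_EV do rewrite EV_shift//.
have q0 : 0 < 64^-1 :> R by rewrite invr_gt0.
have h16 : 0 < 16^-1 :> R by rewrite invr_gt0.
have [M M0 hM] := subgauss_ge0P (tame_subgauss sU) h16.
have sqx (x : Cn) : sq (s *: x) <= normc s ^+ 2 * sq x by rewrite sqZ.
have [N N0 hN] := subgauss_joint 0 (- s) (tame_subgauss sG) sqx h16.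
pose F y z := U z * cj (G (s *: (z - y))) * cexp (hdot y z).
have mF : measurable_fun setT (fun p : Cn * Cn => F p.1 p.2).
  apply: cmeasM; last exact: measurable_cexp_hdot.
  apply: cmeasM; first by apply: measurable_snd_fun; case: sU.
  apply: cmeas_conj; have [mG _ _] := sG; apply: (measurableT_comp mG).
  apply: cmeas_rowZ; first exact: measurable_cst.
  by apply: cmeas_rowB; [exact: measurable_snd|exact: measurable_fst].
(* In the variable [z] both [U] and [G] contribute [1/16], and the kernel contributes [1/2]. *)
have c1 : 8^-1 + 2^-1 < 1 :> R by lra.
have hF y z : normc (F y z) <= M * N * expR ((8^-1 + 2^-1) * sq y) *
    expR ((8^-1 + 2^-1) * sq z).
  rewrite /F 2!normcM normc_conj.
  have hN' := hN z y; rewrite add0r scaleNr -scalerBr in hN'.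
  apply: (@le_trans _ _ (M * expR (16^-1 * sq z) *
     (N * expR (16^-1 * sq z) * expR (16^-1 * sq y)) *
     (expR (2^-1 * sq y) * expR (2^-1 * sq z)))).
    apply: ler_pM; [by rewrite mulr_ge0 ?normc_ge0|exact: normc_ge0| |].
      by apply: ler_pM; [exact: normc_ge0|exact: normc_ge0|exact: hM|exact: hN'].
    exact: normc_cexp_hdot_sq.
  have -> : M * expR (16^-1 * sq z) *
     (N * expR (16^-1 * sq z) * expR (16^-1 * sq y)) *
     (expR (2^-1 * sq y) * expR (2^-1 * sq z)) =
     M * N * (expR (16^-1 * sq y) * expR (2^-1 * sq y)) *
     (expR (16^-1 * sq z) * expR (16^-1 * sq z) * expR (2^-1 * sq z)).
    by move: (expR _) (expR _) (expR _) (expR _) => a b c d; ring.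
  rewrite -!expRD; apply: ler_pM.
  - by rewrite !mulr_ge0 ?expR_ge0.
  - exact: expR_ge0.
  - apply: ler_wpM2l; first exact: mulr_ge0.
    by rewrite ler_expR; have := sq_ge0 y; move: (sq y) => Y Y0; lra.
  - by rewrite ler_expR; move: (sq z) => Z; lra.
rewrite (EV_fubini mF c1 hF).
have E z : EV (fun y => F y z) = U z * cj (G 0).
  have -> : G 0 = EV (fun y => G (s *: (z - y)) * cexp (hdot z y)).
    by rewrite (EV_reproducing z (sGz z)) subrr scaler0.
  rewrite -EV_cj; last exact: tame_EVI.
  rewrite -EVZ; last by apply: EVI_cj; exact: tame_EVI.
  by apply: eq_EV => y; rewrite /F conjcM cexp_conj hdot_cj mulrA.
under eq_EV do rewrite E.
by rewrite EVZr ?EV_mean//; exact/subgauss_EVI/tame_subgauss.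
Qed.

End shifts.

Lemma pow_fact_le (R : realType) (t : R) N : 0 <= t -> t ^+ N / N`!%:R <= expR t.
Proof.
move=> t0; apply: (@le_trans _ _ (series (exp_coeff t) N.+1)).
  rewrite /series/= big_nat_recr//= lerDr sumr_ge0// => k _.
  by rewrite /exp_coeff/= divr_ge0// exprn_ge0.
apply: nondecreasing_cvgn_le; last exact: is_cvg_series_exp_coeff.
apply: nondecreasing_series => k _ _.
by rewrite /exp_coeff/= divr_ge0// exprn_ge0.
Qed.

Lemma le_half_pow_eq0 (R : realType) (x D : R) : 0 <= x ->
  (forall N, x <= D * 2^-1 ^+ N) -> x = 0.
Proof.
move=> x0 h; apply/eqP; rewrite eq_le x0 andbT.
have cv : (fun k => D * 2^-1 ^+ k) @ \oo --> (0 : R).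
  rewrite -[0](mulr0 D); apply: cvgMr; apply: cvg_expr.
  by rewrite ger0_norm ?invr_ge0// invf_lt1// ltr1n.
by apply: (cvgr_to_ge cv); exact: nearW.
Qed.

(** * Polarization *)

Section one_variable.
Variable R : realType.
Local Notation C := R[i].
Implicit Types K : 'rV[C]_1 -> C.

(** One-variable substitute for holomorphy: self-reproduction already yields a Taylor expansion, and
    it passes through integrals and differences. Rows of length 1 let [EV] be reused, and the
    exponent [1/4] leaves room for factors [expR (b * normc (y ord0 ord0))]. *)
Definition good K := [/\ measurable_fun setT K,
  exists2 M : R, 0 <= M & forall x, normc (K x) <= M * expR (4^-1 * sq x) &
  forall x, K x = EV (fun y => K y * cexp (hdot x y))].

Lemma hdot1 (x y : 'rV[C]_1) : hdot x y = x ord0 ord0 * cj (y ord0 ord0).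
Proof. by rewrite /hdot /dot big_ord1 mxE NumconjE. Qed.

Lemma sq1 (x : 'rV[C]_1) : sq x = normc (x ord0 ord0) ^+ 2.
Proof. by rewrite /sq big_ord1. Qed.

Lemma expR_linear_sq (b t : R) : expR (b * t) <= expR (b ^+ 2) * expR (4^-1 * t ^+ 2).
Proof.
rewrite -expRD ler_expR -subr_ge0 (_ : _ - _ = (b - 2^-1 * t) ^+ 2) ?sqr_ge0//.
by field.
Qed.

Lemma good_growth K M b y : 0 <= M -> (forall x, normc (K x) <= M * expR (4^-1 * sq x)) ->
  normc (K y) * expR (b * normc (y ord0 ord0)) <= M * expR (b ^+ 2) * expR (2^-1 * sq y).
Proof.
move=> M0 hM; have := expR_linear_sq b (normc (y ord0 ord0)); rewrite -sq1 => h.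
have -> : M * expR (b ^+ 2) * expR (2^-1 * sq y) =
    (M * expR (4^-1 * sq y)) * (expR (b ^+ 2) * expR (4^-1 * sq y)).
  have -> : expR (2^-1 * sq y) = expR (4^-1 * sq y) * expR (4^-1 * sq y).
    by rewrite -expRD; congr expR; move: (sq y) => Y; field.
  by move: (expR _) (expR _) => a c; ring.
by apply: ler_pM; [exact: normc_ge0|exact: expR_ge0|exact: hM|exact: h].
Qed.

Lemma goodB (K L : 'rV[C]_1 -> C) : good K -> good L -> good (fun x => K x - L x).
Proof.
move=> [mK [M M0 hM] rK] [mL [N N0 hN] rL].
have iE (J : 'rV[C]_1 -> C) (P : R) : measurable_fun setT J -> 0 <= P ->
    (forall x, normc (J x) <= P * expR (4^-1 * sq x)) ->
    forall x, EVI (fun y => J y * cexp (hdot x y)).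
  move=> mJ P0 hP x.
  have c1 : 2^-1 < 1 :> R by rewrite invf_lt1// ltr1n.
  apply: (EVI_growth (M := P * expR (normc (x ord0 ord0) ^+ 2)) _ c1).
    by apply: cmeasM => //; apply: cmeas_exp; exact: measurable_hdotr.
  move=> y; rewrite normcM (le_trans _ (good_growth (normc (x ord0 ord0)) y P0 hP))//.
  apply: ler_wpM2l; first exact: normc_ge0.
  rewrite (le_trans (normc_cexp_le _))// hdot1 normcM normc_conj//.
split; first exact: cmeasB.
  exists (M + N); first exact: addr_ge0.
  by move=> x; rewrite (le_trans (normcD _ _))// normcN mulrDl lerD.
move=> x; under eq_EV do rewrite mulrBl.
by rewrite EVB -?rK -?rL//; [exact: (iE K M)|exact: (iE L N)].
Qed.

Section vanishing.
Variable K : 'rV[C]_1 -> C.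
Hypothesis gK : good K.

(** Taylor coefficient of [K] at 0, read off by expanding the kernel in the reproducing formula. *)
Let co j : C := EV (fun y => K y * (cj (y ord0 ord0) ^+ j / j`!%:R)).

Let half1 : 2^-1 < 1 :> R.
Proof. by rewrite invf_lt1// ltr1n. Qed.

Let bound_pow N (y : 'rV[C]_1) :
  normc (cj (y ord0 ord0) ^+ N / N`!%:R) <= expR (1 * normc (y ord0 ord0)).
Proof.
rewrite normcM normcX normc_conj normcV -realc_nat normcRe ger0_norm//.
by rewrite mul1r pow_fact_le// normc_ge0.
Qed.

Let m0 : measurable_fun setT (fun y : 'rV[C]_1 => y ord0 ord0).
Proof. exact: measurable_coord. Qed.

Let ico j : EVI (fun y => K y * (cj (y ord0 ord0) ^+ j / j`!%:R)).
Proof.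
have [mK [M M0 hM] _] := gK.
apply: (EVI_growth (M := M * expR (1 ^+ 2)) _ half1).
  apply: cmeasM => //; apply: cmeasM; last exact: measurable_cst.
  by apply: cmeasX; exact: cmeas_conj.
move=> y; rewrite normcM (le_trans _ (good_growth 1 y M0 hM))//.
by apply: ler_wpM2l; [exact: normc_ge0|exact: bound_pow].
Qed.

Let taylorE N (x y : 'rV[C]_1) : K y * taylor_exp N (hdot x y) =
  \sum_(j < N) x ord0 ord0 ^+ j * (K y * (cj (y ord0 ord0) ^+ j / j`!%:R)).
Proof.
rewrite /taylor_exp mulr_sumr; apply: eq_bigr => j _; rewrite hdot1 exprMn.
by move: (x _ _ ^+ j) (cj _ ^+ j) (j`!%:R^-1) (K y) => a b c d; ring.
Qed.

Let mtaylor N (x : 'rV[C]_1) : measurable_fun setT (fun y => taylor_exp N (hdot x y)).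
Proof.
apply: cmeas_sum => j _; apply: cmeasM; last exact: measurable_cst.
by apply: cmeasX; exact: measurable_hdotr.
Qed.

(** The Taylor remainder of [K] is the integral of [K] against that of the kernel. Leaving [A] and
    [b] free serves two regimes: small [x], with a power of its modulus as [A], and fixed [x], with
    [A = 2^-1 ^+ N]. *)
Lemma good_taylor : exists2 D : R -> R, (forall b, 0 <= D b) &
  forall N (x : 'rV[C]_1) (b A : R), 0 <= A ->
  (forall y, normc (cexp (hdot x y) - taylor_exp N (hdot x y)) <=
     A * expR (b * normc (y ord0 ord0))) ->
  normc (K x - \sum_(j < N) x ord0 ord0 ^+ j * co j) <= A * D b.
Proof.
have [mK [M M0 hM] rK] := gK.
exists (fun b => M * expR (b ^+ 2) * (1 - 2^-1)^-1 ^+ 1).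
  by move=> b; rewrite !mulr_ge0 ?expR_ge0// exprn_ge0// invr_ge0 subr_ge0 ltW.
move=> N x b A A0 hA.
have ipoly : EVI (fun y => K y * taylor_exp N (hdot x y)).
  rewrite /EVI; under eq_fun do rewrite taylorE.
  by apply: EVI_sum => j _; apply: EVIZ; exact: ico.
have mdiff : measurable_fun setT
    (fun y => K y * (cexp (hdot x y) - taylor_exp N (hdot x y))).
  apply: cmeasM => //; apply: cmeasB => //.
  by apply: cmeas_exp; exact: measurable_hdotr.
have hdiff y : normc (K y * (cexp (hdot x y) - taylor_exp N (hdot x y))) <=
    A * (M * expR (b ^+ 2)) * expR (2^-1 * sq y).
  rewrite normcM; apply: (@le_trans _ _ (normc (K y) * (A * expR (b * normc (y ord0 ord0))))).
    by apply: ler_wpM2l; [exact: normc_ge0|exact: hA].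
  rewrite mulrCA -(mulrA A); apply: ler_wpM2l => //.
  exact: good_growth.
have idiff := EVI_growth mdiff half1 hdiff.
have -> : K x - \sum_(j < N) x ord0 ord0 ^+ j * co j =
    EV (fun y => K y * (cexp (hdot x y) - taylor_exp N (hdot x y))).
  rewrite {1}rK.
  have -> : \sum_(j < N) x ord0 ord0 ^+ j * co j =
      EV (fun y => K y * taylor_exp N (hdot x y)).
    under [RHS]eq_EV do rewrite taylorE.
    rewrite EV_sum; last by move=> j _; apply: EVIZ; exact: ico.
    by apply: eq_bigr => j _; rewrite EVZ//; exact: ico.
  apply/eqP; rewrite subr_eq -EVD//; apply/eqP; apply: eq_EV => y.
  by rewrite -mulrDr subrK.
by rewrite [leRHS]mulrA; apply: normc_EV_le.
Qed.

Hypothesis K0 : forall r : R, 0 < r <= 1 -> K (const_mx r%:C) = 0.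

(** Strong induction: at a real point [r] of the segment only the term of order [N] survives, so the
    modulus of [co N] times [r ^+ N] is at most [r ^+ N.+1 * D 2], with [r] as small as desired. *)
Let co0 N : co N = 0.
Proof.
have [D D0 hD] := good_taylor.
elim/ltn_ind: N => N ih; apply: eq0_normc; apply/eqP.
rewrite eq_le normc_ge0 andbT; apply/ler_addgt0Pl => e e0; rewrite addr0.
pose r := Num.min 1 (e / (D 2 + 1)).
have D1 : 0 < D 2 + 1 by rewrite ltr_wpDl.
have r0 : 0 < r by rewrite lt_min ltr01 divr_gt0.
have r1 : r <= 1 by rewrite ge_min lexx.
have nr : normc r%:C = r by rewrite normcRe gtr0_norm.
have := hD N.+1 (const_mx r%:C) 2 (r ^+ N.+1) (exprn_ge0 _ (ltW r0)).
rewrite K0 ?r0 ?r1// mxE big_ord_recr/= big1; last first.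
  by move=> j _; rewrite ih ?mulr0.
rewrite !add0r normcN normcM normcX nr exprSr -mulrA => h.
have {}h : normc (co N) <= r * D 2.
  have rN : 0 < r ^+ N by rewrite exprn_gt0.
  rewrite -(ler_pM2l rN) h// => y.
  rewrite (le_trans (taylor_exp_bound _ _))// hdot1 normcM mxE nr normc_conj.
  have ny := normc_ge0 (y ord0 ord0); set t := normc (y ord0 ord0) in ny *.
  rewrite -exprSr exprMn -2!mulrA.
  apply: ler_wpM2l; first by rewrite exprn_ge0// ltW.
  rewrite (_ : 2 * t = t + t); last by rewrite mulr_natl mulr2n.
  rewrite expRD mulrA; apply: ler_pM; rewrite ?expR_ge0//.
  - by rewrite divr_ge0// exprn_ge0.
  - exact: pow_fact_le.
  - by rewrite ler_expR ler_piMl.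
rewrite (le_trans h)//; have : r <= e / (D 2 + 1) by rewrite ge_min lexx orbT.
rewrite ler_pdivlMr// => /(le_trans _); apply.
by apply: ler_wpM2l; [exact: ltW|rewrite lerDl].
Qed.

Lemma good_eq0 x : K x = 0.
Proof.
have [D D0 hD] := good_taylor.
apply: eq0_normc; set t := normc (x ord0 ord0).
(* With [a] the modulus of [hdot x y], the quotient of [a ^+ N] by [N] factorial is at most
   [2^-1 ^+ N * expR (2 * a)]; the remainder bound adds a factor [expR a], hence the rate
   [3 * t]. *)
apply: (@le_half_pow_eq0 _ _ (D (3 * t))); first exact: normc_ge0.
move=> N; have := hD N x (3 * t) (2^-1 ^+ N).
rewrite big1 ?subr0; last by move=> j _; rewrite co0 mulr0.
move=> h; rewrite (mulrC (D _)); apply: h => [|y]; first by rewrite exprn_ge0// invr_ge0.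
rewrite (le_trans (taylor_exp_bound _ _))// hdot1 normcM normc_conj -/t.
have t0 : 0 <= t := normc_ge0 _.
have ny := normc_ge0 (y ord0 ord0); set s := normc (y ord0 ord0) in ny *.
have ts : 0 <= t * s by rewrite mulr_ge0.
have -> : 3 * t * s = 2 * (t * s) + t * s by ring.
rewrite expRD mulrA; apply: ler_wpM2r; first exact: expR_ge0.
have := pow_fact_le N (mulr_ge0 (ler0n R 2) ts); rewrite exprMn => h2.
rewrite -(ler_pM2l (exprn_gt0 N (ltr0n R 2 : 0 < 2))) ?ltr0n//.
by rewrite exprVn mulVKf ?expf_neq0 ?pnatr_eq0// [leLHS]mulrA.
Qed.

End vanishing.

End one_variable.

Section polarization.
Variables (R : realType) (n : nat).
Local Notation C := R[i].
Local Notation Cn := 'rV[C]_n.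
Implicit Types (u g : Cn -> C) (p q : Cn).

(* [smeared 0] is [u z * cj (g w)], [smeared 1] on the diagonal is the Berezin
   transform, and [smeared (-1)] on the diagonal is [star_shift]. *)
Definition smeared (s : C) u g (z w : Cn) : C :=
  EV (fun y => u (z + y) * cj (g (w + s *: y))).

(* The arguments [p + x q] and [p + conj x q] coincide for real [x]; the conjugate
   in [smeared] makes [along (smeared s u g) p q] holomorphic in [x]. *)
Definition along (N : Cn -> Cn -> C) p q (x : 'rV[C]_1) : C :=
  N (p + x ord0 ord0 *: q) (p + cj (x ord0 ord0) *: q).

(** Each slice [F ^~ z] is tame in [x] and therefore reproduces itself; Fubini carries this over to
    the integral, so holomorphy of an integral never has to be established. *)
Lemma smeared_good s u g p q : tame u -> tame g -> good (along (smeared s u g) p q).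
Proof.
move=> su sg.
have sA1 (x : 'rV[C]_1) : sq (x ord0 ord0 *: q) <= sq q * sq x.
  by rewrite sqZ sq1 mulrC.
have sA2 (x : 'rV[C]_1) : sq (cj (x ord0 ord0) *: q) <= sq q * sq x.
  by rewrite sqZ sq1 normc_conj mulrC.
have g1 := subgauss_joint p 1 (tame_subgauss su) sA1; have g2 := subgauss_joint p s (tame_subgauss sg) sA2.
pose F (x : 'rV[C]_1) (y : Cn) :=
  u (p + x ord0 ord0 *: q + y) * cj (g (p + cj (x ord0 ord0) *: q + s *: y)).
have mx : measurable_fun setT (fun t : 'rV[C]_1 * Cn => t.1 ord0 ord0).
  exact: (measurableT_comp (measurable_coord (n := 1) ord0) measurable_fst).
have mF : measurable_fun setT (fun t : 'rV[C]_1 * Cn => F t.1 t.2).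
  have [mu _ _] := su; have [mg _ _] := sg.
  apply: cmeasM.
    apply: (measurableT_comp mu); apply: cmeas_rowD; last exact: measurable_snd.
    apply: cmeas_rowD; first exact: measurable_cst.
    by apply: cmeas_rowZ => //; exact: measurable_cst.
  apply: cmeas_conj; apply: (measurableT_comp mg); apply: cmeas_rowD.
    apply: cmeas_rowD; first exact: measurable_cst.
    by apply: cmeas_rowZ; [exact: cmeas_conj|exact: measurable_cst].
  by apply: cmeas_rowZ; [exact: measurable_cst|exact: measurable_snd].
have hF e : 0 < e -> exists2 M, 0 <= M &
    forall x y, normc (F x y) <= M * expR (e * sq x) * expR (e * sq y).
  move=> e0; have e2 : 0 < e / 2 by rewrite divr_gt0.
  have [M M0 hM] := g1 _ e2; have [N N0 hN] := g2 _ e2.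
  exists (M * N); first exact: mulr_ge0.
  move=> x y; rewrite /F normcM normc_conj.
  have hM' := hM x y; rewrite scale1r in hM'.
  have -> : M * N * expR (e * sq x) * expR (e * sq y) =
      (M * expR (e / 2 * sq x) * expR (e / 2 * sq y)) *
      (N * expR (e / 2 * sq x) * expR (e / 2 * sq y)).
    have ee t : expR (e * t) = expR (e / 2 * t) * expR (e / 2 * t).
      by rewrite -expRD -mulrDl -splitr.
    by rewrite !ee; move: (expR _) (expR _) => a b; ring.
  by apply: ler_pM; [exact: normc_ge0|exact: normc_ge0|exact: hM'|exact: hN].
have q8 : 0 < 8^-1 :> R by rewrite invr_gt0.
have [M M0 hM] := hF _ q8.
have c1 : 8^-1 < 1 :> R by rewrite invf_lt1// ltr1n.
split.
- exact: (measurable_EV mF c1 hM).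
- exists (M * (1 - 8^-1)^-1 ^+ n).
    by rewrite mulr_ge0// exprn_ge0// invr_ge0 subr_ge0 ltW.
  move=> x; apply: le_trans (normc_EV_slice mF c1 hM x) _.
  apply: ler_wpM2l.
    by rewrite mulr_ge0// exprn_ge0// invr_ge0 subr_ge0 ltW.
  by rewrite ler_expR; have := sq_ge0 x; move: (sq x) => X X0; lra.
move=> x.
have [_ /(_ _ q8)[N N0 hN]] := subgauss_cexp_hdot x.
pose H (y : 'rV[C]_1) (z : Cn) := F y z * cexp (hdot x y).
have mH : measurable_fun setT (fun t : 'rV[C]_1 * Cn => H t.1 t.2).
  apply: cmeasM => //; apply: cmeas_exp.
  exact: (measurableT_comp (measurable_hdotr x) measurable_fst).
have c4 : 4^-1 < 1 :> R by rewrite invf_lt1// ltr1n.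
have hH y z : normc (H y z) <= M * N * expR (4^-1 * sq y) * expR (4^-1 * sq z).
  rewrite /H normcM.
  apply: (@le_trans _ _ ((M * expR (8^-1 * sq y) * expR (8^-1 * sq z)) *
    (N * expR (8^-1 * sq y)))).
    by apply: ler_pM; [exact: normc_ge0|exact: normc_ge0|exact: hM|exact: hN].
  have -> : expR (4^-1 * sq y) = expR (8^-1 * sq y) * expR (8^-1 * sq y).
    by rewrite -expRD; congr expR; move: (sq y) => Y; field.
  have le : expR (8^-1 * sq z) <= expR (4^-1 * sq z).
    by rewrite ler_expR; have := sq_ge0 z; move: (sq z) => Z Z0; lra.
  have -> : M * expR (8^-1 * sq y) * expR (8^-1 * sq z) * (N * expR (8^-1 * sq y)) =
      M * N * (expR (8^-1 * sq y) * expR (8^-1 * sq y)) * expR (8^-1 * sq z).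
    by move: (expR _) (expR _) => a b; ring.
  by apply: ler_wpM2l => //; rewrite !mulr_ge0 ?expR_ge0.
have E y : along (smeared s u g) p q y * cexp (hdot x y) = EV (H y).
  by rewrite -EVZr//; exact: (EVI_slice1 mF c1 hM).
under eq_EV do rewrite E.
rewrite (EV_fubini mH c4 hH); apply: eq_EV => z.
have sF : tame (F ^~ z).
  split; first exact: (measurable_slice2 mF).
    have [_ lu _] := su; have [_ lg _] := sg.
    move=> a b; apply: choloM.
      have := lu (p + a ord0 ord0 *: q + z) (b ord0 ord0 *: q).
      congr cholo; apply/funext => l; congr u.
      by rewrite !mxE scalerDl scalerA addrAC -!addrA; do !congr (_ + _); rewrite addrC.
    have := cholo_conj (lg (p + cj (a ord0 ord0) *: q + s *: z) (cj (b ord0 ord0) *: q)).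
    congr cholo; apply/funext => l; congr (cj (g _)).
    by rewrite !mxE conjcD conjcM scalerDl scalerA addrAC -!addrA; do !congr (_ + _); rewrite addrC.
  move=> c c0; have [P P0 hP] := hF _ c0; exists (P * expR (c * sq z)) => y.
  by rewrite mulrAC; exact: hP.
exact: (esym (EV_reproducing x sF)).
Qed.

Lemma along_diag_eq0 (N : Cn -> Cn -> C) :
  (forall p q, good (along N p q)) -> (forall z, N z z = 0) ->
  forall z w, N z w = 0.
Proof.
move=> gN N0 z w.
(* Chosen so that [x = - 'i] gives the pair [(z, w)], while real [x] stays on the diagonal, where
   [N] vanishes. *)
pose p := (2^-1 : C) *: (z + w); pose q := ('i / 2 : C) *: (z - w).
have h := @good_eq0 R (along N p q) (gN p q).
have {}h : along N p q (const_mx (- 'i)) = 0.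
  apply: h => r _; by rewrite /along mxE cj_real.
move: h; rewrite /along mxE.
have ii : 'i * 'i = -1 :> C by rewrite -expr2 sqr_i.
have -> : p + - 'i *: q = z.
  rewrite /p /q scalerA mulNr mulrA ii mulN1r opprK.
  by apply/rowP => k; rewrite !mxE; field.
have -> : p + cj (- 'i) *: q = w.
  have -> : cj (- 'i) = 'i :> C by rewrite /cj /= opprK oppr0.
  rewrite /p /q scalerA mulrA ii mulN1r.
  by apply/rowP => k; rewrite !mxE; field.
exact.
Qed.

End polarization.

(** * Toeplitz operators and the Berezin transform *)

Section smeared_identities.
Variables (R : realType) (n : nat).
Local Notation C := R[i].
Local Notation Cn := 'rV[C]_n.
Implicit Types (f g u v : Cn -> C) (z w p : Cn).

Lemma tame_shiftl g w : tame g -> tame (fun y => g (w + y)).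
Proof. by move=> sg; have := tame_affine 1 w sg; under eq_fun do rewrite scale1r. Qed.

Lemma smeared0 u g z w : tame u -> smeared 0 u g z w = u z * cj (g w).
Proof.
move=> su; rewrite /smeared; under eq_EV do rewrite scale0r addr0.
rewrite EVZr; last by apply/subgauss_EVI/tame_subgauss; exact: tame_shiftl.
by rewrite EV_mean ?addr0//; exact: tame_shiftl.
Qed.

Lemma smeared_cross_integrable s u g z : tame u -> tame g ->
  EVI (fun y => smeared s u g (z + y) (z - s *: y)).
Proof.
move=> su sg.
have q0 : 0 < 8^-1 :> R by rewrite invr_gt0.
have c1 : 4^-1 < 1 :> R by rewrite invf_lt1// ltr1n.
have s1 (y : Cn) : sq y <= 1 * sq y by rewrite mul1r.
have s2 (y : Cn) : sq (- (s *: y)) <= normc s ^+ 2 * sq y by rewrite sqN sqZ.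
have [M M0 hM] := subgauss_joint z 1 (tame_subgauss su) s1 q0.
have [N N0 hN] := subgauss_joint z s (tame_subgauss sg) s2 q0.
pose F (y x : Cn) := u (z + y + x) * cj (g (z - s *: y + s *: x)).
have mF : measurable_fun setT (fun t : Cn * Cn => F t.1 t.2).
  have [mu _ _] := su; have [mg _ _] := sg; apply: cmeasM.
    apply: (measurableT_comp mu); apply: cmeas_rowD; last exact: measurable_snd.
    by apply: cmeas_rowD; [exact: measurable_cst|exact: measurable_fst].
  apply: cmeas_conj; apply: (measurableT_comp mg); apply: cmeas_rowD.
    apply: cmeas_rowB; first exact: measurable_cst.
    by apply: cmeas_rowZ; [exact: measurable_cst|exact: measurable_fst].
  by apply: cmeas_rowZ; [exact: measurable_cst|exact: measurable_snd].
have hF y x : normc (F y x) <= M * N * expR (4^-1 * sq y) * expR (4^-1 * sq x).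
  rewrite /F normcM normc_conj; have hM' := hM y x; rewrite scale1r in hM'.
  have e4 t : expR (4^-1 * t) = expR (8^-1 * t) * expR (8^-1 * t).
    by rewrite -expRD; congr expR; field.
  have -> : M * N * expR (4^-1 * sq y) * expR (4^-1 * sq x) =
      (M * expR (8^-1 * sq y) * expR (8^-1 * sq x)) *
      (N * expR (8^-1 * sq y) * expR (8^-1 * sq x)).
    by rewrite !e4; move: (expR _) (expR _) => a b; ring.
  by apply: ler_pM; [exact: normc_ge0|exact: normc_ge0|exact: hM'|exact: hN].
apply: (EVI_growth (measurable_EV mF c1 hF) c1) => y.
exact: (normc_EV_slice mF c1 hF).
Qed.

Lemma smeared_cross s u g z : tame u -> tame g ->
  EV (fun y => smeared s u g (z + y) (z - s *: y)) = u z * cj (g z).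
Proof.
move=> su sg; have := EV_rotation s (tame_shiftl z su) (tame_shiftl z sg).
rewrite !addr0 => <-; apply: eq_EV => y; apply: eq_EV => x.
by rewrite scalerBr (addrC x) addrA (addrC (s *: x)) addrA.
Qed.

Lemma smeared_flip s f g u v : tame f -> tame g -> tame u -> tame v ->
  (forall z w, smeared s u g z w - smeared s f v z w = u z * cj (g w) - f z * cj (v w)) ->
  forall z, smeared (- s) u g z z - smeared (- s) f v z z = u z * cj (g z) - f z * cj (v z).
Proof.
move=> sf sg su sv H z.
have gr a b : tame a -> tame b -> subgauss (fun y => a (z + y) * cj (b (z + - s *: y))).
  move=> sa sb; apply: subgaussM; first exact/tame_subgauss/tame_shiftl.
  by apply/subgauss_cj/tame_subgauss; exact: tame_affine.
rewrite -(smeared_cross s z su sg) -(smeared_cross s z sf sv).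
rewrite -[RHS]EVB; [|exact: smeared_cross_integrable..].
rewrite -[LHS]EVB; [|by apply: subgauss_EVI; exact: gr..].
by apply: eq_EV => y; rewrite H !scaleNr.
Qed.

Lemma smeared_polarize s f g u v : tame f -> tame g -> tame u -> tame v ->
  (forall z, smeared s u g z z - smeared s f v z z = u z * cj (g z) - f z * cj (v z)) ->
  forall z w, smeared s u g z w - smeared s f v z w = u z * cj (g w) - f z * cj (v w).
Proof.
move=> sf sg su sv H z w; apply: subr0_eq.
(* Writing the right-hand side with [smeared 0] brings all four terms within reach of
   [smeared_good]. *)
pose N z w := (smeared s u g z w - smeared s f v z w) -
  (smeared 0 u g z w - smeared 0 f v z w).
have gN p q : good (along N p q).
  apply: (goodB (K := fun x => along (smeared s u g) p q x - along (smeared s f v) p q x)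
    (L := fun x => along (smeared 0 u g) p q x - along (smeared 0 f v) p q x)).
    by apply: goodB; exact: smeared_good.
  by apply: goodB; exact: smeared_good.
have := along_diag_eq0 gN _ z w.
rewrite /N (smeared0 g z w su) (smeared0 v z w sf); apply => x.
have e := H x; rewrite -(smeared0 g x x su) -(smeared0 v x x sf) in e.
by apply/eqP; rewrite subr_eq0; apply/eqP; exact: e.
Qed.

Lemma cj_cexp_hdot z w : cj (cexp (hdot z w)) = cexp (hdot w z).
Proof. by rewrite cexp_conj hdot_cj. Qed.

Lemma tame_mul_hdot u w : tame u -> tame (fun y => u y * cexp (hdot y w)).
Proof. by move=> su; apply: tameM => //; exact: tame_hdot. Qed.

(* Both exponential factors are absorbed by [EV_shift], the second one after
   conjugation. *)
Lemma EV_kernels u g z p : tame u -> tame g ->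
  EV (fun w => u w * cj (g w) * cexp (hdot w p) * cexp (hdot z w)) =
  cexp (hdot z p) * smeared 1 u g z p.
Proof.
move=> su sg; have sU := tame_mul_hdot p su.
transitivity (EV (fun w => (u w * cexp (hdot w p)) * cj (g w) * cexp (hdot z w))).
  by apply: eq_EV => w; rewrite (mulrAC (u w)).
rewrite -(EV_shift z sU sg).
have suz : tame (fun w => u (z + w)) by exact: tame_shiftl.
transitivity (cexp (hdot z p) *
    EV (fun w => cj (g w * cj (u (z + w)) * cexp (hdot p w)))).
  rewrite -EVZ; last first.
    apply/EVI_cj/subgauss_EVI/subgaussM; last exact: subgauss_cexp_hdot.
    by apply: subgaussM; [exact: tame_subgauss|exact/subgauss_cj/tame_subgauss].
  apply: eq_EV => w; rewrite (addrC w) hdotDl cexpD 2!conjcM cjK cj_cexp_hdot.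
  by move: (u _) (g _) (cexp _) (cexp _) => a b c d; ring.
congr (_ * _); rewrite EV_cj; last first.
  apply/subgauss_EVI/subgaussM; last exact: subgauss_cexp_hdot.
  by apply: subgaussM; [exact: tame_subgauss|exact/subgauss_cj/tame_subgauss].
rewrite -(EV_shift p sg suz) -EV_cj; last first.
  apply/subgauss_EVI/subgaussM; first exact/tame_subgauss/tame_shift.
  exact/subgauss_cj/tame_subgauss.
apply: eq_EV => w; rewrite conjcM cjK mulrC scale1r.
by rewrite (addrC w).
Qed.

Lemma EV_left u z p : tame u ->
  EV (fun w => u w * cexp (hdot w p) * cexp (hdot z w)) = u z * cexp (hdot z p).
Proof. by move=> su; rewrite (EV_reproducing z (tame_mul_hdot p su)). Qed.

Lemma EV_right g z p : tame g ->
  EV (fun w => cj (g w) * cexp (hdot w p) * cexp (hdot z w)) =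
  cj (g p) * cexp (hdot z p).
Proof.
move=> sg; have sG := tame_mul_hdot z sg.
transitivity (EV (fun w => cj (g w * cexp (hdot w z) * cexp (hdot p w)))).
  by apply: eq_EV => w; rewrite 2!conjcM !cj_cexp_hdot mulrAC.
rewrite EV_cj; last exact: tame_EVI.
by rewrite (EV_reproducing p sG) conjcM cj_cexp_hdot.
Qed.

Lemma toeplitzE (phi F : Cn -> C) z :
  toeplitz phi F z = EV (fun w => phi w * F w * cexp (hdot z w)).
Proof. exact: mu_integralE. Qed.

Section span.
Variables (m : nat) (c : 'I_m -> C) (p : 'I_m -> Cn).

(** A holomorphic symbol acts by multiplication ([EV_left]), while for the conjugate of one each
    kernel is an eigenvector, with eigenvalue the symbol at the pole [p j] ([EV_right]). *)
Lemma toeplitz_span f g : tame f -> tame g ->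
  toeplitz (fun z => f z + cj (g z)) (fun w => \sum_j c j * cexp (hdot w (p j))) =
  (fun z => \sum_j c j * ((f z + cj (g (p j))) * cexp (hdot z (p j)))).
Proof.
move=> sf sg; apply/funext => z; rewrite toeplitzE.
have gf j : subgauss (fun w => f w * cexp (hdot w (p j)) * cexp (hdot z w)).
  by apply: subgaussM; [exact/tame_subgauss/tame_mul_hdot|exact: subgauss_cexp_hdot].
have gg j : subgauss (fun w => cj (g w) * cexp (hdot w (p j)) * cexp (hdot z w)).
  apply: subgaussM; last exact: subgauss_cexp_hdot.
  by apply: subgaussM; [exact/subgauss_cj/tame_subgauss|exact/tame_subgauss/tame_hdot].
transitivity (EV (fun w => \sum_j c j *
    (f w * cexp (hdot w (p j)) * cexp (hdot z w) +
     cj (g w) * cexp (hdot w (p j)) * cexp (hdot z w)))).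
  apply: eq_EV => w; rewrite mulr_sumr mulr_suml; apply: eq_bigr => j _.
  by move: (f w) (cj _) (cexp _) (cexp _) (c j) => a b k l d; ring.
rewrite EV_sum; last by move=> j _; apply: EVIZ; apply: EVID; exact: subgauss_EVI.
apply: eq_bigr => j _; rewrite EVZ; last by apply: EVID; exact: subgauss_EVI.
rewrite EVD; [|exact: subgauss_EVI..].
by rewrite EV_left// EV_right// mulrDl.
Qed.

(** After multiplication by [f] a kernel is in general no longer an eigenvector for the conjugate of
    [v]; that mixed term is the one that becomes [smeared 1]. *)
Lemma toeplitz_span2 f g u v z : tame f -> tame g -> tame u -> tame v ->
  toeplitz (fun z => u z + cj (v z)) (fun w =>
    \sum_j c j * ((f w + cj (g (p j))) * cexp (hdot w (p j)))) z =
  \sum_j c j * (cexp (hdot z (p j)) *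
    (u z * f z + cj (g (p j)) * u z + smeared 1 f v z (p j) + cj (g (p j)) * cj (v (p j)))).
Proof.
move=> sf sg su sv; rewrite toeplitzE.
have suf : tame (fun w => u w * f w) by exact: tameM.
have g1 j : subgauss (fun w => u w * f w * cexp (hdot w (p j)) * cexp (hdot z w)).
  by apply: subgaussM; [exact/tame_subgauss/tame_mul_hdot|exact: subgauss_cexp_hdot].
have g2 j : subgauss (fun w => u w * cexp (hdot w (p j)) * cexp (hdot z w)).
  by apply: subgaussM; [exact/tame_subgauss/tame_mul_hdot|exact: subgauss_cexp_hdot].
have g3 j : subgauss (fun w => f w * cj (v w) * cexp (hdot w (p j)) * cexp (hdot z w)).
  apply: subgaussM; last exact: subgauss_cexp_hdot.
  apply: subgaussM; last exact/tame_subgauss/tame_hdot.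
  by apply: subgaussM; [exact: tame_subgauss|exact/subgauss_cj/tame_subgauss].
have g4 j : subgauss (fun w => cj (v w) * cexp (hdot w (p j)) * cexp (hdot z w)).
  apply: subgaussM; last exact: subgauss_cexp_hdot.
  by apply: subgaussM; [exact/subgauss_cj/tame_subgauss|exact/tame_subgauss/tame_hdot].
transitivity (EV (fun w => \sum_j c j *
    ((u w * f w * cexp (hdot w (p j)) * cexp (hdot z w) +
      cj (g (p j)) * (u w * cexp (hdot w (p j)) * cexp (hdot z w))) +
     (f w * cj (v w) * cexp (hdot w (p j)) * cexp (hdot z w) +
      cj (g (p j)) * (cj (v w) * cexp (hdot w (p j)) * cexp (hdot z w)))))).
  apply: eq_EV => w; rewrite mulr_sumr mulr_suml; apply: eq_bigr => j _.
  by move: (f w) (u w) (cj _) (cj _) (cexp _) (cexp _) (c j) => a a' b b' k l d; ring.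
have i1 j : EVI (fun w => u w * f w * cexp (hdot w (p j)) * cexp (hdot z w) +
      cj (g (p j)) * (u w * cexp (hdot w (p j)) * cexp (hdot z w))).
  by apply: EVID; [exact: subgauss_EVI|apply: EVIZ; exact: subgauss_EVI].
have i2 j : EVI (fun w => f w * cj (v w) * cexp (hdot w (p j)) * cexp (hdot z w) +
      cj (g (p j)) * (cj (v w) * cexp (hdot w (p j)) * cexp (hdot z w))).
  by apply: EVID; [exact: subgauss_EVI|apply: EVIZ; exact: subgauss_EVI].
rewrite EV_sum; last by move=> j _; apply: EVIZ; exact: EVID.
apply: eq_bigr => j _; rewrite EVZ; last exact: EVID.
rewrite EVD//.
rewrite EVD; [|exact: subgauss_EVI|by apply: EVIZ; exact: subgauss_EVI].
rewrite EVD; [|exact: subgauss_EVI|by apply: EVIZ; exact: subgauss_EVI].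
rewrite EVZ; last exact: subgauss_EVI.
rewrite EVZ; last exact: subgauss_EVI.
rewrite (EV_left z (p j) suf) EV_left// EV_right// EV_kernels//.
congr (_ * _).
by move: (cexp _) (u z) (f z) (cj _) (cj _) (smeared _ _ _ _ _) => a b k d e h; ring.
Qed.

End span.

(** The purely holomorphic and purely antiholomorphic terms are symmetric in the two operators and
    cancel. Testing on a single kernel isolates the identity at a given pair, since [cexp] has no
    zeros. *)
Lemma commutator_zeroP f g u v : tame f -> tame g -> tame u -> tame v ->
  zero_on_kernels (commutator (toeplitz (fun z => f z + cj (g z)))
                              (toeplitz (fun z => u z + cj (v z)))) <->
  forall z w, smeared 1 u g z w - smeared 1 f v z w = u z * cj (g w) - f z * cj (v w).
Proof.
move=> sf sg su sv.
have E m (c : 'I_m -> C) (p : 'I_m -> Cn) z :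
  commutator (toeplitz (fun z => f z + cj (g z))) (toeplitz (fun z => u z + cj (v z)))
    (fun w => \sum_j c j * cexp (hdot w (p j))) z =
  \sum_j c j * (cexp (hdot z (p j)) *
    ((smeared 1 u g z (p j) - smeared 1 f v z (p j)) -
     (u z * cj (g (p j)) - f z * cj (v (p j))))).
  rewrite /commutator (toeplitz_span c p su sv) (toeplitz_span c p sf sg).
  rewrite (toeplitz_span2 c p z su sv sf sg) (toeplitz_span2 c p z sf sg su sv).
  rewrite -sumrB; apply: eq_bigr => j _; rewrite -mulrBr -mulrBr; congr (_ * (_ * _)).
  move: (u z) (f z) (cj _) (cj _) (smeared _ _ _ _ _) (smeared _ _ _ _ _) => a b k d e h.
  by ring.
split=> [H z w|H F [m [c [p ->]]]].
  apply: subr0_eq.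
  have /(congr1 (fun h => h z)) := H (fun x => \sum_(j < 1) 1 * cexp (hdot x w))
    (ex_intro _ 1%N (ex_intro _ (fun=> 1) (ex_intro _ (fun=> w) erefl))).
  rewrite (E 1%N (fun=> 1) (fun=> w)) big_ord1 mul1r => /eqP.
  by rewrite mulf_eq0 (negbTE (cexp_neq0 _)) => /eqP.
apply/funext => z; rewrite (E m c p) big1// => j _.
by rewrite H subrr !mulr0.
Qed.

Lemma berezinE f g u v z : tame f -> tame g -> tame u -> tame v ->
  berezin (fun z => u z * cj (g z) - f z * cj (v z)) z =
  smeared 1 u g z z - smeared 1 f v z z.
Proof.
move=> sf sg su sv; rewrite /berezin mu_integralE.
(* The square root disappears in the squared modulus, leaving the two exponentials that [EV_kernels]
   absorbs at [p = z]. *)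
have nk w : `|nkernel w z| ^+ 2 =
    (cexp (hdot z z))^-1 * (cexp (hdot w z) * cexp (hdot z w)).
  rewrite /nkernel normrM exprMn normrV ?unitfE ?sqrtC_eq0 ?cexp_neq0//.
  rewrite mulrC exprVn -normrX sqrtCK; congr (_ * _).
    rewrite -[rkernel z z]/(cexp (hdot z z)) hdot_sq cexp_real normcC normcRe.
    by rewrite gtr0_norm// expR_gt0.
  by rewrite normcC -realcX -mulc_conj -[rkernel w z]/(cexp (hdot w z)) cj_cexp_hdot.
have gr a b : tame a -> tame b ->
    subgauss (fun w => a w * cj (b w) * cexp (hdot w z) * cexp (hdot z w)).
  move=> sa sb; apply: subgaussM; last exact: subgauss_cexp_hdot.
  apply: subgaussM; last exact/tame_subgauss/tame_hdot.
  by apply: subgaussM; [exact: tame_subgauss|exact/subgauss_cj/tame_subgauss].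
transitivity (EV (fun w => (cexp (hdot z z))^-1 *
   (u w * cj (g w) * cexp (hdot w z) * cexp (hdot z w) -
    f w * cj (v w) * cexp (hdot w z) * cexp (hdot z w)))).
  apply: eq_EV => w; rewrite nk.
  by move: (u w) (cj _) (f w) (cj _) (cexp _) (cexp _) (_^-1) => a b k d e h l; ring.
rewrite EVZ; last by apply: EVIB; apply/subgauss_EVI/gr.
rewrite EVB; [|by apply/subgauss_EVI/gr..].
rewrite EV_kernels// EV_kernels// -mulrBr mulrA mulVf ?mul1r//.
exact: cexp_neq0.
Qed.

End smeared_identities.

(** * From differentiability to complex derivatives along lines *)

Section entire_functions.
Variable R : realType.
Local Notation C := R[i].

Lemma gt0_complex (e : C) : 0 < e -> exists2 r : R, 0 < r & e = r%:C.
Proof.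
case: e => a b; rewrite ltcE /= => /andP[/eqP b0 a0]; exists a => //.
by rewrite b0.
Qed.

Lemma cvg_dnbhs0P (phi : C -> C) (l : C) :
  (phi h @[h --> 0^'] --> l) <->
  (forall e : R, 0 < e -> exists2 d : R, 0 < d &
     forall h, h != 0 -> normc h < d -> normc (phi h - l) <= e).
Proof.
split=> [/cvgrPdist_le cv e e0|H].
  have := cv e%:C; rewrite ltcR => /(_ e0)/nbhs_ballP[d' /= /gt0_complex[d d0 ->] hd].
  exists d => // h h0 hlt.
  have := hd h; rewrite /ball/= sub0r normrN normcC ltcR => /(_ hlt h0).
  by rewrite distrC normcC lecR.
apply/cvgrPdist_le => e' /gt0_complex[e e0 ->].
have [d d0 hd] := H e e0.
apply/nbhs_ballP; exists d%:C; first by rewrite /= ltcR.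
move=> h; rewrite /ball/= sub0r normrN normcC ltcR => hlt h0.
by rewrite distrC normcC lecR; exact: hd.
Qed.

Lemma entire_line_holo n (f : 'rV[C]_n -> C) : entire f -> line_holo f.
Proof.
move=> ef p q l; pose z := p + l *: q.
have /diff_derivable := ef z => /(_ q) df.
exists ('D_q f z) => e e0.
have /cvg_dnbhs0P/(_ e e0)[d d0 hd] := df.
exists d => // w wd; have [->|w0] := eqVneq w 0.
  by rewrite !addr0 subrr mulr0 subr0 normc0 mulr0.
have := hd w w0 wd; rewrite -[_ *: _]/(w^-1 * (f (w *: q + z) - f z)).
have -> : f (p + (l + w) *: q) - f z - 'D_q f z * w =
    w * (w^-1 * (f (w *: q + z) - f z) - 'D_q f z).
  rewrite mulrBr mulVKf// (mulrC w) /z scalerDl addrA; congr (f _ - _ - _).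
  by rewrite addrC.
by move=> h; rewrite normcM mulrC; apply: ler_wpM2r; [exact: normc_ge0|exact: h].
Qed.

Lemma derive_eps n (f : 'rV[C]_n -> C) (z q : 'rV[C]_n) (l : C) :
  (forall e : R, 0 < e -> exists2 d : R, 0 < d &
     forall h, h != 0 -> normc h < d ->
       normc (h^-1 * (f (z + h *: q) - f z) - l) <= e) ->
  'D_q f z = l.
Proof.
move=> H; apply: (@cvg_lim C); first exact: norm_hausdorff.
apply/cvg_dnbhs0P => e /H[d d0 hd]; exists d => // h h0 hl.
by have := hd h h0 hl; rewrite (addrC z).
Qed.

End entire_functions.

(** * Derivatives under the integral *)

Section derivatives.
Variables (R : realType) (n : nat).
Local Notation C := R[i].
Local Notation Cn := 'rV[C]_n.
Implicit Types (u V : Cn -> C) (z y : Cn).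

Lemma hdot_delta (k : 'I_n) y : hdot (delta_mx 0 k) y = cj (y 0 k).
Proof.
rewrite /hdot /dot (bigD1 k)//= big1 ?addr0.
  by rewrite !mxE !eqxx mul1r.
by move=> j jk; rewrite !mxE (negbTE jk) andbF mul0r.
Qed.

Lemma absdot_delta (k : 'I_n) y : absdot (delta_mx 0 k) y = normc (y 0 k).
Proof.
rewrite /absdot (bigD1 k)//= big1 ?addr0.
  by rewrite mxE !eqxx normc1 mul1r.
by move=> j jk; rewrite mxE (negbTE jk) andbF normc0 mul0r.
Qed.

(** Second-order Taylor remainder divided by [h]. The condition on [h] reduces the exponential in
    the remainder bound to [expR (normc a)], and half the square of [normc a] is at most another
    such factor. *)
Lemma cexp_diff_quotient (h a : C) : h != 0 -> normc h < 1 ->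
  normc (h^-1 * (cexp (h * a) - 1) - a) <= normc h * expR (2 * normc a).
Proof.
move=> h0 h1; have nh : 0 < normc h.
  rewrite lt_neqAle normc_ge0 andbT eq_sym; apply: contra h0 => /eqP/eq0_normc -> //.
have -> : h^-1 * (cexp (h * a) - 1) - a = h^-1 * (cexp (h * a) - taylor_exp 2 (h * a)).
  rewrite /taylor_exp !big_ord_recr big_ord0/= expr0 expr1 !divr1 add0r.
  move: (cexp _) => c; field; exact: h0.
rewrite normcM normcV mulrC ler_pdivrMr//.
apply: le_trans (taylor_exp_bound 2 (h * a)) _; rewrite normcM.
have na := normc_ge0 a; set t := normc a in na *; set s := normc h in nh h1 *.
have e2 := pow_fact_le 2 na.
have -> : s * expR (2 * t) * s = s ^+ 2 * (expR t * expR t).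
  by rewrite -expRD mulr_natl mulr2n; move: (expR _) => e; ring.
have -> : (s * t) ^+ 2 / 2`!%:R = s ^+ 2 * (t ^+ 2 / 2`!%:R) by rewrite exprMn mulrA.
rewrite -mulrA; apply: ler_wpM2l; first by rewrite exprn_ge0// ltW.
apply: ler_pM; [|exact: expR_ge0|exact: e2|].
  by rewrite divr_ge0// exprn_ge0.
by rewrite ler_expR ler_piMl// ltW.
Qed.

Lemma subgauss_hdot V z : subgauss V -> subgauss (fun y => V y * cexp (hdot z y)).
Proof. by move=> gV; apply: subgaussM => //; exact: subgauss_cexp_hdot. Qed.

(** The error of the difference quotient is the integral of a function bounded by the modulus of [h]
    times a growth bound independent of [h], so it tends to 0 linearly. *)
Lemma partial_EV V (k : 'I_n) : subgauss V ->
  partial k (fun z => EV (fun y => V y * cexp (hdot z y))) =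
  (fun z => EV (fun y => V y * cj (y 0 k) * cexp (hdot z y))).
Proof.
move=> gV; apply/funext => z; apply: derive_eps => e e0.
have gW : subgauss (fun y => V y * cexp (hdot z y) *
    (expR (2 * absdot (delta_mx 0 k) y))%:C).
  by apply: subgaussM; [exact: subgauss_hdot|exact: subgauss_absexp].
have h2 : 2^-1 < 1 :> R by rewrite invf_lt1// ltr1n.
have [_ /(_ 2^-1 (_ : 0 < _))[|M M0 hM]] := gW; first by rewrite invr_gt0.
pose D := M * (1 - 2^-1)^-1 ^+ n.
have D0 : 0 <= D by rewrite mulr_ge0// exprn_ge0// invr_ge0 subr_ge0 ltW.
have D1 : 0 < D + 1 by rewrite ltr_wpDl.
exists (Num.min 1 (e / (D + 1))); first by rewrite lt_min ltr01 divr_gt0.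
move=> h h0; rewrite lt_min => /andP[h1 he].
have nh := normc_ge0 h.
have gk : subgauss (fun y => V y * cj (y 0 k) * cexp (hdot z y)).
  by apply: subgauss_hdot; apply: subgaussM => //; exact: subgauss_cj_coord.
have E : h^-1 * (EV (fun y => V y * cexp (hdot (z + h *: delta_mx 0 k) y)) -
     EV (fun y => V y * cexp (hdot z y))) -
     EV (fun y => V y * cj (y 0 k) * cexp (hdot z y)) =
  EV (fun y => V y * cexp (hdot z y) *
    (h^-1 * (cexp (h * cj (y 0 k)) - 1) - cj (y 0 k))).
  have i1 := subgauss_EVI (subgauss_hdot (z + h *: delta_mx 0 k) gV).
  have i2 := subgauss_EVI (subgauss_hdot z gV).
  rewrite -EVB// -EVZ; last exact: EVIB.
  rewrite -EVB; [|by apply: EVIZ; exact: EVIB|exact: subgauss_EVI].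
  apply: eq_EV => y; rewrite hdotDl hdotZl hdot_delta cexpD.
  by move: (cexp (hdot z y)) (cexp (h * cj (y 0 k))) (V y) (cj (y 0 k)) (h^-1) => a b c d l; ring.
rewrite E.
have hb y : normc (V y * cexp (hdot z y) *
    (h^-1 * (cexp (h * cj (y 0 k)) - 1) - cj (y 0 k))) <=
    (normc h * M) * expR (2^-1 * sq y).
  have b1 := hM y; have b2 := cexp_diff_quotient (cj (y 0 k)) h0 h1.
  rewrite normcM normcRe gtr0_norm ?expR_gt0// absdot_delta in b1.
  rewrite normc_conj in b2.
  rewrite normcM; apply: le_trans (ler_wpM2l (normc_ge0 _) b2) _.
  by rewrite mulrCA -mulrA; apply: ler_wpM2l.
have mb : measurable_fun setT (fun y => V y * cexp (hdot z y) *
    (h^-1 * (cexp (h * cj (y 0 k)) - 1) - cj (y 0 k))).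
  apply: cmeasM; first by have [] := subgauss_hdot z gV.
  have mk : measurable_fun setT (fun y : Cn => cj (y 0 k)) by have [] := subgauss_cj_coord R k.
  apply: cmeasB => //; apply: cmeasM; first exact: measurable_cst.
  apply: cmeasB; last exact: measurable_cst.
  by apply: cmeas_exp; apply: cmeasM => //; exact: measurable_cst.
apply: le_trans (normc_EV_le (EVI_growth mb h2 hb) h2 hb) _.
rewrite -mulrA -/D; move: he; rewrite ltr_pdivlMr// => /ltW; apply: le_trans.
by apply: ler_wpM2l => //; rewrite lerDl.
Qed.

Lemma subgaussX V m : subgauss V -> subgauss (fun y => V y ^+ m).
Proof.
move=> gV; elim: m => [|m ih]; first by under eq_fun do rewrite expr0; exact: subgauss_cst.
by under eq_fun do rewrite exprS; exact: subgaussM.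
Qed.

Lemma subgauss_prod (I : Type) (r : seq I) (F : I -> Cn -> C) :
  (forall i, subgauss (F i)) -> subgauss (fun z => \prod_(i <- r) F i z).
Proof.
move=> gF; elim: r => [|i r ih].
  by under eq_fun do rewrite big_nil; exact: subgauss_cst.
by under eq_fun do rewrite big_cons; exact: subgaussM.
Qed.

Lemma iter_partial_EV V (k : 'I_n) m : subgauss V ->
  iter m (partial k) (fun z => EV (fun y => V y * cexp (hdot z y))) =
  (fun z => EV (fun y => V y * cj (y 0 k) ^+ m * cexp (hdot z y))).
Proof.
move=> gV; elim: m => [|m ih].
  by apply/funext => z; apply: eq_EV => y; rewrite expr0 mulr1.
rewrite iterS ih partial_EV; last first.
  by apply: subgaussM => //; apply: subgaussX; exact: subgauss_cj_coord.
by apply/funext => z; apply: eq_EV => y; rewrite exprSr mulrA.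
Qed.

Lemma mpartial_EV V (j : 'I_n -> nat) : subgauss V ->
  mpartial j (fun z => EV (fun y => V y * cexp (hdot z y))) =
  (fun z => EV (fun y => V y * (\prod_k cj (y 0 k) ^+ j k) * cexp (hdot z y))).
Proof.
move=> gV; rewrite /mpartial.
transitivity (fun z => EV (fun y =>
    V y * (\prod_(k <- enum 'I_n) cj (y 0 k) ^+ j k) * cexp (hdot z y))).
  elim: (enum 'I_n) => [|k s ih] /=.
    by apply/funext => z; apply: eq_EV => y; rewrite big_nil mulr1.
  rewrite ih iter_partial_EV; last first.
    by apply: subgaussM => //; apply: subgauss_prod => i; apply: subgaussX; exact: subgauss_cj_coord.
  apply/funext => z; apply: eq_EV => y; rewrite big_cons.
  by move: (\prod_(_ <- _) _) (V y) (_ ^+ _) (cexp _) => a b c d; ring.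
by apply/funext => z; apply: eq_EV => y; rewrite big_enum.
Qed.

Lemma subgauss_mexp (i : 'I_n -> nat) z : subgauss (fun y => \prod_k (cj (z 0 k) - cj (y 0 k)) ^+ i k).
Proof.
apply: subgauss_prod => k; apply: subgaussX; apply: subgaussB; first exact: subgauss_cst.
exact: subgauss_cj_coord.
Qed.

Lemma multibinomial (i : {ffun 'I_n -> nat}) (a b : 'I_n -> C) :
  \prod_k (a k - b k) ^+ i k =
  \sum_(l : {ffun 'I_n -> 'I_(\sum_k i k).+1} | [forall k, (l k <= i k)%N])
    (\prod_k 'C(i k, l k))%:R * (-1) ^+ (\sum_k (i k - l k))%N *
    (\prod_k a k ^+ l k) * (\prod_k b k ^+ (i k - l k)%N).
Proof.
set B := (\sum_k i k)%N.
have iB k : (i k <= B)%N by rewrite /B (bigD1 k)//= leq_addr.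
(* All exponents share the bound [B], with zero terms above [i k], so that the product of sums can
   be distributed over functions [l]. *)
pose T k (m : 'I_B.+1) : C := if (m <= i k)%N then
   'C(i k, m)%:R * (-1) ^+ (i k - m)%N * a k ^+ m * b k ^+ (i k - m)%N else 0.
have ET k : (a k - b k) ^+ i k = \sum_m T k m.
  rewrite addrC exprDn (big_ord_widen B.+1 (fun m => (- b k) ^+ (i k - m) * a k ^+ m *+ 'C(i k, m)))//; last by rewrite ltnS.
  rewrite big_mkcond; apply: eq_bigr => m _; rewrite /T ltnS; case: ifP => // _.
  by rewrite (exprNn (b k)) -mulr_natl; move: ('C(_, _)%:R) (_ ^+ _) (_ ^+ _) (_ ^+ _) => x y z w; ring.
under eq_bigr do rewrite ET.
rewrite bigA_distr_bigA [RHS]big_mkcond; apply: eq_bigr => l _.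
case: ifPn => [/forallP lle|].
  under eq_bigr do rewrite /T lle.
  by rewrite !big_split/= -!natr_prod expr_sum.
rewrite negb_forall => /existsP[k /negbTE kl].
by rewrite (bigD1 k)//= /T kl mul0r.
Qed.

Lemma shift_partialE u (i : mindex n) z : tame u ->
  shift_partial i u z =
  EV (fun y => u y * (\prod_k (cj (z 0 k) - cj (y 0 k)) ^+ i k) * cexp (hdot z y)).
Proof.
move=> su; have gu := tame_subgauss su.
have uE : u = (fun z => EV (fun y => u y * cexp (hdot z y))).
  by apply/funext => w; rewrite EV_reproducing.
have gm (j : 'I_n -> nat) : subgauss (fun y => u y * (\prod_k cj (y 0 k) ^+ j k) * cexp (hdot z y)).
  apply: subgauss_hdot; apply: subgaussM => //; apply: subgauss_prod => k; apply: subgaussX; exact: subgauss_cj_coord.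
transitivity (EV (fun y => \sum_(l : {ffun 'I_n -> 'I_(\sum_k i k).+1} |
    [forall k, (l k <= i k)%N])
    ((\prod_k 'C(i k, l k))%:R * (-1) ^+ (\sum_k (i k - l k))%N *
    (\prod_k cj (z 0 k) ^+ l k)) *
     (u y * (\prod_k cj (y 0 k) ^+ (i k - l k)%N) * cexp (hdot z y)))).
  rewrite EV_sum; last by move=> l _; apply: EVIZ; exact: subgauss_EVI.
  apply: eq_bigr => l _; rewrite EVZ; last exact: subgauss_EVI.
  rewrite {1}uE mpartial_EV//; congr (_ * _ * _).
  by apply: eq_bigr => k _; rewrite mxE.
apply: eq_EV => y; rewrite (multibinomial i (fun k => cj (z 0 k)) (fun k => cj (y 0 k))).
rewrite mulr_sumr mulr_suml; apply: eq_bigr => l _.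
by move: (_%:R) (_ ^+ _) (\prod_k _) (\prod_k _) (u y) (cexp _) => a b c d e f; ring.
Qed.

End derivatives.

(** * Power series *)

Section index_boxes.
Variables (R : realType) (n : nat).
Local Notation C := R[i].
Local Notation ind := (mindex n).
Local Open Scope fset_scope.
Local Open Scope ring_scope.
Implicit Types (x : ind -> C) (J : {fset ind}).

Definition weight (i : ind) : nat := (\sum_k i k)%N.

Definition box_index N (l : {ffun 'I_n -> 'I_N}) : ind := [ffun k => val (l k)].

(** Cubes are cofinal among the finite index sets and, being products, turn sums of products into
    products of sums. *)
Definition box N : {fset ind} :=
  [fset box_index l | l in {: {ffun 'I_n -> 'I_N}}].

Lemma mem_box N (i : ind) : (i \in box N) = [forall k, (i k < N)%N].
Proof.
apply/imfsetP/forallP => [[l _ ->] k|iN]; first by rewrite ffunE ltn_ord.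
exists [ffun k => Ordinal (iN k)] => //.
by apply/ffunP => k; rewrite !ffunE.
Qed.

Lemma sum_box (S : comPzSemiRingType) N (F : 'I_n -> nat -> S) :
  \sum_(i <- box N) \prod_k F k (i k) = \prod_k \sum_(m < N) F k m.
Proof.
rewrite bigA_distr_bigA /box big_imfset /=; last first.
  move=> l m _ _ /ffunP e; apply/ffunP => k; apply/val_inj.
  by have := e k; rewrite !ffunE.
rewrite big_enum; apply: eq_bigr => l _.
by apply: eq_bigr => k _; rewrite ffunE.
Qed.

Lemma sub_box J : exists N0, forall N, (N0 <= N)%N -> J `<=` box N.
Proof.
exists (\sum_(i : J) weight (val i)).+1 => N hN; apply/fsubsetP => i iJ.
rewrite mem_box; apply/forallP => k; apply: leq_trans hN; rewrite ltnS.
rewrite (bigD1 [` iJ])//= (leq_trans _ (leq_addr _ _))//.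
by rewrite /weight (bigD1 k)//= leq_addr.
Qed.

Lemma weight_notin_box K (i : ind) : i \notin box K -> (K <= weight i)%N.
Proof.
rewrite mem_box negb_forall => /existsP[k]; rewrite -leqNgt => /leq_trans; apply.
by rewrite /weight (bigD1 k)//= leq_addr.
Qed.

Lemma fset_sumB J J' x : J `<=` J' ->
  \sum_(i <- J') x i - \sum_(i <- J) x i = \sum_(i <- J' `\` J) x i.
Proof.
move=> JJ'; rewrite (big_fsetID _ (fun i => i \in J) J') /=.
have -> : [fset i in J' | i \in J] = J.
  apply/fsetP => i; rewrite !inE /= andb_idl//; exact: (fsubsetP JJ').
have -> : [fset i in J' | i \notin J] = J' `\` J.
  by apply/fsetP => i; rewrite !inE /= andbC.
by rewrite addrAC subrr add0r.
Qed.

Lemma partial_sumE x J : summability.partial_sum x J = \sum_(i <- J) x i.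
Proof. by rewrite [RHS]big_seq_fsetE. Qed.

(* Convergence at a geometric rate once the index set contains [box K]; it
   implies convergence along [summability.totally] and is uniform enough to be
   integrated term by term. *)
Definition box_cvg x (L : C) (D : R) := forall K J, box K `<=` J ->
  normc (L - \sum_(i <- J) x i) <= D / 2 ^+ K.

(** An index outside [box K] has weight at least [K]; as the sums weighted by [2 ^+ weight i] stay
    below [T], the indices outside [J] contribute at most [T / 2 ^+ K]. *)
Lemma box_tail x (L : C) (T : R) :
  (forall e : R, 0 < e -> exists N0, forall N, (N0 <= N)%N ->
     normc (L - \sum_(i <- box N) x i) <= e) ->
  (forall N, \sum_(i <- box N) normc (x i) * 2 ^+ weight i <= T) ->
  box_cvg x L T.
Proof.
move=> xL xT K J KJ; apply/ler_addgt0Pr => e e0.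
have [N1 hN1] := xL e e0; have [N2 hN2] := sub_box J.
pose N := maxn N1 N2; have JN : J `<=` box N by rewrite hN2// leq_maxr.
rewrite (_ : L - _ = (\sum_(i <- box N) x i - \sum_(i <- J) x i) +
    (L - \sum_(i <- box N) x i)); last by rewrite [RHS]addrC addrA subrK.
apply: le_trans (normcD _ _) _; apply: lerD; last by rewrite hN1// leq_maxl.
rewrite fset_sumB//; apply: le_trans (normc_sum _ _ _) _.
rewrite ler_pdivlMr ?exprn_gt0// mulr_suml.
apply: le_trans (xT N); rewrite -subr_ge0.
apply: (@le_trans _ _ (\sum_(i <- box N `\` J) normc (x i) * 2 ^+ weight i -
    \sum_(i <- box N `\` J) normc (x i) * 2 ^+ K)).
  rewrite -sumrB big_seq sumr_ge0// => i; rewrite inE => /andP[iJ _].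
  rewrite -mulrBr mulr_ge0 ?normc_ge0// subr_ge0 ler_weXn2l ?ler1n//.
  by apply: weight_notin_box; apply: contra iJ; exact: (fsubsetP KJ).
rewrite lerD2r [leRHS](big_fsetID _ (fun i => i \notin J))/=.
have -> : [fset i in box N | i \notin J] = box N `\` J.
  by apply/fsetP => i; rewrite !inE andbC.
rewrite lerDl big_seq sumr_ge0// => i _.
by rewrite mulr_ge0 ?normc_ge0// exprn_ge0.
Qed.

Lemma box_cvg_partial_sum x (L : C) D : box_cvg x L D ->
  summability.partial_sum x @ summability.totally --> L.
Proof.
move=> xL; have tF := @summability.totally_filter ind.
apply/cvgrPdist_le => e' /gt0_complex[e e0 ->].
have [K hK] : exists K, D / 2 ^+ K <= e.
  exists (Num.bound `|D / e|); rewrite ler_pdivrMr ?exprn_gt0// mulrC -ler_pdivrMr//.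
  apply: le_trans (ler_norm _) _; apply: le_trans (ltW (archi_boundP (normr_ge0 _))) _.
  by rewrite -natrX ler_nat ltnW// ltn_expl.
exists (box K) => // J /= KJ; by rewrite partial_sumE normcC lecR (le_trans _ hK)// xL.
Qed.

End index_boxes.

(** * The exponential series in several variables *)

Section exponential_series.
Variables (R : realType) (n : nat).
Local Notation C := R[i].

Lemma cvg_taylor_exp (a : C) (e : R) : 0 < e ->
  exists N0, forall N, (N0 <= N)%N -> normc (cexp a - taylor_exp N a) <= e.
Proof.
move=> e0; have := @cvg_exp_coeff R (normc a).
move=> /cvgrPdist_le/(_ (e / expR (normc a))).
rewrite divr_gt0 ?expR_gt0// => /(_ isT)[N0 _ hN]; exists N0 => N NN0.
have := hN N NN0; rewrite /= sub0r normrN ler_pdivlMr ?expR_gt0// => h.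
rewrite (le_trans (taylor_exp_bound N a))// (le_trans _ h)//.
by rewrite ler_wpM2r ?expR_ge0// ler_norm.
Qed.

Lemma cvg_prod_taylor_exp (I : Type) (r : seq I) (a : I -> C) (e : R) : 0 < e ->
  exists N0, forall N, (N0 <= N)%N ->
    normc (\prod_(i <- r) cexp (a i) - \prod_(i <- r) taylor_exp N (a i)) <= e.
Proof.
elim: r e => [|i r ih] e e0.
  by exists 0%N => N _; rewrite !big_nil subrr normc0 ltW.
set P := \prod_(i <- r) cexp (a i) in ih.
have P1 : 0 < normc P + 1 by rewrite ltr_wpDl// normc_ge0.
have [N1 h1] := @cvg_taylor_exp (a i) (e / 2 / (normc P + 1)) (divr_gt0 (divr_gt0 e0 (ltr0Sn _ 1)) P1).
have [N2 h2] := ih (e / 2 / expR (normc (a i))) (divr_gt0 (divr_gt0 e0 (ltr0Sn _ 1)) (expR_gt0 _)).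
exists (maxn N1 N2) => N; rewrite geq_max => /andP[/h1 {}h1 /h2 {}h2].
rewrite !big_cons -/P; move: h1 h2 (normc_taylor_exp_le N (a i)).
move: (\prod_(_ <- _) _) (taylor_exp _ _) (cexp _) => Q t c h1 h2 h3.
have -> : c * P - t * Q = (c - t) * P + t * (P - Q) by ring.
apply: le_trans (normcD _ _) _; rewrite !normcM [leRHS]splitr lerD//.
  apply: le_trans (_ : _ <= normc (c - t) * (normc P + 1)) _.
    by rewrite ler_wpM2l ?normc_ge0// lerDl.
  by rewrite -ler_pdivlMr.
rewrite mulrC; apply: le_trans (_ : _ <= normc (P - Q) * expR (normc (a i))) _.
  by rewrite ler_wpM2l ?normc_ge0.
by rewrite -ler_pdivlMr ?expR_gt0.
Qed.

Lemma taylor_exp_real_le N (t : R) : 0 <= t ->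
  \sum_(m < N) t ^+ m / m`!%:R <= expR t.
Proof.
move=> t0; have := normc_taylor_exp_le N t%:C.
have -> : taylor_exp N t%:C = (\sum_(m < N) t ^+ m / m`!%:R)%:C.
  rewrite realc_sum; apply: eq_bigr => m _.
  by rewrite realcM realcV realcX realc_nat.
by rewrite !normcRe (ger0_norm t0); apply: le_trans; rewrite ler_norm.
Qed.

(** The factor [2 ^+ weight i] doubles every [a k], so the weighted sum over a cube is a product of
    exponential partial sums at [2 * normc (a k)]. *)
Lemma prod_exp_box (a : 'I_n -> C) :
  box_cvg (fun i : mindex n => \prod_k (a k ^+ i k / (i k)`!%:R))
    (\prod_k cexp (a k)) (\prod_k expR (2 * normc (a k))).
Proof.
apply: box_tail.
  move=> e e0; have [N0 hN] := cvg_prod_taylor_exp (index_enum 'I_n) a e0.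
  by exists N0 => N NN0; rewrite (sum_box _ (fun k m => a k ^+ m / m`!%:R)) hN.
move=> N; rewrite (eq_bigr (fun i : mindex n =>
    \prod_k ((2 * normc (a k)) ^+ i k / (i k)`!%:R))); last first.
  move=> i _; rewrite normc_prod /weight expr_sum -big_split/=; apply: eq_bigr => k _.
  rewrite normcM normcX normcV exprMn -(realc_nat R) normcRe ger0_norm//.
  by move: (_ ^+ _) (_ ^+ _) (_^-1) => x y z; ring.
rewrite (sum_box _ (fun k m => (2 * normc (a k)) ^+ m / m`!%:R)).
apply: ler_prod => k _; rewrite sumr_ge0/=; last first.
  by move=> m _; rewrite divr_ge0// exprn_ge0// mulr_ge0// normc_ge0.
by rewrite taylor_exp_real_le// mulr_ge0// normc_ge0.
Qed.

End exponential_series.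

Section expansion.
Variables (R : realType) (n : nat).
Local Notation C := R[i].
Local Notation Cn := 'rV[C]_n.
Implicit Types (g : Cn -> C) (w : Cn).

Lemma hdotE w (y : Cn) : hdot w y = \sum_k w 0 k * cj (y 0 k).
Proof. by apply: eq_bigr => k _; rewrite mxE. Qed.

(** The coefficients come from expanding the kernel in the reproducing formula of [g]; the geometric
    rate of [prod_exp_box] survives integration. *)
Lemma tame_expansion g : tame g ->
  exists (b : mindex n -> C) (M : R), 0 <= M /\
    forall w, box_cvg (fun i => b i * monom w i) (g w) (M * expR (4 * sq w)).
Proof.
move=> sg; have gg := tame_subgauss sg.
have [_ /(_ (1 / 4))[|M1 M10 hM1]] := gg; first by rewrite divr_gt0.
pose P (i : mindex n) (y : Cn) := \prod_k (cj (y 0 k) ^+ i k / (i k)`!%:R).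
have gP i : subgauss (P i).
  apply: subgauss_prod => k; apply: subgaussM; last exact: subgauss_cst.
  by apply: subgaussX; exact: subgauss_cj_coord.
have h12 : 1 / 2 < 1 :> R by lra.
exists (fun i => EV (fun y => g y * P i y)), (M1 * (1 - 1 / 2)^-1 ^+ n); split.
  by rewrite mulr_ge0// exprn_ge0// invr_ge0; lra.
move=> w K J KJ.
have e1 : EVI (fun y => g y * cexp (hdot w y)) by apply: subgauss_EVI; exact: subgauss_hdot.
have e2 i : EVI (fun y => g y * P i y * monom w i).
  by apply: subgauss_EVI; apply: subgaussM; [exact: subgaussM|exact: subgauss_cst].
have e3 : EVI (fun y => \sum_(i <- J) g y * P i y * monom w i).
  by apply: EVI_sum => i _; exact: e2.
have -> : \sum_(i <- J) EV (fun y => g y * P i y) * monom w i =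
    EV (fun y => \sum_(i <- J) g y * P i y * monom w i).
  rewrite EV_sum; last by move=> i _; exact: e2.
  by apply: eq_bigr => i _; rewrite EVZr//; apply: subgauss_EVI; exact: subgaussM.
rewrite -(EV_reproducing w sg) -EVB//.
pose T (y : Cn) := \prod_k cexp (w 0 k * cj (y 0 k)) -
  \sum_(i <- J) \prod_k ((w 0 k * cj (y 0 k)) ^+ i k / (i k)`!%:R).
have ET y : g y * cexp (hdot w y) - \sum_(i <- J) g y * P i y * monom w i = g y * T y.
  rewrite /T mulrBr hdotE cexp_sum; congr (_ - _).
  rewrite mulr_sumr; apply: eq_bigr => i _; rewrite -mulrA; congr (_ * _).
  rewrite /P /monom -big_split/=; apply: eq_bigr => k _.
  by rewrite exprMn mulrC mulrA.
have bT y : normc (g y * T y) <= (M1 * expR (4 * sq w) / 2 ^+ K) * expR (1 / 2 * sq y).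
  have bx := prod_exp_box (fun k => w 0 k * cj (y 0 k)) KJ.
  have ea : \prod_k expR (2 * normc (w 0 k * cj (y 0 k))) <=
      expR (4 * sq w) * expR (1 / 4 * sq y).
    rewrite -expR_sum -expRD ler_expR -mulr_sumr.
    (* AM-GM with [s = 2]: twice [absdot w y] is at most [4 * sq w + 1 / 4 * sq y], the source of
       the constant 4. *)
    have := absdot_young w y (ltr0Sn _ 1 : 0 < 2%:R :> R).
    under eq_bigr do rewrite normcM normc_conj.
    by rewrite -/(absdot w y) => h; lra.
  rewrite normcM; apply: le_trans (ler_pM (normc_ge0 _) (normc_ge0 _) (hM1 y) bx) _.
  have -> : expR (1 / 2 * sq y) = expR (1 / 4 * sq y) * expR (1 / 4 * sq y).
    by rewrite -expRD; congr expR; lra.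
  move: ea (expR_gt0 (1 / 4 * sq y)); move: (expR (1 / 4 * sq y)) => x.
  move: (expR (4 * sq w)) (\prod_k _) => X Y YX x0.
  have -> : M1 * X / 2 ^+ K * (x * x) = M1 * x * (X * x / 2 ^+ K).
    by move: ((2 ^+ K)^-1) => q; ring.
  apply: ler_wpM2l; first by rewrite mulr_ge0// ltW.
  by rewrite ler_wpM2r// invr_ge0 exprn_ge0.
rewrite (eq_EV ET); apply: le_trans (normc_EV_le _ h12 bT) _.
  by move: (EVIB e1 e3); congr EVI; apply/funext => y; exact: ET.
rewrite le_eqVlt; apply/orP; left; apply/eqP.
by move: (expR _) (_ ^+ n) ((2 ^+ K)^-1) => x y z; ring.
Qed.

Lemma monomZ (c : C) w (i : mindex n) : monom (c *: w) i = c ^+ weight i * monom w i.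
Proof.
rewrite /monom /weight expr_sum -big_split/=; apply: eq_bigr => k _.
by rewrite mxE exprMn.
Qed.

(* Applying [tame_expansion] to the dilation [g (s z)] replaces the
   exponent [4] by [4 / s^2]. *)
Lemma tame_expansion_small g (c : R) : tame g -> 0 < c ->
  exists (b : mindex n -> C) (M : R), 0 <= M /\
    forall w, box_cvg (fun i => b i * monom w i) (g w) (M * expR (c * sq w)).
Proof.
move=> sg c0; pose s : R := Num.sqrt (4 / c).
have s2 : s ^+ 2 = 4 / c by rewrite sqr_sqrtr// divr_ge0// ltW.
have s0 : 0 < s by rewrite sqrtr_gt0 divr_gt0.
have sC : s%:C != 0 :> C by rewrite -[0]/(0%:C) (inj_eq (@complexI R)) gt_eqF.
have [b [M [M0 hb]]] := tame_expansion (tame_affine s%:C 0 sg).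
exists (fun i => b i * (s^-1)%:C ^+ weight i), M; split=> // w K J KJ.
have := hb ((s^-1)%:C *: w) K J KJ.
rewrite add0r scalerA -realcM divff ?gt_eqF// scale1r.
under eq_bigr do rewrite monomZ mulrA.
have -> // : 4 * sq ((s^-1)%:C *: w) = c * sq w.
rewrite sqZ normcRe ger0_norm ?invr_ge0 ?ltW// exprVn s2 invf_div.
by rewrite mulrA (mulrC 4) divfK// pnatr_eq0.
Qed.

End expansion.

(** * Uniqueness of power series coefficients *)

Section uniqueness.
Variables (R : realType) (n : nat).
Local Notation C := R[i].
Local Notation Cn := 'rV[C]_n.
Local Notation ind := (mindex n).
Local Open Scope fset_scope.
Local Open Scope ring_scope.
Implicit Types (d x : ind -> C) (J : {fset ind}).

(** ['X^N - 1] splits and is separable, so it has [N] distinct roots, and that many [N]-th roots of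
    unity include a primitive one. *)
Lemma prim_root_exists N : (0 < N)%N -> exists z : C, N.-primitive_root z.
Proof.
pose p : {poly C} := 'X^N - 1; have [r Dp] := closed_field_poly_normal p.
move=> N0; rewrite (monicP _) ?monicXnsubC // scale1r in Dp.
have rn1 : all N.-unity_root r by apply/allP=> z; rewrite -root_prod_XsubC -Dp.
have sz_r : (N < (size r).+1)%N by rewrite -(size_prod_XsubC r id) -Dp size_XnsubC.
have [|z] := hasP (cyclic.has_prim_root N0 rn1 _ sz_r); last by exists z.
by rewrite -separable.separable_prod_XsubC -Dp cyclotomic.separable_Xn_sub_1 // pnatr_eq0 -lt0n.
Qed.

Lemma root_sum N (z : C) (i j : nat) : N.-primitive_root z -> (i < N)%N -> (j < N)%N ->
  \sum_(m < N) (z ^+ m) ^+ i * ((z ^+ m) ^+ j)^-1 = (i == j)%:R * N%:R.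
Proof.
move=> zN iN jN; have z0 : z != 0.
  by rewrite (prim_root_eq0 zN) -lt0n (leq_ltn_trans _ iN).
pose q := z ^+ i / z ^+ j.
rewrite (eq_bigr (fun m : 'I_N => q ^+ m)); last first.
  by move=> m _; rewrite /q expr_div_n -!exprM !(mulnC m).
have [ij|ij] := eqVneq i j.
  rewrite /q ij divff ?expf_neq0// mul1r; under eq_bigr do rewrite expr1n.
  by rewrite sumr_const card_ord.
rewrite mul0r; apply: (@mulfI _ (q - 1)).
  rewrite subr_eq0; apply: contra ij => /eqP q1.
  have : z ^+ i == z ^+ j by rewrite -[z ^+ i](divfK (_ : z ^+ j != 0)) ?expf_neq0// -/q q1 mul1r.
  by rewrite (eq_prim_root_expr zN) !modn_small.
by rewrite mulr0 -subrX1 /q expr_div_n -!exprM !(mulnC _ N) !exprM (prim_expr_order zN) !expr1n divr1 subrr.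
Qed.

Lemma sum_norm_le_signed (r : ind -> R) J0 (e : R) :
  (forall J, J `<=` J0 -> `|\sum_(i <- J) r i| <= e) -> \sum_(i <- J0) `|r i| <= 2 * e.
Proof.
move=> h; rewrite (big_fsetID _ (fun i => 0 <= r i) J0)/= mulr_natl mulr2n; apply: lerD.
  rewrite (eq_big_seq r); last by move=> i; rewrite !inE => /andP[_ ri]; rewrite ger0_norm.
  by apply: le_trans (ler_norm _) (h _ _); apply/fsubsetP => i; rewrite !inE => /andP[].
rewrite (eq_big_seq (fun i => - r i)); last first.
  by move=> i; rewrite !inE -ltNge => /andP[_ ri]; rewrite ltr0_norm.
rewrite sumrN; apply: le_trans (ler_norm _) _; rewrite normrN; apply: h.
by apply/fsubsetP => i; rewrite !inE => /andP[].
Qed.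

(** For [J] inside [B] the sum over [J] is a difference of sums over two sets containing [A], hence
    at most [2 * e]. Real and imaginary parts, each split by sign, account for the further factor
    4. *)
Lemma sum_norm_tail d A (e : R) :
  (forall J, A `<=` J -> normc (\sum_(i <- J) d i) <= e) ->
  forall B, [disjoint B & A]%fset -> \sum_(i <- B) normc (d i) <= 8 * e.
Proof.
move=> dA B BA.
have dB J : J `<=` B -> normc (\sum_(i <- J) d i) <= 2 * e.
  move=> JB; have -> : J = (A `|` J) `\` A.
    by rewrite fsetDUl fsetDv fset0U; apply/esym/fsetDidPl; apply: fdisjointWl BA.
  rewrite -fset_sumB ?fsubsetUl//; apply: le_trans (normcD _ _) _.
  by rewrite normcN mulr_natl mulr2n lerD// dA// fsubsetUl.
have hR : \sum_(i <- B) `|complex.Re (d i)| <= 2 * (2 * e).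
  apply: sum_norm_le_signed => J /dB; apply: le_trans.
  by rewrite -(big_morph _ (@cReD R) (erefl : complex.Re (0 : C) = 0)) normc_Re.
have hI : \sum_(i <- B) `|complex.Im (d i)| <= 2 * (2 * e).
  apply: sum_norm_le_signed => J /dB; apply: le_trans.
  by rewrite -(big_morph _ (@cImD R) (erefl : complex.Im (0 : C) = 0)) normc_Im.
apply: (@le_trans _ _ (\sum_(i <- B) (`|complex.Re (d i)| + `|complex.Im (d i)|))).
  by apply: ler_sum => i _; exact: normc_le.
by rewrite big_split/=; lra.
Qed.

Lemma partial_sum_cvg x (L : C) (e : R) :
  summability.partial_sum x @ summability.totally --> L -> 0 < e ->
  exists A, forall J, A `<=` J -> normc (L - \sum_(i <- J) x i) <= e.
Proof.
move=> xL e0; have tF := @summability.totally_filter ind.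
have /cvgrPdist_le/(_ e%:C) := xL; rewrite ltcR => /(_ e0)[A _ hA].
by exists A => J AJ; have := hA J AJ; rewrite /= partial_sumE normcC lecR.
Qed.

(* Unconditional convergence makes the partial sums uniformly small on the torus,
   and averaging them over roots of unity extracts the coefficient. *)
Lemma power_series_unique d :
  (forall (w : Cn) (e : R), 0 < e -> exists A, forall J, A `<=` J ->
    normc (\sum_(i <- J) d i * monom w i) <= e) -> forall j, d j = 0.
Proof.
move=> tail j.
suff h (e : R) : 0 < e -> normc (d j) <= 9 * e.
  apply/eq0_normc/le_anti; rewrite normc_ge0 andbT; apply/ler_addgt0Pl => e e0.
  by have := h (e / 9) (divr_gt0 e0 (ltr0Sn _ 8)); rewrite addr0 mulrC divfK// pnatr_eq0.
move=> e0.
have mon1 (i : ind) : monom (const_mx 1 : Cn) i = 1.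
  by rewrite /monom big1// => k _; rewrite mxE expr1n.
have [A hA] := tail (const_mx 1) e e0.
have dA J : A `<=` J -> normc (\sum_(i <- J) d i) <= e.
  by move=> /hA; under eq_bigr do rewrite mon1 mulr1.
have sA := sum_norm_tail dA.
have torus (w : Cn) : (forall k, normc (w 0 k) = 1) -> forall J, A `<=` J ->
    normc (\sum_(i <- J) d i * monom w i) <= 9 * e.
  move=> w1 J AJ; have [A' hA'] := tail w e e0.
  have nm (i : ind) : normc (monom w i) = 1.
    by rewrite normc_prod big1// => k _; rewrite normcX w1 expr1n.
  have -> : \sum_(i <- J) d i * monom w i = \sum_(i <- J `|` A') d i * monom w i -
      \sum_(i <- (J `|` A') `\` J) d i * monom w i.
    by rewrite -fset_sumB ?fsubsetUl// opprB addrC subrK.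
  apply: le_trans (normcD _ _) _; rewrite normcN.
  have -> : 9 * e = e + 8 * e by lra.
  apply: lerD; first by rewrite hA'// fsubsetUr.
  apply: le_trans (normc_sum _ _ _) _; under eq_bigr do rewrite normcM nm mulr1.
  apply: sA; rewrite fdisjoint_sym; apply: fdisjointWl AJ _.
  by apply/fdisjointP => i iJ; rewrite !inE iJ.
(* The box must contain [A] for the bound and [j] for the extraction; its exponents are below [N],
   so [N]-th roots of unity tell them apart. *)
have [N0 hN0] := sub_box (j |` A); pose N := N0.+1.
have /fsubsetP jA := hN0 N (leqnSn _).
have jN : j \in box n N by apply: jA; rewrite !inE eqxx.
have AN : A `<=` box n N by apply/fsubsetP => i iA; apply: jA; rewrite !inE iA orbT.
have [z zN] := @prim_root_exists N isT.
have z1 m : normc (z ^+ m) = 1.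
  rewrite normcX; have : normc z ^+ N = 1 by rewrite -normcX (prim_expr_order zN) normc1.
  by move=> /eqP; rewrite pexpr_eq1 ?normc_ge0// => /eqP ->; rewrite expr1n.
pose w (m : {ffun 'I_n -> 'I_N}) : Cn := \row_k z ^+ m k.
(* Discrete Cauchy formula over [N ^ n] points of the torus: by [root_sum] only the index [j]
   survives. *)
pose S := \sum_m (\sum_(i <- box n N) d i * monom (w m) i) * (monom (w m) j)^-1.
have wm m (i : ind) : monom (w m) i = \prod_k (z ^+ m k) ^+ i k.
  by apply: eq_bigr => k _; rewrite mxE.
have ES : S = d j * (N ^ n)%:R.
  rewrite /S; under eq_bigr do rewrite mulr_suml; rewrite exchange_big/=.
  have E (i : ind) : i \in box n N -> \sum_m d i * monom (w m) i / monom (w m) j =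
      d i * \prod_k ((i k == j k)%:R * N%:R).
    move=> iN; rewrite (eq_bigr (fun m : {ffun 'I_n -> 'I_N} =>
        d i * \prod_k ((z ^+ m k) ^+ i k * ((z ^+ m k) ^+ j k)^-1))); last first.
      by move=> m _; rewrite !wm -mulrA -prodfV -big_split.
    rewrite -mulr_sumr; congr (_ * _).
    rewrite -(bigA_distr_bigA (fun k (m : 'I_N) => (z ^+ m) ^+ i k * ((z ^+ m) ^+ j k)^-1)).
    move: iN jN; rewrite !mem_box => /forallP iN /forallP jN.
    by apply: eq_bigr => k _; rewrite (root_sum zN).
  rewrite (eq_big_seq _ E) (big_fsetD1 j)//= [X in _ + X]big_seq [X in _ + X]big1 ?addr0.
    congr (_ * _); rewrite natrX; under eq_bigr do rewrite eqxx mul1r.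
    by rewrite prodr_const card_ord.
  move=> i; rewrite !inE => /andP[ij _].
  have [k kij] : exists k, i k != j k.
    apply/existsP; rewrite -negb_forall; apply: contra ij => /forallP h.
    by apply/eqP/ffunP => k; apply/eqP.
  by rewrite (bigD1 k)//= (negbTE kij) !mul0r mulr0.
have : normc S <= (N ^ n)%:R * (9 * e).
  apply: le_trans (normc_sum _ _ _) _.
  apply: (@le_trans _ _ (\sum_(m : {ffun 'I_n -> 'I_N}) 9 * e)).
    apply: ler_sum => m _; rewrite normcM normcV.
    have -> : normc (monom (w m) j) = 1.
      by rewrite wm normc_prod big1// => k _; rewrite normcX z1 expr1n.
    by rewrite invr1 mulr1 torus// => k; rewrite mxE z1.
  by rewrite sumr_const card_ffun !card_ord -[leLHS]mulr_natl.
rewrite ES normcM -(realc_nat R) normcRe ger0_norm// mulrC ler_pM2l//.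
by rewrite ltr0n expn_gt0.
Qed.

End uniqueness.

(** * The series [star_shift] as a Gaussian integral *)

Section star_shift.
Variables (R : realType) (n : nat).
Local Notation C := R[i].
Local Notation Cn := 'rV[C]_n.
Local Open Scope fset_scope.
Local Open Scope ring_scope.
Implicit Types (g u : Cn -> C) (w z : Cn).

(** [coefs] is known only through the convergence of its partial sums, without a rate. Uniqueness
    identifies it with the explicit expansion obtained for [c], from which it inherits the rate. *)
Lemma coefs_box_cvg g (c : R) : tame g -> 0 < c ->
  exists2 M : R, 0 <= M &
    forall w, box_cvg (fun i => coefs g i * monom w i) (g w) (M * expR (c * sq w)).
Proof.
move=> sg c0; have [b [M [M0 hb]]] := tame_expansion_small sg c0.
have hg : forall w, summability.partial_sum (fun i => coefs g i * monom w i) @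
    summability.totally --> g w.
  rewrite /coefs; set P := [set a | _].
  suff : P (get P) by [].
  by apply: getPex; exists b => w; exact: box_cvg_partial_sum (hb w).
exists M => //; suff -> : coefs g = b by [].
apply/funext => j; apply/eqP; rewrite -subr_eq0; apply/eqP; move: j.
apply: (@power_series_unique R n (fun i => coefs g i - b i)) => w e e0.
have [A hA] := partial_sum_cvg (hg w) (divr_gt0 e0 (ltr0Sn _ 1)).
have [B hB] := partial_sum_cvg (box_cvg_partial_sum (hb w)) (divr_gt0 e0 (ltr0Sn _ 1)).
exists (A `|` B) => J; rewrite fsubUset => /andP[/hA hJ1 /hB hJ2].
under eq_bigr do rewrite mulrBl.
rewrite sumrB; move: hJ1 hJ2; move: (\sum_(i <- J) _) (\sum_(i <- J) _) => y x h1 h2.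
have -> : x - y = (g w - y) - (g w - x) by ring.
by apply: le_trans (normcD _ _) _; rewrite normcN [leRHS]splitr lerD.
Qed.

(** The remainder of the series of [g] at [z - y] decays geometrically, uniformly up to a
    Gaussian-integrable factor in [y], so sum and integral are exchanged with an explicit error. *)
Lemma star_shiftE g u z : tame g -> tame u ->
  star_shift g u z = EV (fun y => u y * cj (g (z - y)) * cexp (hdot z y)).
Proof.
move=> sg su; have gu := tame_subgauss su.
(* [sqD_le] doubles [1/16] when [sq (z - y)] is split; the resulting [1/8] and the [1/4] of the
   other factors together stay below [1/2]. *)
have c0 : 0 < 1 / 16 :> R by lra.
have h12 : 1 / 2 < 1 :> R by lra.
have [M M0 hM] := coefs_box_cvg sg c0.
have gk : subgauss (fun y => u y * cexp (hdot z y)) by exact: subgauss_hdot.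
have [_ /(_ (1 / 4))[|M1 M10 hM1]] := gk; first by lra.
have sgz : tame (fun y => g (z - y)).
  have := tame_affine (-1) z sg; congr tame; apply/funext => y.
  by rewrite scaleN1r.
have gG : subgauss (fun y => u y * cj (g (z - y)) * cexp (hdot z y)).
  by apply: subgauss_hdot; apply: subgaussM => //; apply: subgauss_cj; exact: tame_subgauss.
pose m (i : mindex n) (y : Cn) := \prod_k (cj (z 0 k) - cj (y 0 k)) ^+ i k.
have mE i y : m i y = cj (monom (z - y) i).
  rewrite /monom conjc_prod; apply: eq_bigr => k _.
  by rewrite !mxE conjcX conjcD conjcN.
have gm i : subgauss (fun y => cj (coefs g i) * (u y * m i y * cexp (hdot z y))).
  apply: subgaussM; first exact: subgauss_cst.
  apply: subgauss_hdot; apply: subgaussM => //; exact: subgauss_mexp.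
suff h : box_cvg (fun i : mindex n => cj (coefs g i) * shift_partial i u z)
    (EV (fun y => u y * cj (g (z - y)) * cexp (hdot z y)))
    (M * expR (1 / 8 * sq z) * M1 * (1 - 1 / 2)^-1 ^+ n).
  have tF := @summability.totally_filter (mindex n).
  apply: (@cvg_lim C); first exact: norm_hausdorff.
  exact: (box_cvg_partial_sum h).
move=> K J KJ.
have e3 : EVI (fun y => \sum_(i <- J) cj (coefs g i) * (u y * m i y * cexp (hdot z y))).
  by apply: EVI_sum => i _; exact: subgauss_EVI.
have -> : \sum_(i <- J) cj (coefs g i) * shift_partial i u z =
    EV (fun y => \sum_(i <- J) cj (coefs g i) * (u y * m i y * cexp (hdot z y))).
  rewrite EV_sum; last by move=> i _; exact: subgauss_EVI.
  apply: eq_bigr => i _; rewrite shift_partialE// EVZ//; apply: subgauss_EVI.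
  by apply: subgauss_hdot; apply: subgaussM => //; exact: subgauss_mexp.
rewrite -EVB//; last exact: subgauss_EVI.
pose T (y : Cn) := cj (g (z - y) - \sum_(i <- J) coefs g i * monom (z - y) i).
have ET y : u y * cj (g (z - y)) * cexp (hdot z y) -
    \sum_(i <- J) cj (coefs g i) * (u y * m i y * cexp (hdot z y)) =
    u y * cexp (hdot z y) * T y.
  rewrite /T conjcD conjcN conjc_sum mulrBr mulrAC; congr (_ - _).
  rewrite mulr_sumr; apply: eq_bigr => i _; rewrite mE conjcM.
  by move: (cj _) (cj _) (u y) (cexp _) => a b c d; ring.
have bT y : normc (u y * cexp (hdot z y) * T y) <=
    (M * expR (1 / 8 * sq z) * M1 / 2 ^+ K) * expR (1 / 2 * sq y).
  have := hM (z - y) K J KJ; rewrite -[X in X <= _]normc_conj -/(T y) => b1.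
  rewrite normcM; apply: le_trans (ler_pM (normc_ge0 _) (normc_ge0 _) (hM1 y) b1) _.
  have : expR (1 / 16 * sq (z - y)) <= expR (1 / 8 * sq z) * expR (1 / 8 * sq y).
    rewrite -expRD ler_expR; have := sqD_le z (- y); rewrite sqN => h; lra.
  have : expR (1 / 4 * sq y) * expR (1 / 8 * sq y) <= expR (1 / 2 * sq y).
    by rewrite -expRD ler_expR; have := sq_ge0 y; lra.
  have := expR_ge0 (1 / 4 * sq y); have := expR_ge0 (1 / 8 * sq z).
  move: (expR (1 / 4 * _)) (expR (1 / 8 * sq z)) (expR (1 / 8 * sq y)) (expR (1 / 2 * _))
    (expR (1 / 16 * _)) => a b c d e b0 a0 h1 h2.
  have q0 : 0 <= (2 ^+ K)^-1 :> R by rewrite invr_ge0 exprn_ge0.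
  move: (2 ^+ K)^-1 q0 => q q0.
  apply: (@le_trans _ _ (M1 * a * (M * (b * c) * q))).
    apply: ler_wpM2l; first exact: mulr_ge0.
    by apply: ler_wpM2r => //; apply: ler_wpM2l.
  have -> : M1 * a * (M * (b * c) * q) = M * b * M1 * q * (a * c) by ring.
  by apply: ler_wpM2l => //; rewrite !mulr_ge0.
rewrite (eq_EV ET); apply: le_trans (normc_EV_le _ h12 bT) _.
  by move: (EVIB (subgauss_EVI gG) e3); congr EVI; apply/funext => y; exact: ET.
rewrite le_eqVlt; apply/orP; left; apply/eqP.
by move: (expR _) (_ ^+ n) ((2 ^+ K)^-1) => a b c; ring.
Qed.

Lemma star_shift_smeared g u z : tame g -> tame u -> star_shift g u z = smeared (-1) u g z z.
Proof.
move=> sg su; rewrite star_shiftE//.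
have sgz : tame (fun y => g (z - y)).
  have := tame_affine (-1) z sg; congr tame; apply/funext => y.
  by rewrite scaleN1r.
have := EV_shift z su sgz => /= <-.
apply: eq_EV => y; rewrite scaleN1r; congr (u _ * cj (g _)).
by rewrite addrC.
Qed.

End star_shift.

Theorem theorem5 (R : realType) (n : nat) (hn : (1 <= n)%N)
    (f g u v : 'rV[R[i]]_n -> R[i])
    (hf : in_Sym f /\ entire f) (hg : in_Sym g /\ entire g)
    (hu : in_Sym u /\ entire u) (hv : in_Sym v /\ entire v) :
  let a := zero_on_kernels
    (commutator (toeplitz (fun z => f z + (g z)^*))
                (toeplitz (fun z => u z + (v z)^*))) in
  let b := berezin (fun z => u z * (g z)^* - f z * (v z)^*)
    = (fun z => u z * (g z)^* - f z * (v z)^*) in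
  let c := forall z : 'rV[R[i]]_n,
    u z * (g z)^* - f z * (v z)^* = star_shift g u z - star_shift v f z in
  (a <-> b) /\ (b <-> c).
Proof.
have entire_tame h : in_Sym h /\ entire h -> tame h.
  by move=> [sh eh]; apply: in_Sym_tame => //; exact: entire_line_holo.
have [sf sg su sv] : [/\ tame f, tame g, tame u & tame v] by split; exact: entire_tame.
pose phi z w := u z * cj (g w) - f z * cj (v w).
pose Psi s z w := smeared s u g z w - smeared s f v z w.
have aP := commutator_zeroP sf sg su sv.
have polar s : (forall z, Psi s z z = phi z z) -> forall z w, Psi s z w = phi z w.
  exact: smeared_polarize.
have flip s : (forall z w, Psi s z w = phi z w) -> forall z, Psi (- s) z z = phi z z.
  exact: smeared_flip.
have bP : berezin (fun z => u z * (g z)^* - f z * (v z)^*)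
    = (fun z => u z * (g z)^* - f z * (v z)^*) <-> forall z, Psi 1 z z = phi z z.
  split=> [h z|h]; last by apply/funext => z; have := h z; rewrite /Psi -berezinE.
  by have := congr1 (fun F => F z) h; rewrite berezinE.
have cP : (forall z, u z * (g z)^* - f z * (v z)^* = star_shift g u z - star_shift v f z)
    <-> forall z, Psi (-1) z z = phi z z.
  by split=> h z; have := h z; rewrite !star_shift_smeared.
split; split.
- by move=> /aP h; apply/bP => z; exact: h.
- by move=> /bP/polar h; apply/aP.
(* [flip] needs the identity off the diagonal, hence [polar] before it. The converse runs the same
   argument from [s = -1], where [flip] leads back to 1. *)
- by move=> /bP/polar/flip h; apply/cP.
- by move=> /cP/polar/flip; rewrite opprK => h; apply/bP.
Qed.
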